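(* Let $L \in \mathbb{R}^{n\times n}$ be negative semidefinite, $B \in \mathbb{R}^{n\times n}$, $X_0 \in \mathbb{R}^n$, $t \in [0,1]$, and let $m \ge 2$ be an integer. Let $X_t$ be the solution of $dX_t = L X_t\,dt + B\,dW_t$ with initial value $X_0$, and let $X_t^m$ be the approximation $$X_t^m = e^{tL}X_0 + \sqrt{2}\sum_{k=1}^m \varphi_{k,t}^{\cos}(L)\,B\,Z_k .$$ Then $$\mathbb{E}\left(\|X_t - X_t^m\|^2\right) = 2\sum_{k=m+1}^\infty \left\|\varphi_{k,t}^{\cos}(L)B\right\|_F^2 \le \frac{2\|B\|^2}{\pi^2}\,\frac{n}{m-1}.$$
   Context: A matrix $L\in\mathbb{R}^{n\times n}$ is called negative semidefinite if its numerical range $\{x^*Lx : x\in\mathbb{C}^n, \|x\|_2=1\}$ is contained in $\mathbb{R}_{\le 0}$ (so $L$ is symmetric). $\|\cdot\|$ is the Euclidean norm on vectors and the induced spectral norm on matrices; $\|\cdot\|_F$ is the Frobenius norm. $W_t$ is a standard $n$-dimensional Wiener process with Karhunen--Lo\`eve expansion $W_t = \sqrt{2}\sum_{k=1}^\infty Z_k \frac{\sin(\lambda_k t)}{\lambda_k}$ for $t\in[0,1]$ (convergence in $L^2$), where $\lambda_k = (k-\tfrac12)\pi$ and $Z_1,Z_2,\dots$ are independent $\mathbb{R}^n$-valued random vectors whose components are all independent $\mathcal{N}(0,1)$ random variables. The same $Z_k$ are used in the definition of $X_t^m$. The solution of the stochastic differential equation is $X_t = e^{tL}X_0 + \int_0^t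 e^{(t-s)L}B\,dW_s$ (It\^o integral). The function $\varphi_{k,t}^{\cos}$ is the entire function $\varphi_{k,t}^{\cos}(z) = \int_0^t e^{(t-s)z}\cos(\lambda_k s)\,ds = \frac{z e^{zt} - z\cos(\lambda_k t)+\lambda_k\sin(\lambda_k t)}{z^2+\lambda_k^2}$, and $\varphi_{k,t}^{\cos}(L)$ is the corresponding matrix function, i.e. $\varphi_{k,t}^{\cos}(L)=\int_0^t e^{(t-s)L}\cos(\lambda_k s)\,ds$. *)

(* Defs.v *)
From HB Require Import structures.
From mathcomp Require Import all_boot all_order all_algebra.
From mathcomp Require Import complex.
From mathcomp Require Import all_classical all_reals all_analysis.

Set Implicit Arguments.
Unset Strict Implicit.
Unset Printing Implicit Defensive.

Import Order.TTheory GRing.Theory Num.Theory.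
Import numFieldNormedType.Exports.

Local Open Scope classical_set_scope.
Local Open Scope ring_scope.

Section matrices.
Context {R : realType}.

Definition vnorm2 n (x : 'cV[R]_n) : R := Num.sqrt (\sum_i x i 0 ^+ 2).

(* Spectral norm; the unit ball (not the unit sphere) keeps the set nonempty
   when n = 0. *)
Definition opnorm2 n (A : 'M[R]_n) : R :=
  sup [set vnorm2 (A *m x) | x in [set x : 'cV[R]_n | vnorm2 x <= 1]].

Definition frobenius n (A : 'M[R]_n) : R :=
  Num.sqrt (\sum_i \sum_j A i j ^+ 2).

Definition numerical_range n (L : 'M[R]_n) : set R[i] :=
  [set ((map_mx Num.conj x)^T *m map_mx (real_complex R) L *m x) 0 0
     | x in [set x : 'cV[R[i]]_n | sqrtC (\sum_i `|x i 0| ^+ 2) = 1]].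

(* In the partial order of R[i], z <= 0 means that z is real and nonpositive. *)
Definition negative_semidefinite n (L : 'M[R]_n) : Prop :=
  numerical_range L `<=` [set z | z <= 0].

Definition expmx n (A : 'M[R]_n) : 'M[R]_n :=
  \matrix_(i, j) limn (series (fun k => (A ^+ k) i j / k`!%:R)).

Definition lambda (k : nat) : R := (k%:R - 2^-1) * pi.

Definition phicos (k : nat) (t : R) n (L : 'M[R]_n) : 'M[R]_n :=
  \matrix_(i, j) Rintegral lebesgue_measure `[0, t]
    (fun s => expmx ((t - s) *: L) i j * cos (lambda k * s)).

End matrices.

Section probability.
Context d (T : measurableType d) (R : realType) (P : probability T R).

Definition sigma_of (I : Type) (D : set I) (X : I -> T -> R) : set (set T) :=
  <<s \bigcup_(i in D) preimage_set_system setT (X i) measurable >>.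

Definition independent_sigma (F G : set (set T)) : Prop :=
  forall A B, F A -> G B -> P (A `&` B) = (P A * P B)%E.

Definition mutually_independent (I : eqType) (X : I -> T -> R) : Prop :=
  forall (s : seq I) (A : I -> set R), uniq s ->
    (forall i, measurable (A i)) ->
    P (\bigcap_(i in [set` s]) (X i @^-1` A i)) =
    (\prod_(i <- s) P (X i @^-1` A i))%E.

Definition has_law (X : T -> R) (mu : set R -> \bar R) : Prop :=
  forall A, measurable A -> pushforward P X A = mu A.

Definition rvec n (X : 'I_n -> T -> R) (w : T) : 'cV[R]_n := \col_j X j w.

Definition natural_filtration n (D : set R) (W : R -> 'I_n -> T -> R) (s : R)
    : set (set T) :=
  sigma_of [set uj : R * 'I_n | D uj.1 /\ uj.1 <= s] (fun uj => W uj.1 uj.2).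

(* D is the time set of the process.  The second argument of normal_prob is
   the standard deviation. *)
Record standard_wiener n (D : set R) (W : R -> 'I_n -> {RV P >-> R}) : Prop := {
  wiener0 : forall j, {ae P, forall w, W 0 j w = 0} ;
  wiener_increment_law : forall s t j, D s -> D t -> s < t ->
    has_law (W t j \- W s j) (normal_prob 0 (Num.sqrt (t - s))) ;
  wiener_components_independent : forall s t, D s -> D t -> s < t ->
    mutually_independent (fun j => W t j \- W s j) ;
  wiener_increment_independent : forall s t, D s -> D t -> s < t ->
    independent_sigma (natural_filtration D W s)
      (sigma_of setT (fun j => W t j \- W s j)) ;
  wiener_continuous : forall j,
    {ae P, forall w, {within D, continuous (fun t => W t j w)}} }.

(* A bounded F-adapted process on [0, t], equal to coef i on
   [time i, time i.+1[ for i < size. *)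
Record simple_process (F : R -> set (set T)) (t : R) := SimpleProcess {
  sp_size : nat ;
  sp_time : nat -> R ;
  sp_coef : nat -> T -> R ;
  sp_time0 : sp_time 0%N = 0 ;
  sp_timeT : sp_time sp_size = t ;
  sp_time_lt : forall i, (i < sp_size)%N -> sp_time i < sp_time i.+1 ;
  sp_adapted : forall i (A : set R), (i < sp_size)%N -> measurable A ->
    F (sp_time i) (sp_coef i @^-1` A) ;
  sp_bounded : forall i, (i < sp_size)%N ->
    exists M : R, forall w, `|sp_coef i w| <= M }.

Definition sp_val F t (H : simple_process F t) (s : R) (w : T) : R :=
  \sum_(i < sp_size H)
    sp_coef H i w * \1_(`[sp_time H i, sp_time H i.+1[%classic) s.

Definition sp_integral F t (H : simple_process F t) (W : R -> T -> R) (w : T)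
    : R :=
  \sum_(i < sp_size H)
    sp_coef H i w * (W (sp_time H i.+1) w - W (sp_time H i) w).

(* I is (a version of) the Ito integral over [0, t] of the process f with
   respect to the scalar F-Wiener process W: it is the L^2(P) limit of the
   integrals of simple F-adapted processes converging to f in
   L^2(P x Lebesgue). *)
Definition is_ito_integral (F : R -> set (set T)) (W : R -> T -> R) (t : R)
    (f : R -> T -> R) (I : {RV P >-> R}) : Prop :=
  exists H : nat -> simple_process F t,
    ((\int[P]_w \int[lebesgue_measure]_(s in `[0%R, t])
       ((f s w - sp_val (H k) s w) ^+ 2)%R%:E)%E @[k --> \oo] --> 0%E) /\
    ('E_P[fun w => ((I w - sp_integral (H k) W w) ^+ 2)%R]%E @[k --> \oo] --> 0%E).

(* X_t = e^{tL} X0 + \int_0^t e^{(t-s)L} B dW_s for t in D, the vector-valued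
   Ito integral being the componentwise sum of scalar ones. *)
Definition sde_solution n (D : set R) (L B : 'M[R]_n) (X0 : 'cV[R]_n)
    (W X : R -> 'I_n -> {RV P >-> R}) : Prop :=
  forall t, D t -> exists I : 'I_n -> 'I_n -> {RV P >-> R},
    (forall i j, is_ito_integral (natural_filtration D W) (W^~ j) t
       (fun s _ => (expmx ((t - s) *: L) *m B) i j) (I i j)) /\
    {ae P, forall w, forall i,
       X t i w = (expmx (t *: L) *m X0) i 0 + \sum_j I i j w}.

(* Here and below Z is indexed from 1: Z 0 is not used. *)
Definition iid_standard_normal n (Z : nat -> 'I_n -> {RV P >-> R}) : Prop :=
  (forall k j, (0 < k)%N -> has_law (Z k j) (normal_prob 0 1)) /\
  mutually_independent (fun kj : nat * 'I_n => Z kj.1.+1 kj.2 : T -> R).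

Definition karhunen_loeve n (W : R -> 'I_n -> {RV P >-> R})
    (Z : nat -> 'I_n -> {RV P >-> R}) : Prop :=
  forall t : R, 0 <= t <= 1 ->
    'E_P[fun w => (vnorm2 (rvec (W t) w - Num.sqrt 2 *:
       \sum_(1 <= k < N.+1) (sin (lambda k * t) / lambda k) *: rvec (Z k) w)
       ^+ 2)%R]%E @[N --> \oo] --> 0%E.

Definition Xapprox n (L B : 'M[R]_n) (X0 : 'cV[R]_n)
    (Z : nat -> 'I_n -> {RV P >-> R}) (m : nat) (t : R) (w : T) : 'cV[R]_n :=
  expmx (t *: L) *m X0 +
  Num.sqrt 2 *: \sum_(1 <= k < m.+1) phicos k t L *m B *m rvec (Z k) w.

End probability.

(* Main.v *)
Require Import Defs.
From HB Require Import structures.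
From mathcomp Require Import all_boot all_order all_algebra.
From mathcomp Require Import complex.
From mathcomp Require Import all_classical all_reals all_analysis.
From mathcomp Require Import measurable_realfun.
From mathcomp Require Import spectral.
From mathcomp Require Import ring lra.

Set Implicit Arguments.
Unset Strict Implicit.
Unset Printing Implicit Defensive.

Import Order.TTheory GRing.Theory Num.Theory.
Import numFieldNormedType.Exports.

Local Open Scope classical_set_scope.
Local Open Scope ring_scope.

(** The stochastic integral in X_t has the entries
I_ij = int_0^t f_ij(s) dW^j_s with f_ij(s) = (e^{(t-s)L} B)_ij deterministic and
Lipschitz on [0, t].

Equality. The variables Z_k^j are orthonormal in L^2(P), and by the
Karhunen-Loeve expansion every W^j_s lies in the closed span of (Z_k^j)_k with
coefficients sqrt 2 sin(lambda_k s) / lambda_k. The integral I_ij is an L^2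
limit of Riemann sums sum_i f_ij(s_i) (W^j_{s_{i+1}} - W^j_{s_i}): the Ito
isometry, applied to the difference of a defining simple process and a
deterministic step function, bounds the error (ito_step_bound). Hence I_ij lies
in the same closed span (spanned_ito). Because sin(lambda b) - sin(lambda a) is
lambda times the integral of cos(lambda s) over [a, b], the coefficient of a
Riemann sum is a Riemann sum of a cosine integral, and in the limit the
coefficient of I_ij on Z_k^j is sqrt 2 (phicos_k(L) B)_ij (ip_ito). Subtracting
X_t^m removes the terms with k <= m, and Parseval gives the error
(sum_sqn_error_component).

Bound. A spectral decomposition of L (nsd_spectral) reduces the claim to a
scalar one (frobenius_phicos_tail): for z <= 0,
sum_{k > m} phicos_k(z)^2 <= 1 / (pi^2 (m - 1)) (phicos_scalar_tail). The
termwise estimate |phicos_k(z)| <= 1 / (pi (k - 1)), which would give this by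
summation, holds when t is not small but fails in general: lambda_k |phicos_k(z)|
can exceed 1 by an amount of order 1 / (lambda_k t), at those k where
sin(lambda_k t) is close to -1. The proof therefore distinguishes three regimes.
For t >= 4/15 the termwise estimate holds. For smaller t, as long as
lambda_k t <= pi, the sine is nonnegative and lambda_k |phicos_k(z)| <= 1.
Beyond that point,
lambda_k |phicos_k(z)| <= (1 + |sin(lambda_k t)|) / 2 + (2/5) / (lambda_k t),
and the sine cannot stay close to -1: summation by parts replaces the square of
the first term by its average, at most 3/4, which leaves room for the second
term. *)

(** * Moments of a centred normal variable *)

Section normal_moments.
Context (R : realType).
Local Notation mu := (@lebesgue_measure R).

Lemma ge0_integral_normal_prob (s : R) (f : R -> \bar R) :
  measurable_fun [set: R] f -> (forall x, 0 <= f x)%E ->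
  (\int[normal_prob 0 s]_x f x = \int[mu]_x (f x * (normal_pdf 0 s x)%:E))%E.
Proof.
move=> mf f0.
have dom : normal_prob 0 s `<< mu := @normal_prob_dominates R 0 s.
rewrite -(Radon_Nikodym_SigmaFinite.change_of_variables dom f0)//.
have mpdf : measurable_fun [set: R] (EFin \o normal_pdf 0 s).
  by apply/measurable_EFinP; exact: measurable_normal_pdf.
have ig := Radon_Nikodym_SigmaFinite.f_integrable dom.
have mg := measurable_int _ ig.
apply: ae_eq_integral => //.
- exact: emeasurable_funM.
- exact: emeasurable_funM.
apply: ae_eqe_mul2l; apply: integral_ae_eq => //.
by move=> E _ mE; rewrite -Radon_Nikodym_SigmaFinite.f_integral.
Qed.

Section density.
Variables (s : R) (s0 : 0 < s).
Local Notation p := (normal_pdf 0 s : R -> R).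

Let sneq0 : s != 0. Proof. by rewrite gt_eqF. Qed.

Let pE x : p x = normal_peak s * expR (- (x ^+ 2) / (s ^+ 2 *+ 2)).
Proof. by rewrite normal_pdfE// /normal_fun subr0. Qed.

Let mp : measurable_fun [set: R] p.
Proof. exact: measurable_normal_pdf. Qed.

Let cp : continuous p.
Proof. exact: continuous_normal_pdf. Qed.

Lemma is_derive_normal_pdf (x : R) : is_derive x 1 p (- (x / s ^+ 2) * p x).
Proof.
have -> : p = (fun x => normal_peak s *: expR (- (x ^+ 2) / (s ^+ 2 *+ 2))).
  by apply/funext => y; rewrite pE.
have H : is_derive x 1 (fun x : R => - (x ^+ 2) / (s ^+ 2 *+ 2)) (- (x / s ^+ 2)).
  have -> : (fun x : R => - (x ^+ 2) / (s ^+ 2 *+ 2)) =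
      (fun x : R => - (s ^+ 2 *+ 2)^-1 *: x ^+ 2).
    by apply/funext => y; rewrite /GRing.scale/=; ring.
  apply: is_derive_eq.
  rewrite /GRing.scale/= .
  by field.
apply: is_derive_eq; rewrite /GRing.scale/=; ring.
Qed.

(** Since p' = - x p / s^2, the function - s^2 x p is an antiderivative of
(x^2 - s^2) p: the variance integral reduces to boundary terms. *)
Lemma is_derive_mul_normal_pdf (x : R) :
  is_derive x 1 (fun x : R => - (s ^+ 2 * (x * p x))) ((x ^+ 2 - s ^+ 2) * p x).
Proof.
have ? := is_derive_normal_pdf x.
have -> : (fun x => - (s ^+ 2 * (x * p x))) = (fun x => - (s ^+ 2) *: (id x * p x)).
  by apply/funext => y; rewrite /GRing.scale/= mulNr.
apply: is_derive_eq; rewrite /GRing.scale/=.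
by field.
Qed.

(** From 1 + y <= exp y at y = x^2 / (2 s^2); this decay makes the boundary
term at infinity vanish. *)
Lemma mul_normal_pdf_ub (x : R) : 0 < x ->
  x * p x <= normal_peak s * (s ^+ 2 *+ 2) / x.
Proof.
move=> x0; rewrite pE ler_pdivlMr//.
have s20 : 0 < s ^+ 2 *+ 2 by rewrite mulrn_wgt0// exprn_gt0.
rewrite mulNr expRN mulrCA -mulrA ler_wpM2l ?normal_peak_ge0//.
have e0 := expR_gt0 (x ^+ 2 / (s ^+ 2 *+ 2)).
rewrite -mulrA (mulrC _ x) mulrA -expr2 ler_pdivrMr// -ler_pdivrMl// mulrC.
by have := expR_ge1Dx (x ^+ 2 / (s ^+ 2 *+ 2)); lra.
Qed.

Lemma cvg_mul_normal_pdf : x * p x @[x --> +oo] --> 0.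
Proof.
apply: (@squeeze_cvgr _ _ _ _ (cst 0)
  (fun x => (normal_peak s * (s ^+ 2 *+ 2)) * x^-1)).
- near=> x; have x0 : 0 < x by near: x; exact: nbhs_pinfty_gt.
  by rewrite mul_normal_pdf_ub// andbT mulr_ge0 ?normal_pdf_ge0// ltW.
- exact: cvg_cst.
- rewrite -[X in _ --> X](mulr0 (normal_peak s * (s ^+ 2 *+ 2))).
  apply: cvgMl_tmp. apply/gtr0_cvgV0; [near=> x; near: x; exact: nbhs_pinfty_gt|exact: cvg_id].
Unshelve. all: by end_near. Qed.
Let continuous_poly_mul_pdf (q : R -> R) : continuous q -> continuous (fun x : R => q x * p x).
Proof. by move=> cq x; apply: cvgM; [exact: cq|exact: cp]. Qed.

Let cx2 : continuous (fun x : R => x ^+ 2).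
Proof. exact: sqr_continuous. Qed.

(** The integrand (x^2 - s^2) p changes sign at s. Its integrals over [0, s] and
over [s, +oo[ are boundary terms, and they are opposite because x p vanishes at
0 and at infinity. *)
Lemma integral_sqr_normal_pdf_halfline :
  (\int[mu]_(x in `[0%R, +oo[) (x ^+ 2 * p x)%:E =
   (s ^+ 2)%:E * \int[mu]_(x in `[0%R, +oo[) (p x)%:E)%E.
Proof.
pose G := fun x : R => - (s ^+ 2 * (x * p x)).
have dG (x : R) := is_derive_mul_normal_pdf x.
have cG : continuous G.
  by move=> x; apply/differentiable_continuous/derivable1_diffP; have [] := dG x.
have cq : continuous (fun x : R => (x ^+ 2 - s ^+ 2) * p x).
  by apply: continuous_poly_mul_pdf => x; apply: cvgB; [exact: cx2|exact: cvg_cst].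
have hi : (\int[mu]_(x in `[s, +oo[) ((x ^+ 2 - s ^+ 2) * p x)%:E = (- G s)%:E)%E.
  rewrite (@ge0_continuous_FTC2y _ _ G _ 0) ?sub0e//.
  - move=> x sx; rewrite mulr_ge0 ?normal_pdf_ge0// subr_ge0.
    by rewrite ler_pXn2r// nnegrE ltW// (lt_le_trans s0).
  - exact: continuous_subspaceT.
  - rewrite -[X in _ --> X]oppr0 -(mulr0 (s ^+ 2)); apply: cvgN.
    by apply: cvgMl_tmp; exact: cvg_mul_normal_pdf.
  - exact/cvg_at_right_filter/cG.
  - by move=> x _; rewrite derive1E; have [_ ->] := dG x.
have lo : (\int[mu]_(x in `[0%R, s]) ((s ^+ 2 - x ^+ 2) * p x)%:E = (- G s)%:E)%E.
  rewrite (@continuous_FTC2 _ _ (fun x => - G x) 0 s)//.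
  - by rewrite -EFinB /G mul0r mulr0 !oppr0 addr0.
  - apply: continuous_subspaceT; apply: continuous_poly_mul_pdf => x.
    by apply: cvgB; [exact: cvg_cst|exact: cx2].
  - split.
    + by move=> x _; apply: derivableN; have [] := dG x.
    + by apply: cvgN; exact/cvg_at_right_filter/cG.
    + by apply: cvgN; exact/cvg_at_left_filter/cG.
  - move=> x _; rewrite derive1E deriveN; last by have [] := dG x.
    by have [_ ->] := dG x; rewrite -mulNr opprB.
have mE (A : set R) (q : R -> R) : continuous q ->
    measurable_fun A (EFin \o (fun x => q x * p x)).
  move=> qc; apply/measurable_EFinP/measurable_funTS.
  by apply: continuous_measurable_fun; exact: continuous_poly_mul_pdf.
have cx1 : continuous (fun x : R => s ^+ 2) by move=> x; exact: cvg_cst.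
have cd : continuous (fun x : R => s ^+ 2 - x ^+ 2).
  by move=> x; apply: cvgB; [exact: cvg_cst|exact: cx2].
have cd' : continuous (fun x : R => x ^+ 2 - s ^+ 2).
  by move=> x; apply: cvgB; [exact: cx2|exact: cvg_cst].
have zs : `[0%R, s]%classic `|` `]s, +oo[%classic = `[0%R, +oo[%classic :> set R.
  by rewrite -itv_bndbnd_setU// bnd_simp ltW.

have e1 (q : R -> R) : continuous q -> (forall x, 0 <= x -> 0 <= q x) ->
  (\int[mu]_(x in `[0%R, +oo[) (q x * p x)%:E =
  \int[mu]_(x in `[0%R, s]) (q x * p x)%:E +
  \int[mu]_(x in `[s, +oo[) (q x * p x)%:E)%E.
  move=> qc q0; rewrite -zs ge0_integral_setU//.
  + by rewrite integral_itv_obnd_cbnd//; exact: mE.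
  + exact: mE.
  + rewrite zs => x /=; rewrite in_itv/= andbT => x0.
    by rewrite lee_fin mulr_ge0 ?q0 ?normal_pdf_ge0.
  + rewrite disj_set2E; apply/eqP; rewrite -subset0 => x/=.
    by rewrite !in_itv/= andbT => -[/andP[_ xs]]; rewrite ltNge xs.
have e2 (A : set R) : measurable A -> (\int[mu]_(x in A) (s ^+ 2 * p x)%:E =
   (s ^+ 2)%:E * \int[mu]_(x in A) (p x)%:E)%E.
  move=> mA; rewrite -ge0_integralZl//.
  + by apply/measurable_EFinP/measurable_funTS.
  + by move=> x _; rewrite lee_fin normal_pdf_ge0.
  + by rewrite lee_fin sqr_ge0.
rewrite -e2// !e1//; do ?by move=> *; exact: sqr_ge0.
have e3 : (\int[mu]_(x in `[0%R, s]) (s ^+ 2 * p x)%:E =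
  \int[mu]_(x in `[0%R, s]) (x ^+ 2 * p x)%:E + (- G s)%:E)%E.
  rewrite -lo -ge0_integralD//.
  + by apply: eq_integral => x _; rewrite -EFinD -mulrDl addrC subrK.
  + by move=> x _; rewrite lee_fin mulr_ge0 ?sqr_ge0 ?normal_pdf_ge0.
  + exact: mE.
  + move=> x /=; rewrite in_itv/= => /andP[x0 xs].
    by rewrite lee_fin mulr_ge0 ?normal_pdf_ge0// subr_ge0 ler_pXn2r// nnegrE ltW.
  + exact: mE.
have e4 : (\int[mu]_(x in `[s, +oo[) (x ^+ 2 * p x)%:E =
  (- G s)%:E + \int[mu]_(x in `[s, +oo[) (s ^+ 2 * p x)%:E)%E.
  rewrite -hi -ge0_integralD//.
  + by apply: eq_integral => x _; rewrite -EFinD -mulrDl subrK.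
  + move=> x /=; rewrite in_itv/= andbT => sx.
    rewrite lee_fin mulr_ge0 ?normal_pdf_ge0// subr_ge0 ler_pXn2r// nnegrE.
      by rewrite ltW.
    by rewrite (le_trans (ltW s0)).
  + exact: mE.
  + by move=> x _; rewrite lee_fin mulr_ge0 ?sqr_ge0 ?normal_pdf_ge0.
  + exact: mE.
by rewrite e3 e4 addeA.
Qed.

Lemma integral_sqr_normal_pdf : (\int[mu]_x (x ^+ 2 * p x)%:E = (s ^+ 2)%:E)%E.
Proof.
have pN (x : R) : p (- x) = p x by rewrite !pE sqrrN.
have half : (2%:E * \int[mu]_(x in [set x | (0 <= x)%R]) (p x)%:E = 1)%E.
  rewrite -ge0_symfun_integralT//.
  - exact: integral_normal_pdf.
  - by move=> x; exact: normal_pdf_ge0.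
  - by move=> x /=; rewrite pN.
rewrite ge0_symfun_integralT.
- rewrite -set_itvcy integral_sqr_normal_pdf_halfline set_itvcy.
  by rewrite muleCA half mule1.
- by move=> x; rewrite mulr_ge0 ?sqr_ge0 ?normal_pdf_ge0.
- exact: continuous_poly_mul_pdf.
- by move=> x /=; rewrite sqrrN pN.
Qed.

(** Symmetry of the density: the positive and the negative part of a centred
normal variable have the same mean, so the variable has mean 0. *)
Lemma integral_pos_neg_normal_pdf :
  (\int[mu]_x ((Num.max x 0) * p x)%:E = \int[mu]_x ((Num.max (- x) 0) * p x)%:E)%E.
Proof.
have pN (x : R) : p (- x) = p x by rewrite !pE sqrrN.
transitivity (\int[mu]_(x in `[0%R, +oo[) (x * p x)%:E)%E.
  rewrite [RHS]integral_mkcond; apply: eq_integral => x _.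
  rewrite patchE; case: ifPn => [|].
    by rewrite inE/= in_itv/= andbT => x0; rewrite max_l.
  rewrite notin_setE/= in_itv/= andbT => /negP; rewrite -ltNge => x0.
  by rewrite max_r ?mul0r// ltW.
transitivity (\int[mu]_(x in `]-oo, (- 0)%R]) (- x * p x)%:E)%E; last first.
  rewrite integral_mkcond; apply: eq_integral => x _.
  rewrite patchE oppr0; case: ifPn => [|].
    by rewrite inE/= in_itv/= => x0; rewrite max_l// oppr_ge0.
  rewrite notin_setE/= in_itv/= => /negP; rewrite -ltNge => x0.
  by rewrite max_r ?mul0r// oppr_le0 ltW.
rewrite (@ge0_integration_by_substitutionNy _ (fun x => - x * p x)).
- by apply: eq_integral => x _ /=; rewrite opprK pN.
- apply: continuous_subspaceT; apply: continuous_poly_mul_pdf.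
  by move=> x; apply: cvgN; exact: cvg_id.
- move=> x; rewrite in_itv/= oppr0 => x0.
  by rewrite mulr_ge0 ?normal_pdf_ge0// oppr_ge0 ltW.
Qed.

End density.
End normal_moments.

Section gaussian_rv.
Context d (T : measurableType d) (R : realType) (P : probability T R).

Lemma ge0_integral_has_law (X : T -> R) (s : R) (f : R -> \bar R) :
  measurable_fun setT X -> has_law P X (normal_prob 0 s) ->
  measurable_fun [set: R] f -> (forall x, 0 <= f x)%E ->
  (\int[P]_w f (X w) =
   \int[lebesgue_measure]_x (f x * (normal_pdf 0 s x)%:E))%E.
Proof.
move=> mX lX mf f0; rewrite -ge0_integral_normal_prob//.
pose X' : {mfun T >-> measurableTypeR R} :=
  HB.pack (X : T -> measurableTypeR R) (isMeasurableFun.Build _ _ T (measurableTypeR R) X mX).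
transitivity (\int[pushforward P X']_y f y)%E.
  by rewrite ge0_integral_pushforward.
by apply: eq_measure_integral => A mA _; exact: lX.
Qed.

Variables (X : T -> R) (s : R).
Hypotheses (s0 : 0 < s) (mX : measurable_fun setT X).
Hypothesis lX : has_law P X (normal_prob 0 s).

Lemma normal_sqr_integral : (\int[P]_w (X w ^+ 2)%:E = (s ^+ 2)%:E)%E.
Proof.
rewrite (ge0_integral_has_law (f := fun x => (x ^+ 2)%:E) mX lX).
- by under eq_integral do rewrite -EFinM; exact: integral_sqr_normal_pdf.
- by apply/measurable_EFinP; exact: measurable_funX.
- by move=> x; rewrite lee_fin sqr_ge0.
Qed.

Lemma normal_sqr_integrable : P.-integrable setT (EFin \o (fun w => X w ^+ 2)).
Proof.
apply/integrableP; split.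
  by apply/measurable_EFinP; exact: measurable_funX.
under eq_integral do rewrite gee0_abs ?lee_fin ?sqr_ge0//.
by rewrite normal_sqr_integral ltry.
Qed.

Lemma sqr_integrable_integrable (Y : T -> R) : measurable_fun setT Y ->
  P.-integrable setT (EFin \o (fun w => Y w ^+ 2)) -> P.-integrable setT (EFin \o Y).
Proof.
move=> mY iY.
have := integrableD measurableT (finite_measure_integrable_cst P 1 measurableT) iY.
apply: le_integrable => //; first exact/measurable_EFinP.
move=> w _ /=; rewrite lee_fin [leRHS]ger0_norm ?addr_ge0 ?sqr_ge0//.
by rewrite ler_norml; apply/andP; split; have := sqr_ge0 (Y w - 1); have := sqr_ge0 (Y w + 1); nra.
Qed.

Lemma normal_integral0 : (\int[P]_w (X w)%:E = 0)%E.
Proof.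
have iX := sqr_integrable_integrable mX normal_sqr_integrable.
have pE : (\int[P]_w (EFin \o X)^\+ w = \int[P]_w (Num.max (X w) 0)%:E)%E.
  by apply: eq_integral => w _; rewrite funeposE -EFin_max.
have nE : (\int[P]_w (EFin \o X)^\- w = \int[P]_w (Num.max (- X w) 0)%:E)%E.
  by apply: eq_integral => w _; rewrite funenegE -EFin_max.
have e1 : (\int[P]_w (EFin \o X)^\+ w = \int[P]_w (EFin \o X)^\- w)%E.
  rewrite pE nE.
  rewrite (ge0_integral_has_law (f := fun x => (Num.max x 0)%:E) mX lX); last 2 first.
  - by apply/measurable_EFinP; exact: measurable_maxr.
  - by move=> x; rewrite lee_fin le_max lexx orbT.
  rewrite (ge0_integral_has_law (f := fun x => (Num.max (- x) 0)%:E) mX lX); last 2 first.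
  - by apply/measurable_EFinP; apply: measurable_maxr => //; exact: measurable_oppr.
  - by move=> x; rewrite lee_fin le_max lexx orbT.
  under eq_integral do rewrite -EFinM.
  under [RHS]eq_integral do rewrite -EFinM.
  exact: integral_pos_neg_normal_pdf.
rewrite integralE e1 subee//; apply: integrable_fin_num => //.
exact: integrable_funeneg.
Qed.
End gaussian_rv.

(** * Products of independent variables *)

Section independence.
Context d (T : measurableType d) (R : realType) (P : probability T R).

(** The product rule on rectangles identifies the law of (U, V) with the product
of the two laws; Fubini's theorem then factors the integral of x * y. *)
Lemma integral_mul_indep (U V : {RV P >-> R}) :
  (forall A B : set R, measurable A -> measurable B ->
    P ((U @^-1` A) `&` (V @^-1` B)) = (P (U @^-1` A) * P (V @^-1` B))%E) ->
  P.-integrable setT (EFin \o U) -> P.-integrable setT (EFin \o V) ->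
  P.-integrable setT (EFin \o (U \* V)) /\
  (\int[P]_w (U w * V w)%:E = (\int[P]_w (U w)%:E) * (\int[P]_w (V w)%:E))%E.
Proof.
move=> indep iU iV.
pose phi w := (U w, V w).
have mphi : measurable_fun setT phi by exact/measurable_fun_pair.
pose Phi : {mfun T >-> (R * R)%type} :=
  HB.pack phi (isMeasurableFun.Build _ _ T (R * R)%type phi mphi).
pose m1 := distribution P U. pose m2 := distribution P V.
pose g := fun z : R * R => (z.1 * z.2)%:E.
have mg : measurable_fun setT g.
  by apply/measurable_EFinP; apply: measurable_funM.
have joint X : measurable X -> (m1 \x m2)%E X = distribution P Phi X.
  apply: product_measure_unique => A B mA mB.
  by rewrite -[RHS]indep.
have mid : measurable_fun [set: R] (@EFin R) by exact/(@measurable_EFinP _ _ _ _ (fun x : R => x)).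
have i1 : (\int[m1]_x (x%:E) = \int[P]_w (U w)%:E)%E.
  by rewrite integral_distribution.
have i2 : (\int[m2]_x (x%:E) = \int[P]_w (V w)%:E)%E.
  by rewrite integral_distribution.
have iid2 : m2.-integrable setT (@EFin R).
  by apply: integrable_pushforward.
have iid1 : m1.-integrable setT (@EFin R).
  by apply: integrable_pushforward.
have inner x : (\int[m2]_y g (x, y) = x%:E * \int[P]_w (V w)%:E)%E.
  by rewrite -i2 -integralZl//; apply: eq_integral.
have intg : (m1 \x m2)%E.-integrable setT g.
  apply/integrable12ltyP => //.
  have -> : (\int[m1]_x \int[m2]_y `|g (x, y)| =
      (\int[m1]_x `|x%:E|) * (\int[m2]_y `|y%:E|))%E.
    rewrite -ge0_integralZr//; last 2 first.
    - exact: measurableT_comp.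
    - exact: integral_ge0.
    apply: eq_integral => x _.
    rewrite -ge0_integralZl//; last by exact: measurableT_comp.
    by apply: eq_integral => y _; rewrite /g EFinM abseM.
  by apply: lte_mul_pinfty; [exact: integral_ge0|
    exact: (integrable_fin_num _ (integrable_abse iid1))|by case/integrableP : iid2].
have intg' : (distribution P Phi).-integrable setT g.
  apply/integrableP; split => //.
  rewrite -(@eq_measure_integral _ _ _ _ _ (m1 \x m2)%E) => [|X mX _]; first by case/integrableP : intg.
  exact: joint.
have iUV : P.-integrable setT (EFin \o (U \* V)).
  apply/integrableP; split; first by apply/measurable_EFinP; exact: measurable_funM.
  case/integrableP : intg' => _; rewrite ge0_integral_distribution//.
  exact: measurableT_comp.
split => //.
rewrite -(@integral_distribution _ _ _ _ _ P Phi g)//.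
rewrite -(@eq_measure_integral _ _ _ _ _ (m1 \x m2)%E) => [|X mX _]; last exact: joint.
rewrite -integral12_prod_meas1//.
under eq_integral do rewrite /fubini_F inner.
have /fineK <- : (\int[P]_w (V w)%:E)%E \is a fin_num by exact: integrable_fin_num.
by rewrite integralZr// i1.
Qed.
End independence.

(** * The Hilbert space of square-integrable variables *)

(** The scalar product of L^2(P), locked so that conversion never has to compare
the underlying integrals. *)
HB.lock Definition ip {d} {T : measurableType d} {R : realType}
  (P : probability T R) (X Y : T -> R) : R := (\int[P]_w (X w * Y w))%R.
Canonical ip_unlockable := Unlockable ip.unlock.
Arguments ip {d T R} P X Y.

Section square_integrable.
Context d (T : measurableType d) (R : realType) (P : probability T R).
Implicit Types (X Y Z : T -> R).

Definition L1 X := P.-integrable setT (EFin \o X).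

Definition L2 X :=
  measurable_fun setT X /\ L1 (fun w => X w ^+ 2).

Lemma ipE X Y : ip P X Y = \int[P]_w (X w * Y w).
Proof. by rewrite unlock. Qed.

Local Notation ip := (ip P).

(** The squared norm of L^2(P). *)
Definition sqn X : R := ip X X.

Lemma L1_le X Y : measurable_fun setT X -> L1 Y -> (forall w, `|X w| <= Y w) -> L1 X.
Proof.
move=> mX iY XY; apply: (le_integrable _ _ _ iY) => //.
  exact/measurable_EFinP.
by move=> w _ /=; rewrite lee_fin (le_trans (XY w)) ?ler_norm.
Qed.

Lemma L1D X Y : L1 X -> L1 Y -> L1 (fun w => X w + Y w).
Proof. exact: integrableD. Qed.

Lemma L1Z (a : R) X : L1 X -> L1 (fun w => a * X w).
Proof. move=> iX; exact: (integrableZl measurableT a iX). Qed.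

Lemma L1_sum (I : Type) (s : seq I) (F : I -> T -> R) :
  (forall i, L1 (F i)) -> L1 (fun w => \sum_(i <- s) F i w).
Proof.
move=> iF; elim: s => [|i s IH].
  have -> : (fun w => \sum_(i <- [::]) F i w) = cst 0.
    by apply/funext => w; rewrite big_nil.
  exact: finite_measure_integrable_cst.
have -> : (fun w => \sum_(j <- i :: s) F j w) = (fun w => F i w + \sum_(j <- s) F j w).
  by apply/funext => w; rewrite big_cons.
exact: L1D.
Qed.

Lemma L2_mul X Y : L2 X -> L2 Y -> L1 (fun w => X w * Y w).
Proof.
move=> [mX iX] [mY iY]; apply: L1_le (L1D iX iY) _; first exact: measurable_funM.
move=> w; rewrite ler_norml; have := sqr_ge0 (X w + Y w).
have := sqr_ge0 (X w - Y w); have := sqr_ge0 (X w); have := sqr_ge0 (Y w).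
by move=> *; apply/andP; split; nra.
Qed.

Lemma L2_cst (a : R) : L2 (fun _ => a).
Proof.
by split; [exact: measurable_cst|apply: (finite_measure_integrable_cst P (a ^+ 2))].
Qed.

Lemma L2_L1 X : L2 X -> L1 X.
Proof.
move=> X2; have := L2_mul X2 (L2_cst 1).
by under eq_fun do rewrite mulr1.
Qed.

Lemma L2D X Y : L2 X -> L2 Y -> L2 (fun w => X w + Y w).
Proof.
move=> X2 Y2; have [mX iX] := X2; have [mY iY] := Y2.
split; first exact: measurable_funD.
have -> : (fun w => (X w + Y w) ^+ 2) =
    (fun w => (X w ^+ 2 + Y w ^+ 2) + 2 * (X w * Y w)).
  by apply/funext => w; ring.
by apply: L1D; [exact: L1D|apply/L1Z/L2_mul].
Qed.

Lemma L2Z (a : R) X : L2 X -> L2 (fun w => a * X w).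
Proof.
move=> [mX iX]; split; first exact: measurable_funM.
by under eq_fun do rewrite exprMn; exact: L1Z.
Qed.

Lemma L2N X : L2 X -> L2 (fun w => - X w).
Proof. by move=> /(L2Z (-1)); under eq_fun do rewrite mulN1r. Qed.

Lemma L2B X Y : L2 X -> L2 Y -> L2 (fun w => X w - Y w).
Proof. by move=> X2 /L2N; exact: L2D. Qed.

Lemma L2_sum (I : Type) (s : seq I) (F : I -> T -> R) :
  (forall i, L2 (F i)) -> L2 (fun w => \sum_(i <- s) F i w).
Proof.
move=> F2; elim: s => [|i s IH].
  under eq_fun do rewrite big_nil; exact: L2_cst.
under eq_fun do rewrite big_cons; exact: L2D.
Qed.

Lemma meanD X Y : L1 X -> L1 Y ->
  \int[P]_w (X w + Y w) = \int[P]_w X w + \int[P]_w Y w.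
Proof. by move=> iX iY; rewrite RintegralD. Qed.

Lemma mean_sum (I : Type) (s : seq I) (F : I -> T -> R) :
  (forall i, L1 (F i)) ->
  \int[P]_w (\sum_(i <- s) F i w) = \sum_(i <- s) \int[P]_w F i w.
Proof.
move=> iF; elim: s => [|i s IH].
  under eq_Rintegral do rewrite big_nil.
  by rewrite Rintegral_cst// mul0r big_nil.
under eq_Rintegral do rewrite big_cons.
by rewrite meanD ?IH ?big_cons//; exact: L1_sum.
Qed.

Lemma ipC X Y : ip X Y = ip Y X.
Proof. by rewrite !ipE; apply: eq_Rintegral => w _; rewrite mulrC. Qed.

Lemma ipDl X Y Z : L2 X -> L2 Y -> L2 Z ->
  ip (fun w => X w + Y w) Z = ip X Z + ip Y Z.
Proof.
move=> X2 Y2 Z2; rewrite !ipE -meanD; [|exact: L2_mul..].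
by apply: eq_Rintegral => w _; rewrite mulrDl.
Qed.

Lemma ipZl (a : R) X Z : L2 X -> L2 Z -> ip (fun w => a * X w) Z = a * ip X Z.
Proof.
move=> X2 Z2; rewrite !ipE -RintegralZl//; last exact: L2_mul.
by apply: eq_Rintegral => w _; rewrite mulrA.
Qed.

Lemma ipBl X Y Z : L2 X -> L2 Y -> L2 Z ->
  ip (fun w => X w - Y w) Z = ip X Z - ip Y Z.
Proof.
move=> X2 Y2 Z2; have -> : (fun w => X w - Y w) = (fun w => X w + (-1) * Y w).
  by apply/funext => w; rewrite mulN1r.
by rewrite ipDl ?ipZl ?mulN1r//; exact: L2Z.
Qed.

Lemma ip_suml (I : Type) (s : seq I) (F : I -> T -> R) Z :
  (forall i, L2 (F i)) -> L2 Z ->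
  ip (fun w => \sum_(i <- s) F i w) Z = \sum_(i <- s) ip (F i) Z.
Proof.
move=> F2 Z2; under [RHS]eq_bigr do rewrite ipE.
rewrite ipE -mean_sum; last by move=> i; exact: L2_mul.
by apply: eq_Rintegral => w _; rewrite mulr_suml.
Qed.

Lemma sqn_ge0 X : 0 <= sqn X.
Proof. by rewrite /sqn ipE; apply: Rintegral_ge0 => w _; rewrite -expr2 sqr_ge0. Qed.

Lemma sqnD X Y : L2 X -> L2 Y ->
  sqn (fun w => X w + Y w) = sqn X + 2 * ip X Y + sqn Y.
Proof.
move=> X2 Y2; have XY := L2D X2 Y2.
by rewrite /sqn ipDl// ![ip _ (fun w => _ + _)]ipC !ipDl// (ipC Y X); ring.
Qed.

Lemma sqnZ (a : R) X : L2 X -> sqn (fun w => a * X w) = a ^+ 2 * sqn X.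
Proof.
move=> X2; have aX := L2Z a X2.
by rewrite /sqn ipZl// ipC ipZl// mulrA expr2.
Qed.

Lemma sqnB X Y : L2 X -> L2 Y ->
  sqn (fun w => X w - Y w) = sqn X - 2 * ip X Y + sqn Y.
Proof.
move=> X2 Y2; have XY := L2B X2 Y2.
by rewrite /sqn ipBl// ![ip _ (fun w => _ - _)]ipC !ipBl// (ipC Y X); ring.
Qed.

(** The triangle inequality in squared form; the factor 2 is harmless in
arguments about limits. *)
Lemma sqn_le2 X Y Z : L2 X -> L2 Y -> L2 Z ->
  sqn (fun w => X w - Z w) <=
  2 * sqn (fun w => X w - Y w) + 2 * sqn (fun w => Y w - Z w).
Proof.
move=> X2 Y2 Z2; have A2 := L2B X2 Y2; have B2 := L2B Y2 Z2.
have -> : (fun w => X w - Z w) = (fun w => (X w - Y w) + (Y w - Z w)).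
  by apply/funext => w; ring.
rewrite sqnD//.
have := sqn_ge0 (fun w => (X w - Y w) - (Y w - Z w)); rewrite sqnB//.
lra.
Qed.

(** Cauchy-Schwarz, from the nonnegativity of |X + a Y|^2 for all real a; when
|Y| = 0, a suitable large a shows that the scalar product vanishes. *)
Lemma ip_sqr_le X Y : L2 X -> L2 Y -> ip X Y ^+ 2 <= sqn X * sqn Y.
Proof.
move=> X2 Y2.
have key a : 0 <= sqn X + 2 * a * ip X Y + a ^+ 2 * sqn Y.
  have := sqn_ge0 (fun w => X w + a * Y w).
  by rewrite sqnD ?sqnZ//; [rewrite [ip X _]ipC ipZl// (ipC Y) mulrA|exact: L2Z].
have := sqn_ge0 Y; rewrite le_eqVlt => /predU1P[Y0|Y0].
  rewrite -Y0 mulr0; have [->|n0] := eqVneq (ip X Y) 0; first by rewrite expr0n.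
  have := key (- (sqn X + 1) / (2 * ip X Y)); rewrite -Y0 mulr0 addr0.
  have -> : 2 * (- (sqn X + 1) / (2 * ip X Y)) * ip X Y = - (sqn X + 1) by field.
  lra.
have := key (- ip X Y / sqn Y).
have -> : sqn X + 2 * (- ip X Y / sqn Y) * ip X Y + (- ip X Y / sqn Y) ^+ 2 * sqn Y =
   (sqn X * sqn Y - ip X Y ^+ 2) / sqn Y by field; rewrite gt_eqF.
by rewrite pmulr_lge0 ?invr_gt0// subr_ge0.
Qed.

Lemma cvg_sqr_dist (u v : nat -> R) (l : R) :
  (forall n, (l - u n) ^+ 2 <= v n) -> v n @[n --> \oo] --> 0 -> u n @[n --> \oo] --> l.
Proof.
move=> uv v0.
have s0 : Num.sqrt (v n) @[n --> \oo] --> 0.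
  by rewrite -[X in _ --> X]sqrtr0; exact: (continuous_cvg _ (@sqrt_continuous _ _)).
apply: (@squeeze_cvgr _ _ _ _ (fun n => l - Num.sqrt (v n)) (fun n => l + Num.sqrt (v n))).
- near=> n; have := uv n; rewrite -ler_sqrt; last by rewrite (le_trans (sqr_ge0 _) (uv n)).
  by rewrite sqrtr_sqr ler_norml => /andP[? ?]; apply/andP; split; lra.
- by rewrite -[X in _ --> X]subr0; apply: cvgB => //; exact: cvg_cst.
- by rewrite -[X in _ --> X]addr0; apply: cvgD => //; exact: cvg_cst.
Unshelve. all: by end_near. Qed.

Lemma ip_cvg (S : nat -> T -> R) X Y : (forall n, L2 (S n)) -> L2 X -> L2 Y ->
  sqn (fun w => X w - S n w) @[n --> \oo] --> 0 ->
  ip (S n) Y @[n --> \oo] --> ip X Y.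
Proof.
move=> S2 X2 Y2 SX.
apply: (@cvg_sqr_dist _ (fun n => sqn (fun w => X w - S n w) * sqn Y)).
  by move=> n; rewrite -ipBl//; apply: ip_sqr_le => //; exact: L2B.
by rewrite -[X in _ --> X](mul0r (sqn Y)); apply: cvgM => //; exact: cvg_cst.
Qed.

Lemma sqn_cvg (S : nat -> T -> R) X : (forall n, L2 (S n)) -> L2 X ->
  sqn (fun w => X w - S n w) @[n --> \oo] --> 0 ->
  sqn (S n) @[n --> \oo] --> sqn X.
Proof.
move=> S2 X2 SX.
have -> : (fun n => sqn (S n)) =
   (fun n => sqn (fun w => X w - S n w) - sqn X + 2 * ip (S n) X).
  by apply/funext => n; rewrite sqnB// (ipC (S n)); ring.
rewrite [X in _ --> X](_ : _ = 0 - sqn X + 2 * ip X X); last by rewrite /sqn; ring.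
apply: cvgD; first by apply: cvgB => //; exact: cvg_cst.
by apply: cvgM; [exact: cvg_cst|exact: ip_cvg].
Qed.

Definition orthonormal_rv (I : eqType) (e : I -> T -> R) : Prop :=
  (forall i, L2 (e i)) /\ forall i j, ip (e i) (e j) = (i == j)%:R.

Section orthonormal.
Variables (I : eqType) (e : I -> T -> R) (e_on : orthonormal_rv e).

Let e2 i : L2 (e i). Proof. by have [] := e_on. Qed.
Let ee i j : ip (e i) (e j) = (i == j)%:R. Proof. by have [] := e_on. Qed.

Lemma L2_lincomb (s : seq I) (a : I -> R) : L2 (fun w => \sum_(i <- s) a i * e i w).
Proof. by apply: L2_sum => i; exact: L2Z. Qed.

Lemma ip_lincomb (s : seq I) (a : I -> R) X : L2 X ->
  ip X (fun w => \sum_(i <- s) a i * e i w) = \sum_(i <- s) a i * ip X (e i).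
Proof.
move=> X2; rewrite ipC ip_suml//; last by move=> i; exact: L2Z.
by apply: eq_bigr => i _; rewrite ipZl// ipC.
Qed.

Lemma ip_lincomb_basis (s : seq I) (a : I -> R) k : uniq s ->
  ip (fun w => \sum_(i <- s) a i * e i w) (e k) = if k \in s then a k else 0.
Proof.
move=> us; rewrite ipC ip_lincomb//.
under eq_bigr do rewrite ee eq_sym mulr_natr mulrb.
rewrite -big_mkcond/=; case: ifPn => [ks|ks].
  by rewrite -big_filter filter_pred1_uniq// big_seq1.
by rewrite big_seq_cond big1// => i /andP[si /eqP ik]; rewrite -ik si in ks.
Qed.

Lemma sqn_lincomb (s : seq I) (a : I -> R) : uniq s ->
  sqn (fun w => \sum_(i <- s) a i * e i w) = \sum_(i <- s) a i ^+ 2.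
Proof.
move=> us; rewrite /sqn ip_lincomb; last exact: L2_lincomb.
rewrite big_seq [RHS]big_seq; apply: eq_bigr => i si.
by rewrite ip_lincomb_basis// si expr2.
Qed.

(** Best approximation: no combination of the e i is closer to X than the one
with the Fourier coefficients, whose distance is computed in sqn_projection. *)
Lemma sqn_lincomb_ge (s : seq I) (a : I -> R) X : uniq s -> L2 X ->
  sqn X - \sum_(i <- s) ip X (e i) ^+ 2 <=
  sqn (fun w => X w - \sum_(i <- s) a i * e i w).
Proof.
move=> us X2; rewrite sqnB//; last exact: L2_lincomb.
rewrite ip_lincomb// sqn_lincomb// -addrA lerD2l.
rewrite mulr_sumr -sumrN -sumrN -big_split/=; apply: ler_sum => i _.
have := sqr_ge0 (ip X (e i) - a i); nra.
Qed.

Lemma sqn_projection (s : seq I) X : uniq s -> L2 X ->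
  sqn (fun w => X w - \sum_(i <- s) ip X (e i) * e i w) =
  sqn X - \sum_(i <- s) ip X (e i) ^+ 2.
Proof.
move=> us X2; rewrite sqnB//; last exact: L2_lincomb.
rewrite ip_lincomb// sqn_lincomb//.
under eq_bigr do rewrite -expr2.
ring.
Qed.

End orthonormal.
End square_integrable.

(** * Brownian increments and the Ito isometry *)

Section wiener_increments.
Context d (T : measurableType d) (R : realType) (P : probability T R).
Local Notation L1 := (L1 P).
Local Notation L2 := (L2 P).
Implicit Types (X Y : T -> R) (G : set (set T)).

Definition adapted G X := forall A : set R, measurable A -> G (X @^-1` A).

Definition bounded_rv X := exists M : R, forall w, `|X w| <= M.

Lemma adaptedP G X : sigma_algebra setT G ->
  adapted G X <-> measurable_fun (setT : set (g_sigma_algebraType G)) X.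
Proof.
move=> sG; split => aX.
  by move=> _ A mA; rewrite setTI; apply: sub_sigma_algebra; exact: aX.
by move=> A mA; have := aX measurableT A mA; rewrite setTI /measurable/= sigma_algebra_id.
Qed.

Lemma adaptedM G X Y : sigma_algebra setT G -> adapted G X -> adapted G Y ->
  adapted G (fun w => X w * Y w).
Proof.
move=> sG /(adaptedP _ sG) mX /(adaptedP _ sG) mY; apply/(adaptedP _ sG).
exact: measurable_funM.
Qed.

Lemma adapted_cst G (c : R) : sigma_algebra setT G -> adapted G (fun _ => c).
Proof. by move=> sG; apply/(adaptedP _ sG); exact: measurable_cst. Qed.

Lemma adapted_measurable G X : G `<=` measurable -> adapted G X -> measurable_fun setT X.
Proof. by move=> mG aX _ A mA; rewrite setTI; apply: mG; exact: aX. Qed.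

Lemma adaptedS G G' X : G `<=` G' -> adapted G X -> adapted G' X.
Proof. by move=> GG' aX A mA; apply: GG'; exact: aX. Qed.

Lemma bounded_rvM X Y : bounded_rv X -> bounded_rv Y -> bounded_rv (fun w => X w * Y w).
Proof.
move=> [M XM] [N YN]; exists (M * N) => w; rewrite normrM.
by apply: ler_pM.
Qed.

Lemma L1_boundedM X Y : measurable_fun setT X -> bounded_rv X -> L1 Y ->
  L1 (fun w => X w * Y w).
Proof.
move=> mX [M XM] iY.
have mY : measurable_fun setT Y by apply/measurable_EFinP; exact: (measurable_int _ iY).
have M0 : 0 <= M by rewrite (le_trans _ (XM point)).
apply: (L1_le _ (L1Z M (integrable_norm iY))) => [|w]; first exact: measurable_funM.
by rewrite /= normrM ler_wpM2r.
Qed.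

Lemma L2_bounded X : measurable_fun setT X -> bounded_rv X -> L2 X.
Proof.
move=> mX bX; split => //.
have := L1_boundedM mX bX (L1_boundedM mX bX (finite_measure_integrable_cst P 1 measurableT)).
by under eq_fun do rewrite mulr1 -expr2.
Qed.

(** A form of integral_mul_indep suited to filtrations: the independence is
between X and a sigma-algebra, and U enters through adaptedness only. *)
Lemma mean_mul_indep G (U X : T -> R) : G `<=` measurable ->
  adapted G U -> measurable_fun setT X ->
  (forall A B, G A -> measurable B ->
     P (A `&` (X @^-1` B)) = (P A * P (X @^-1` B))%E) ->
  L1 U -> L1 X ->
  L1 (fun w => U w * X w) /\
  \int[P]_w (U w * X w) = (\int[P]_w U w) * (\int[P]_w X w).
Proof.
move=> mG aU mX indep iU iX.
have mU := adapted_measurable mG aU.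
pose U' : {mfun T >-> R} := HB.pack U (isMeasurableFun.Build _ _ _ _ _ mU).
pose X' : {mfun T >-> R} := HB.pack X (isMeasurableFun.Build _ _ _ _ _ mX).
have [|iUX e] := @integral_mul_indep _ _ _ P U' X' _ iU iX.
  by move=> A B mA mB; apply: indep => //; exact: aU.
by split => //; rewrite /Rintegral e fineM//; exact: integrable_fin_num.
Qed.

Definition inc (w : R -> T -> R) (s t : R) (x : T) : R := w t x - w s x.

Lemma incD (w : R -> T -> R) s t u x : inc w s t x + inc w t u x = inc w s u x.
Proof. by rewrite /inc; ring. Qed.

(** A scalar Wiener process on [0, 1] relative to a filtration F, described by
its increments. F may be larger than the filtration generated by w: for one
component of a vector-valued process it carries the information of all the
components. *)
Record brownian (F : R -> set (set T)) (w : R -> T -> R) : Prop := {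
  bro_sigma : forall s : R, sigma_algebra setT (F s) ;
  bro_measurable : forall s : R, F s `<=` measurable ;
  bro_mono : forall s t : R, s <= t -> F s `<=` F t ;
  bro_adapted : forall s t : R, 0 <= s -> s <= t -> t <= 1 ->
    adapted (F t) (inc w s t) ;
  bro_law : forall s t : R, 0 <= s -> s < t -> t <= 1 ->
    has_law P (inc w s t) (normal_prob 0 (Num.sqrt (t - s))) ;
  bro_indep : forall s t : R, 0 <= s -> s < t -> t <= 1 ->
    forall (A : set T) (B : set R), F s A -> measurable B ->
    P (A `&` (inc w s t @^-1` B)) = (P A * P (inc w s t @^-1` B))%E }.

Section brownian.
Variables (F : R -> set (set T)) (w : R -> T -> R) (bw : brownian F w).

Local Notation inc := (inc w).

Lemma measurable_inc s t : 0 <= s -> s <= t -> t <= 1 -> measurable_fun setT (inc s t).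
Proof.
move=> s0 st t1; apply: (adapted_measurable (@bro_measurable _ _ bw t)).
exact: bro_adapted.
Qed.

Lemma inc_moments s t : 0 <= s -> s <= t -> t <= 1 ->
  [/\ L2 (inc s t), \int[P]_x inc s t x = 0 & \int[P]_x (inc s t x ^+ 2) = t - s].
Proof.
move=> s0; rewrite le_eqVlt => /predU1P[<-|st] t1.
  have -> : inc s s = (fun _ => 0) by apply/funext => x; rewrite /inc subrr.
  split; first exact: L2_cst.
    by rewrite Rintegral_cst// mul0r.
  by rewrite subrr expr0n/= Rintegral_cst// mul0r.
have ts : 0 < Num.sqrt (t - s) by rewrite sqrtr_gt0 subr_gt0.
have mi := measurable_inc s0 (ltW st) t1.
have law := bro_law bw s0 st t1.
split.
- by split => //; exact: normal_sqr_integrable law.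
- by rewrite /Rintegral (normal_integral0 ts mi law).
- by rewrite /Rintegral (normal_sqr_integral ts mi law)/= sqr_sqrtr// subr_ge0 ltW.
Qed.

Lemma mean_mul_inc U s t : 0 <= s -> s <= t -> t <= 1 ->
  adapted (F s) U -> L1 U ->
  L1 (fun x => U x * inc s t x) /\ \int[P]_x (U x * inc s t x) = 0.
Proof.
move=> s0 st t1 aU iU; have [i2 i0 _] := inc_moments s0 st t1.
move: st; rewrite le_eqVlt => /predU1P[est|st].
  have -> : (fun x => U x * inc s t x) = (fun _ => 0).
    by apply/funext => x; rewrite /inc est subrr mulr0.
  by split; [exact/L2_L1/L2_cst|rewrite Rintegral_cst// mul0r].
have := mean_mul_indep (@bro_measurable _ _ bw s) aU (measurable_inc s0 (ltW st) t1) (bro_indep bw s0 st t1) iU (L2_L1 i2).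
by rewrite i0 mulr0.
Qed.

Lemma mean_mul_inc2 U s t : 0 <= s -> s <= t -> t <= 1 ->
  adapted (F s) U -> L1 U ->
  L1 (fun x => U x * inc s t x ^+ 2) /\
  \int[P]_x (U x * inc s t x ^+ 2) = (\int[P]_x U x) * (t - s).
Proof.
move=> s0 st t1 aU iU; have [i2 _ is2] := inc_moments s0 st t1.
have mi := measurable_inc s0 st t1.
move: st; rewrite le_eqVlt => /predU1P[est|st].
  have -> : (fun x => U x * inc s t x ^+ 2) = (fun _ => 0).
    by apply/funext => x; rewrite /inc est subrr expr0n mulr0.
  by rewrite est subrr mulr0; split; [exact/L2_L1/L2_cst|rewrite Rintegral_cst// mul0r].
rewrite -is2; apply: (mean_mul_indep (@bro_measurable _ _ bw s) aU) => //.
- exact: measurable_funX.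
- move=> A B FA mB.
  have := bro_indep bw s0 st t1 FA (_ : measurable ((fun y : R => y ^+ 2) @^-1` B)).
  apply; rewrite -[X in measurable X]setTI.
  by apply: (@measurable_funX _ _ _ _ (fun x : R => x)).
- by case: i2.
Qed.

Definition overlap (u v a b : R) : R := Num.max 0 (Num.min v b - Num.max u a).

Lemma overlapC u v a b : overlap u v a b = overlap a b u v.
Proof. by rewrite /overlap minC [Num.max u a]maxC. Qed.

(** By symmetry u <= a. If v <= a, the second increment is independent of the
other factors and has mean 0. Otherwise both intervals are cut at a, at
min(v, b) and at max(v, b), and the only product of increments with a nonzero
mean is the square of the increment over [a, min(v, b)]. *)
Lemma mean_mul_inc_inc xi eta u v a b :
  0 <= u -> u <= v -> v <= 1 -> 0 <= a -> a <= b -> b <= 1 ->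
  adapted (F u) xi -> bounded_rv xi -> adapted (F a) eta -> bounded_rv eta ->
  \int[P]_x ((xi x * inc u v x) * (eta x * inc a b x)) =
  (\int[P]_x (xi x * eta x)) * overlap u v a b.
Proof.
wlog ua : xi eta u v a b / u <= a.
  move=> H u0 uv v1 a0 ab b1 axi bxi aeta beta.
  have [ua|/ltW au] := leP u a; first exact: H.
  have := H eta xi a b u v au a0 ab b1 u0 uv v1 aeta beta axi bxi.
  rewrite (overlapC a) => e.
  under eq_Rintegral do rewrite mulrC; rewrite e.
  by congr (_ * _); apply: eq_Rintegral => x _; rewrite mulrC.
move=> u0 uv v1 a0 ab b1 axi bxi aeta beta.
have sF (s : R) := @bro_sigma _ _ bw s.
have mF (s : R) := @bro_measurable _ _ bw s.
pose U0 x := xi x * eta x.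
have aU0 : adapted (F a) U0.
  by apply: adaptedM => //; exact: adaptedS (bro_mono bw ua) axi.
have bU0 : bounded_rv U0 by exact: bounded_rvM.
have mU0 := adapted_measurable (mF a) aU0.
have iU0 : L1 U0 by exact/L2_L1/L2_bounded.
have U0inc s t : a <= t -> 0 <= s -> s <= t -> t <= 1 ->
    adapted (F t) (fun x => U0 x * inc s t x) /\ L1 (fun x => U0 x * inc s t x).
  move=> ra s0 st t1; split.
    by apply: adaptedM => //; [exact: adaptedS (bro_mono bw ra) aU0|exact: bro_adapted].
  by apply: L1_boundedM => //; apply: L2_L1; have [] := inc_moments s0 st t1.
have [va|av] := leP v a.
  have -> : overlap u v a b = 0.
    rewrite /overlap max_l// subr_le0 ge_min le_max.
    by rewrite va orbT.
  rewrite mulr0.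
  have aU : adapted (F a) (fun x => U0 x * inc u v x).
    by apply: adaptedM => //; apply: adaptedS (bro_mono bw va) _; exact: bro_adapted.
  have iU : L1 (fun x => U0 x * inc u v x).
    by apply: L1_boundedM => //; apply: L2_L1; have [] := inc_moments u0 uv v1.
  have [_ <-] := mean_mul_inc a0 ab b1 aU iU.
  by apply: eq_Rintegral => x _; rewrite /U0; ring.
pose m := Num.min v b; pose M := Num.max v b.
have am : a <= m by rewrite le_min ab ltW.
have mM : m <= M by rewrite ge_min le_max lexx.
have M1 : M <= 1 by rewrite ge_max v1 b1.
have m0 : 0 <= m by rewrite (le_trans a0).
have m1 : m <= 1 by rewrite (le_trans mM).
have -> : overlap u v a b = m - a.
  by rewrite /overlap (max_r ua) max_r// subr_ge0.
have [aU1 iU1] := U0inc u a (lexx _) u0 ua (le_trans am m1).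
have [i1 e1] := mean_mul_inc a0 ab b1 aU1 iU1.
have [i2 e2] := mean_mul_inc2 a0 am m1 aU0 iU0.
have [aU3 iU3] := U0inc a m am a0 am m1.
have [i3 e3] := mean_mul_inc m0 mM M1 aU3 iU3.
transitivity (\int[P]_x ((U0 x * inc u a x * inc a b x + U0 x * inc a m x ^+ 2) +
    U0 x * inc a m x * inc m M x)); last first.
  by rewrite meanD ?meanD ?e1 ?e2 ?e3 ?add0r ?addr0//; exact: L1D.
apply: eq_Rintegral => x _; rewrite /m /M /U0 -(incD w u a v).
by case: (leP v b) => _; [rewrite -(incD w a v b)|rewrite -(incD w a b v)]; ring.
Qed.

Variables (I : finType) (xi : I -> T -> R) (u v : I -> R).
Hypotheses (u0 : forall i, 0 <= u i) (uv : forall i, u i <= v i)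
  (v1 : forall i, v i <= 1) (axi : forall i, adapted (F (u i)) (xi i))
  (bxi : forall i, bounded_rv (xi i)).

Let mxi i : measurable_fun setT (xi i).
Proof. exact: adapted_measurable (@bro_measurable _ _ bw (u i)) (axi i). Qed.

Let xi2 i : L2 (xi i). Proof. exact: L2_bounded. Qed.

Let xinc i : L2 (fun x => xi i x * inc (u i) (v i) x).
Proof.
have [i2 _ _] := inc_moments (u0 i) (uv i) (v1 i).
split; first by apply: measurable_funM => //; case: i2.
under eq_fun do rewrite exprMn; apply: L1_boundedM; last by case: i2.
  exact: measurable_funX.
by under eq_fun do rewrite expr2; exact: bounded_rvM.
Qed.

Lemma L2_simple_integral :
  L2 (fun x => \sum_i xi i x * inc (u i) (v i) x).
Proof. exact: L2_sum. Qed.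

(** The intervals [u i, v i] are arbitrary and may overlap: the difference of two
simple integrals along unrelated partitions is again of this form. *)
Lemma simple_integral_isometry :
  sqn P (fun x => \sum_i xi i x * inc (u i) (v i) x) =
  \int[P]_x (\sum_i \sum_j
     xi i x * xi j x * overlap (u i) (v i) (u j) (v j)).
Proof.
rewrite /sqn ip_suml//; last exact: L2_simple_integral.
have iij i j : L1 (fun x => xi i x * xi j x * overlap (u i) (v i) (u j) (v j)).
  under eq_fun do rewrite mulrC; exact/L1Z/L2_mul.
rewrite mean_sum; last by move=> i; exact: L1_sum.
apply: eq_bigr => i _; rewrite ipC ip_suml// mean_sum//.
apply: eq_bigr => j _; rewrite ipC ipE mean_mul_inc_inc//.
by rewrite -RintegralZr//; exact: L2_mul.
Qed.

End brownian.
End wiener_increments.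

(** * Step functions *)

Section step_functions.
Context (R : realType).
Local Notation mu := (@lebesgue_measure R).

Definition step (I : finType) (c u v : I -> R) (s : R) : R :=
  \sum_i c i * \1_(`[u i, v i[%classic) s.

Lemma measurable_step (I : finType) (c u v : I -> R) : measurable_fun [set: R] (step c u v).
Proof.
apply: measurable_sum => i; exact: measurable_funM.
Qed.

(** The same double sum of overlaps as in simple_integral_isometry, which makes
that lemma an isometry even for overlapping intervals. *)
Lemma integral_step_sqr (I : finType) (c u v : I -> R) (t : R) :
  (forall i, 0 <= u i) -> (forall i, v i <= t) ->
  (\int[mu]_(s in `[0%R, t]) (step c u v s ^+ 2)%:E =
   (\sum_i \sum_j c i * c j * overlap (u i) (v i) (u j) (v j))%:E)%E.
Proof.
move=> u0 vt.
have ind i j : (\int[mu]_(s in `[0%R, t])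
    (c i * c j * \1_(`[Num.max (u i) (u j), Num.min (v i) (v j)[%classic) s)%:E =
    (c i * c j * overlap (u i) (v i) (u j) (v j))%:E)%E.
  under eq_integral do rewrite EFinM.
  rewrite integralZl//; last exact: integrableS (integrable_indic_itv _ _ _ _).
  rewrite integral_indic//.
  have -> : `[Num.max (u i) (u j), Num.min (v i) (v j)[%classic `&` `[0, t]%classic =
      `[Num.max (u i) (u j), Num.min (v i) (v j)[%classic :> set R.
    apply/setIidPl => s /=; rewrite !in_itv/= ge_max lt_min.
    move=> /andP[/andP[us _] /andP[sv _]].
    by rewrite (le_trans (u0 i))//= (le_trans (ltW sv)).
  have := lebesgue_measure_itv `[Num.max (u i) (u j), Num.min (v i) (v j)[.
  rewrite /= lte_fin /overlap => ->.
  case: (ltP (Num.max (u i) (u j)) (Num.min (v i) (v j))) => h.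
    by rewrite -EFinB -EFinM [Num.max 0 _]max_r// subr_ge0 ltW.
  by rewrite [Num.max 0 _]max_l ?subr_le0// mulr0 mule0.
transitivity (\int[mu]_(s in `[0%R, t]) (\sum_i \sum_j
    (c i * c j * \1_(`[Num.max (u i) (u j), Num.min (v i) (v j)[%classic) s)%:E))%E.
  apply: eq_integral => s _; rewrite expr2 /step mulr_suml -sumEFin.
  apply: eq_bigr => i _; rewrite mulr_sumr -sumEFin; apply: eq_bigr => j _.
  rewrite mulrACA; congr (_ * _)%:E.
  rewrite !indicE -natrM mulnb; congr (_%:R); congr (nat_of_bool _).
  by rewrite -in_setI; congr (_ \in _); apply/seteqP; split => x /=;
    rewrite !in_itv/= ge_max lt_min; [move=> [/andP[-> ->] /andP[-> ->]]|
    move=> /andP[/andP[-> ->] /andP[-> ->]]].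
have iij i j : mu.-integrable `[0%R, t] (fun s =>
   (c i * c j * \1_(`[Num.max (u i) (u j), Num.min (v i) (v j)[%classic) s)%:E).
  have ii : mu.-integrable `[0%R, t]
      (EFin \o \1_(`[Num.max (u i) (u j), Num.min (v i) (v j)[%classic)).
    exact: integrableS (integrable_indic_itv _ _ _ _).
  exact: (integrableZl _ (c i * c j) ii).
rewrite integral_sum//; last by move=> i; exact: integrable_sum.
rewrite -sumEFin; apply: eq_bigr => i _.
by rewrite integral_sum// -sumEFin; apply: eq_bigr => j _; exact: ind.
Qed.

End step_functions.

(** * The Ito integral of a deterministic function *)

Section ito_integral.
Context d (T : measurableType d) (R : realType) (P : probability T R).
Local Notation mu := (@lebesgue_measure R).
Variables (F : R -> set (set T)) (W : R -> T -> R) (bW : brownian P F W).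
Variables (t : R) (t0 : 0 <= t) (t1 : t <= 1).

Lemma sp_time_le (H : simple_process F t) i j : (i <= j)%N -> (j <= sp_size H)%N ->
  sp_time H i <= sp_time H j.
Proof.
move=> ij; elim: j ij => [|j IH]; first by rewrite leqn0 => /eqP ->.
rewrite leq_eqVlt => /predU1P[->//|ij] js.
by rewrite (le_trans (IH _ (ltnW js)))// ltW// sp_time_lt.
Qed.

Lemma sp_time_ge0 (H : simple_process F t) i : (i <= sp_size H)%N -> 0 <= sp_time H i.
Proof. by move=> iH; rewrite -(sp_time0 H) sp_time_le. Qed.

Lemma sp_time_leT (H : simple_process F t) i : (i <= sp_size H)%N -> sp_time H i <= t.
Proof. by move=> iH; rewrite -[leRHS](sp_timeT H) sp_time_le. Qed.

Section difference.
Variables (H : simple_process F t) (K : finType) (g a b : K -> R).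
Hypotheses (a0 : forall k, 0 <= a k) (ab : forall k, a k <= b k)
  (bt : forall k, b k <= t).

(* The difference of the two integrals is one sum over a disjoint union of
   index types, the step function contributing constant coefficients. *)
Let J := ('I_(sp_size H) + K)%type.
Let xi (i : J) : T -> R :=
  match i with inl i => sp_coef H i | inr k => fun _ => - g k end.
Let u (i : J) := match i with inl i => sp_time H i | inr k => a k end.
Let v (i : J) := match i with inl i => sp_time H i.+1 | inr k => b k end.

Let u0 i : 0 <= u i. Proof. by case: i => [i|k] //=; rewrite sp_time_ge0// ltnW. Qed.
Let uv i : u i <= v i. Proof. by case: i => [i|k] //=; rewrite ltW// sp_time_lt. Qed.
Let vt i : v i <= t. Proof. by case: i => [i|k] //=; rewrite sp_time_leT. Qed.
Let v1 i : v i <= 1. Proof. by rewrite (le_trans (vt i)). Qed.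
Let axi i : adapted (F (u i)) (xi i).
Proof.
case: i => [i|k] /=; first by move=> A mA; exact: sp_adapted.
by apply: adapted_cst; exact: bro_sigma bW _.
Qed.
Let bxi i : bounded_rv (xi i).
Proof. by case: i => [i|k] /=; [exact: sp_bounded|exists `|- g k|]. Qed.

Let integralE x : sp_integral H W x - \sum_k g k * inc W (a k) (b k) x =
  \sum_i xi i x * inc W (u i) (v i) x.
Proof.
rewrite big_sumType/= /sp_integral; congr (_ + _).
by rewrite -sumrN; apply: eq_bigr => k _; rewrite mulNr.
Qed.

Let valE x s : sp_val H s x - step g a b s = step (xi ^~ x) u v s.
Proof.
rewrite /step big_sumType/= /sp_val; congr (_ + _).
by rewrite -sumrN; apply: eq_bigr => k _; rewrite mulNr.
Qed.

Lemma L2_simple_difference :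
  L2 P (fun x => sp_integral H W x - \sum_k g k * inc W (a k) (b k) x).
Proof.
have -> : (fun x => sp_integral H W x - \sum_k g k * inc W (a k) (b k) x) =
  (fun x => \sum_i xi i x * inc W (u i) (v i) x) by apply/funext => x.
exact: (L2_simple_integral bW).
Qed.

Lemma simple_difference_isometry :
  ((sqn P (fun x => sp_integral H W x - \sum_k g k * inc W (a k) (b k) x))%:E =
  \int[P]_x \int[mu]_(s in `[0%R, t]) ((sp_val H s x - step g a b s) ^+ 2)%:E)%E.
Proof.
have -> : (fun x => sp_integral H W x - \sum_k g k * inc W (a k) (b k) x) =
  (fun x => \sum_i xi i x * inc W (u i) (v i) x) by apply/funext => x.
rewrite (simple_integral_isometry bW)//.
rewrite /Rintegral fineK; last first.
  apply: integrable_fin_num => //; apply: L1_sum => i; apply: L1_sum => j.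
  under eq_fun do rewrite mulrC; apply/L1Z/L2_mul.
    exact: L2_bounded (adapted_measurable (@bro_measurable _ _ _ _ _ _ bW (u i)) (axi i)) (bxi i).
  exact: L2_bounded (adapted_measurable (@bro_measurable _ _ _ _ _ _ bW (u j)) (axi j)) (bxi j).
apply: eq_integral => x _; rewrite -(integral_step_sqr (xi ^~ x) u0 vt).
by apply: eq_integral => s _; rewrite -valE.
Qed.
End difference.

Lemma measurable_sp_val_section (H : simple_process F t) x :
  measurable_fun [set: R] (sp_val H ^~ x).
Proof.
by apply: measurable_sum => i; exact: measurable_funM.
Qed.

(** By Tonelli's theorem, since the integrand is jointly measurable. *)
Lemma measurable_ito_error (f : R -> R) (H : simple_process F t) :
  measurable_fun [set: R] f ->
  measurable_fun setT
    (fun x => \int[mu]_(s in `[0%R, t]) ((f s - sp_val H s x) ^+ 2)%:E)%E.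
Proof.
move=> mf; pose h (z : T * measurableTypeR R) : \bar R :=
  ((f z.2 - sp_val H z.2 z.1) ^+ 2 * \1_(`[0%R, t]%classic) z.2)%:E.
have msnd (q : R -> R) : measurable_fun [set: R] q ->
    measurable_fun setT (fun z : T * measurableTypeR R => q z.2).
  by move=> mq; exact: (measurableT_comp mq measurable_snd).
have mfst (q : T -> R) : measurable_fun setT q ->
    measurable_fun setT (fun z : T * measurableTypeR R => q z.1).
  by move=> mq; exact: (measurableT_comp mq measurable_fst).
have mh : measurable_fun setT h.
  apply/measurable_EFinP; apply: measurable_funM; last first.
    by apply: msnd; exact: measurable_indic.
  apply: measurable_funX; apply: measurable_funB.
    exact: msnd.
  apply: measurable_sum => i; apply: measurable_funM.
    apply: mfst.
    apply: (adapted_measurable (@bro_measurable _ _ _ _ _ _ bW (sp_time H i))).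
    by move=> A mA; exact: sp_adapted.
  by apply: msnd; exact: measurable_indic.
have -> : (fun x => \int[mu]_(s in `[0%R, t]) ((f s - sp_val H s x) ^+ 2)%:E)%E =
   fubini_F mu h.
  apply/funext => x; rewrite integral_mkcond; apply: eq_integral => s _.
  by rewrite patchE /h indicE; case: ifP => _ /=; rewrite ?mulr1 ?mulr0.
apply: measurable_fun_fubini_tonelli_F => // z.
by rewrite lee_fin mulr_ge0 ?sqr_ge0.
Qed.

Variables (f : R -> R) (mf : measurable_fun [set: R] f).

(** The isometry for H - g, followed by
(H - g)^2 <= 2 (f - H)^2 + 2 (f - g)^2. *)
Lemma sqn_simple_difference_le (H : simple_process F t) (K : finType) (g a b : K -> R) :
  (forall k, 0 <= a k) -> (forall k, a k <= b k) -> (forall k, b k <= t) ->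
  ((sqn P (fun x => sp_integral H W x - (\sum_k g k * inc W (a k) (b k) x)%R))%:E <=
   2%:E * \int[P]_x \int[mu]_(s in `[0%R, t]) ((f s - sp_val H s x) ^+ 2)%:E +
   2%:E * \int[mu]_(s in `[0%R, t]) ((f s - step g a b s) ^+ 2)%:E)%E.
Proof.
move=> a0 ab bt; rewrite simple_difference_isometry//.
set C := (\int[mu]_(s in `[0%R, t]) ((f s - step g a b s) ^+ 2)%:E)%E.
have msq (q : R -> R) : measurable_fun [set: R] q ->
    measurable_fun (`[0%R, t] : set (measurableTypeR R)) (fun s => (q s ^+ 2)%:E).
  by move=> mq; apply/measurable_EFinP/measurable_funTS; exact: measurable_funX.
have mval x : measurable_fun [set: R] (fun s => f s - sp_val H s x).
  by apply: measurable_funB => //; exact: measurable_sp_val_section.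
have mg : measurable_fun [set: R] (fun s => f s - step g a b s).
  by apply: measurable_funB => //; exact: measurable_step.
have mvg x : measurable_fun [set: R] (fun s => sp_val H s x - step g a b s).
  by apply: measurable_funB; [exact: measurable_sp_val_section|exact: measurable_step].
have C0 : (0 <= C)%E by apply: integral_ge0 => s _; rewrite lee_fin sqr_ge0.
have e0 x : (0 <= \int[mu]_(s in `[0%R, t]) ((f s - sp_val H s x) ^+ 2)%:E)%E.
  by apply: integral_ge0 => s _; rewrite lee_fin sqr_ge0.
have pw x : (\int[mu]_(s in `[0%R, t]) ((sp_val H s x - step g a b s) ^+ 2)%:E <=
   2%:E * \int[mu]_(s in `[0%R, t]) ((f s - sp_val H s x) ^+ 2)%:E + 2%:E * C)%E.
  rewrite /C -!ge0_integralZl//; try exact: msq; try by move=> s _; rewrite lee_fin sqr_ge0.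
  rewrite -ge0_integralD//.
  - apply: ge0_le_integral => //.
    + by move=> s _; rewrite lee_fin sqr_ge0.
    + exact: msq.
    + apply: emeasurable_funD; apply: emeasurable_funM => //; exact: msq.
    + move=> s _; rewrite -!EFinM -EFinD lee_fin.
      have := sqr_ge0 ((f s - sp_val H s x) + (f s - step g a b s)).
      lra.
  - by move=> s _; rewrite -EFinM lee_fin mulr_ge0 ?sqr_ge0.
  - by apply: emeasurable_funM => //; exact: msq.
  - by move=> s _; rewrite -EFinM lee_fin mulr_ge0 ?sqr_ge0.
  - by apply: emeasurable_funM => //; exact: msq.
have me := measurable_ito_error H mf.
apply: (@le_trans _ _ (\int[P]_x (2%:E *
   \int[mu]_(s in `[0%R, t]) ((f s - sp_val H s x) ^+ 2)%:E + 2%:E * C))%E).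
  apply: ge0_le_integral => //.
  - by move=> x _; apply: integral_ge0 => s _; rewrite lee_fin sqr_ge0.
  - rewrite (_ : (fun x => _) = (fun x =>
      \int[mu]_(s in `[0%R, t]) ((step g a b s - sp_val H s x) ^+ 2)%:E)%E); last first.
      by apply/funext => x; apply: eq_integral => s _; rewrite -sqrrN opprB.
    by apply: measurable_ito_error; exact: measurable_step.
  - apply: emeasurable_funD; last exact: measurable_cst.
    by apply: emeasurable_funM.
rewrite ge0_integralD//.
- rewrite ge0_integralZl// leeD2l// integral_cst//=.
  by rewrite probability_setT mule1.
- by move=> x _; rewrite mule_ge0.
- by apply: emeasurable_funM.
- by move=> x _; rewrite mule_ge0.
Qed.

Variable I : {RV P >-> R}.
Hypothesis ito : is_ito_integral F W t (fun s _ => f s) I.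

Lemma ecvg0_near (u : nat -> \bar R) (e : R) : 0 < e ->
  (u n @[n --> \oo] --> 0)%E -> \forall n \near \oo, (u n < e%:E)%E.
Proof.
move=> e0 u0; apply: (u0 [set x | (x < e%:E)%E]); apply: open_nbhs_nbhs; split; last by rewrite /= lte_fin.
exact: open_ereal_lt_ereal.
Qed.

Lemma ito_near (e : R) : 0 < e -> exists H : simple_process F t,
  (\int[P]_x \int[mu]_(s in `[0%R, t]) ((f s - sp_val H s x) ^+ 2)%:E < e%:E)%E /\
  (\int[P]_x ((I x - sp_integral H W x) ^+ 2)%:E < e%:E)%E.
Proof.
move=> e0; have [H [H1 H2]] := ito; rewrite unlock in H2.
near \oo => k; exists (H k); split.
  by near: k; exact: ecvg0_near H1.
by near: k; exact: ecvg0_near H2.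
Unshelve. all: by end_near. Qed.

Lemma L2_sp_integral (H : simple_process F t) : L2 P (sp_integral H W).
Proof.
have := @L2_simple_difference H void (fun=> 0) (fun=> 0) (fun=> 0).
rewrite (_ : (fun x => _ - _) = sp_integral H W); last first.
  by apply/funext => x; rewrite big1 ?subr0// => -[].
by apply => -[].
Qed.

Lemma L2_ito_integral : L2 P I.
Proof.
have [H [_ HI]] := ito_near ltr01.
have mI : measurable_fun setT I by [].
have H2 := L2_sp_integral H.
have D2 : L2 P (fun x => I x - sp_integral H W x).
  split; first by apply: measurable_funB => //; case: H2.
  apply/integrableP; split.
    apply/measurable_EFinP; apply: measurable_funX; apply: measurable_funB => //.
    by case: H2.
  under eq_integral do rewrite gee0_abs ?lee_fin ?sqr_ge0//.
  by rewrite (lt_trans HI) ?ltry.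
rewrite (_ : I = (fun x => (I x - sp_integral H W x) + sp_integral H W x) :> (T -> R)).
  exact: L2D.
by apply/funext => x; rewrite subrK.
Qed.

Lemma sqnE (Y : T -> R) : L2 P Y -> ((sqn P Y)%:E = \int[P]_x (Y x ^+ 2)%:E)%E.
Proof.
move=> [mY iY]; rewrite /sqn ipE /Rintegral; under eq_integral do rewrite -expr2.
by rewrite fineK//; exact: integrable_fin_num.
Qed.

(** The simple processes that define the Ito integral I of f may be random. This
bound replaces them by deterministic step functions g, whose integrals are
combinations of increments and have an explicit Karhunen-Loeve expansion. The
constant 4 comes from using the squared triangle inequality twice; the error of
the simple process can be made arbitrarily small. *)
Lemma ito_step_bound (K : finType) (g a b : K -> R) :
  (forall k, 0 <= a k) -> (forall k, a k <= b k) -> (forall k, b k <= t) ->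
  ((sqn P (fun x => I x - (\sum_k g k * inc W (a k) (b k) x)%R))%:E <=
   4%:E * \int[mu]_(s in `[0%R, t]) ((f s - step g a b s) ^+ 2)%:E)%E.
Proof.
move=> a0 ab bt; apply/lee_addgt0Pr => e e0.
have e6 : 0 < e / 6 by rewrite divr_gt0.
have [H [H1 H2]] := ito_near e6.
have HS := sqn_simple_difference_le H g a0 ab bt.
have I2 := L2_ito_integral; have HI2 := L2_sp_integral H.
have S2 : L2 P (fun x => \sum_k g k * inc W (a k) (b k) x).
  apply: L2_sum => k; apply: L2Z.
  by have [] := inc_moments bW (a0 k) (ab k) (le_trans (bt k) t1).
have := sqn_le2 I2 HI2 S2; rewrite -lee_fin => /le_trans; apply.
rewrite EFinD !EFinM sqnE; last exact: L2B.
apply: (@le_trans _ _ (2%:E * (e / 6)%:E + 2%:E * (2%:E * (e / 6)%:E +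
   2%:E * \int[mu]_(s in `[0%R, t]) ((f s - step g a b s) ^+ 2)%:E)))%E.
  apply: leeD; first by rewrite lee_pmul2l// ltW.
  rewrite lee_pmul2l// (le_trans HS)// leeD2r// lee_pmul2l// ltW//.
rewrite muleDr// addeA -!EFinM -EFinD addeC.
rewrite muleA -EFinM (_ : 2 * 2 = 4)%R; last by ring.
by rewrite (_ : 2 * (e / 6) + 2 * (2 * (e / 6)) = e)%R//; field.
Qed.
End ito_integral.

(** * The closed span of an orthonormal sequence *)

Section closed_span.
Context d (T : measurableType d) (R : realType) (P : probability T R).
Implicit Types X Y : T -> R.

Lemma sqn0 : sqn P (fun _ => 0) = 0.
Proof.
rewrite /sqn ipE; under eq_Rintegral do rewrite mulr0.
by rewrite Rintegral_cst// mul0r.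
Qed.

Variables (e : nat -> T -> R) (e_on : orthonormal_rv P e).
Local Notation L2 := (L2 P).
Local Notation ip := (ip P).
Local Notation sqn := (sqn P).

Let e2 k : L2 (e k). Proof. by have [] := e_on. Qed.

Definition expansion (N : nat) (X : T -> R) (x : T) : R :=
  \sum_(0 <= k < N) ip X (e k) * e k x.

(** Membership in the closed linear span of the e k, expressed by the
convergence of the Fourier expansion. *)
Definition spanned (X : T -> R) : Prop :=
  sqn (fun x => X x - expansion N X x) @[N --> \oo] --> 0.

Lemma L2_expansion N X : L2 (expansion N X).
Proof. exact: L2_lincomb. Qed.

Lemma L2_residual N X : L2 X -> L2 (fun x => X x - expansion N X x).
Proof. by move=> X2; apply: L2B => //; exact: L2_expansion. Qed.

Lemma cvg0_le (u v : nat -> R) : (forall n, 0 <= u n <= v n) ->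
  v n @[n --> \oo] --> 0 -> u n @[n --> \oo] --> 0.
Proof.
move=> uv v0; apply: (@squeeze_cvgr _ _ _ _ (fun=> 0) v) => //.
  by near=> n; exact: uv.
exact: cvg_cst.
Unshelve. all: by end_near. Qed.

Lemma cvg0_comb (a b : R) (u v : nat -> R) :
  u n @[n --> \oo] --> 0 -> v n @[n --> \oo] --> 0 ->
  a * u n + b * v n @[n --> \oo] --> 0.
Proof.
move=> u0 v0; rewrite -[X in _ --> X](addr0 0) -[X in X + _](mulr0 a) -[X in _ + X](mulr0 b).
by apply: cvgD; exact: cvgMl_tmp.
Qed.

(** If some series in the e k converges to X, so does the Fourier expansion, by
best approximation. *)
Lemma spanned_of_cvg X (c : nat -> R) : L2 X ->
  sqn (fun x => X x - \sum_(0 <= k < N) c k * e k x) @[N --> \oo] --> 0 ->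
  spanned X.
Proof.
move=> X2; apply: cvg0_le => N; rewrite sqn_ge0/=.
by rewrite sqn_projection ?iota_uniq// sqn_lincomb_ge// iota_uniq.
Qed.

Lemma sqnD_le X Y : L2 X -> L2 Y ->
  sqn (fun x => X x + Y x) <= 2 * sqn X + 2 * sqn Y.
Proof.
move=> X2 Y2; rewrite sqnD//.
by have := sqn_ge0 P (fun x => X x - Y x); rewrite sqnB//; lra.
Qed.

Lemma spannedDZ (a : R) X Y : L2 X -> L2 Y -> spanned X -> spanned Y ->
  spanned (fun x => a * X x + Y x).
Proof.
move=> X2 Y2 sX sY.
apply: (spanned_of_cvg (c := fun k => a * ip X (e k) + ip Y (e k))).
  by apply: L2D => //; exact: L2Z.
apply: (@cvg0_le _ (fun N => 2 * a ^+ 2 * sqn (fun x => X x - expansion N X x) +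
    2 * sqn (fun x => Y x - expansion N Y x))).
  move=> N; rewrite sqn_ge0/= -mulrA -sqnZ; last exact: L2_residual.
  apply: le_trans (sqnD_le _ _); [|exact/L2Z/L2_residual|exact: L2_residual].
  rewrite le_eqVlt; apply/orP; left; apply/eqP; congr sqn; apply/funext => x.
  rewrite /expansion; under eq_bigr do rewrite mulrDl -mulrA.
  by rewrite big_split/= -mulr_sumr; ring.
exact: cvg0_comb sX sY.
Qed.

(** By best approximation, the residual of X is at most the distance from X to
the expansion of Y, hence small with X - Y and the residual of Y. *)
Lemma spanned_closed X : L2 X ->
  (forall eps, 0 < eps ->
    exists Y, [/\ L2 Y, spanned Y & sqn (fun x => X x - Y x) <= eps]) ->
  spanned X.
Proof.
move=> X2 H; apply/cvgrPdist_le => eps eps0.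
have [Y [Y2 sY XY]] := H (eps / 4) ltac:(by rewrite divr_gt0).
move/cvgrPdist_le : sY => /(_ (eps / 4) ltac:(by rewrite divr_gt0)).
apply: filterS => N.
rewrite !sub0r !normrN ger0_norm; last exact: sqn_ge0.
move=> YN; rewrite ger0_norm; last exact: sqn_ge0.
have pY2 := L2_expansion N Y.
apply: (@le_trans _ _ (sqn (fun x => X x - expansion N Y x))).
  by rewrite sqn_projection ?iota_uniq// sqn_lincomb_ge// iota_uniq.
by apply: (le_trans (sqn_le2 X2 Y2 pY2)); lra.
Qed.

Lemma spanned_lincomb (I : Type) (s : seq I) (c : I -> R) (X : I -> T -> R) :
  (forall i, L2 (X i)) -> (forall i, spanned (X i)) ->
  spanned (fun x => \sum_(i <- s) c i * X i x).
Proof.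
move=> X2 sX; elim: s => [|i s IH].
  apply: (spanned_of_cvg (c := fun=> 0)).
    by under eq_fun do rewrite big_nil; exact: L2_cst.
  rewrite (_ : (fun N => _) = fun=> 0); first exact: cvg_cst.
  apply/funext => N; rewrite -[RHS]sqn0; congr sqn; apply/funext => x.
  by rewrite big_nil big1 ?subrr// => k _; rewrite mul0r.
under eq_fun do rewrite big_cons.
apply: spannedDZ; [exact: X2| |exact: sX|exact: IH].
by apply: L2_sum => j; exact: L2Z.
Qed.
End closed_span.

(** * Riemann sums on a uniform grid *)

Section uniform_grid.
Context (R : realType).
Local Notation mu := (@lebesgue_measure R).
Variables (t : R) (t0 : 0 <= t) (M : nat).

Definition grid (i : nat) : R := t * (i%:R / M.+1%:R).

Lemma grid_ge0 i : 0 <= grid i.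
Proof. by rewrite mulr_ge0// divr_ge0. Qed.

Lemma grid_le i j : (i <= j)%N -> grid i <= grid j.
Proof. by move=> ij; rewrite ler_wpM2l// ler_wpM2r ?invr_ge0// ler_nat. Qed.

Lemma grid_leT i : (i <= M.+1)%N -> grid i <= t.
Proof.
move=> iM; rewrite -[leRHS]mulr1 ler_wpM2l// ler_pdivrMr ?ltr0n// mul1r ler_nat.
exact: iM.
Qed.

Variables (f : R -> R) (cf : continuous f) (K : R) (K0 : 0 <= K).
Hypothesis lip : forall x y : R, 0 <= x -> x <= y -> y <= t -> `|f y - f x| <= K * (y - x).

Definition grid_step : R -> R :=
  step (fun i : 'I_M.+1 => f (grid i)) (fun i => grid i) (fun i => grid i.+1).

Definition mesh_error : R := K * (t / M.+1%:R).

Lemma mesh_error_ge0 : 0 <= mesh_error.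
Proof. by rewrite mulr_ge0// divr_ge0. Qed.

Lemma grid_step_error s : 0 <= s -> s < t -> `|f s - grid_step s| <= mesh_error.
Proof.
move=> s0 st; have tgt0 : 0 < t by rewrite (le_lt_trans s0).
have M0 : (0 : R) < M.+1%:R by rewrite ltr0n.
have x0 : 0 <= s / t * M.+1%:R by rewrite mulr_ge0// divr_ge0.
have /andP[n1 n2] := Num.Theory.truncn_itv x0.
set n := Num.truncn _ in n1 n2.
have nM : (n < M.+1)%N.
  rewrite -(ltr_nat R) (le_lt_trans n1)// -[ltRHS]mul1r ltr_pM2r// ltr_pdivrMr//.
  by rewrite mul1r.
have eg (i : nat) : (grid i <= s) = (i%:R <= s / t * M.+1%:R).
  by rewrite /grid mulrC -ler_pdivlMr// ler_pdivrMr.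
have mem (i : nat) : (s \in `[grid i, grid i.+1[) = (n == i).
  by rewrite in_itv/= eg ltNge eg -ltNge truncn_eq.
have -> : grid_step s = f (grid n).
  rewrite /grid_step /step (bigD1 (Ordinal nM))//= indicE mem_setE mem eqxx mulr1.
  rewrite big1 ?addr0// => i /eqP ni; rewrite indicE mem_setE mem.
  case: eqP => [e|]; last by rewrite mulr0.
  by case: ni; apply/val_inj.
have gs : grid n <= s by rewrite eg.
apply: (le_trans (lip (grid_ge0 n) gs (ltW st))).
rewrite /mesh_error ler_wpM2l//.
have sg : s < grid n.+1 by rewrite ltNge eg -ltNge.
have -> : t / M.+1%:R = grid n.+1 - grid n.
  by rewrite /grid -mulrBr -mulrBl -natrB// subSnn mul1r.
by rewrite lerD2r ltW.
Qed.

Let cst_cos (la : R) : continuous (fun s : R => cos (la * s)).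
Proof.
move=> s; apply: continuous_comp; last exact: continuous_cos.
by apply: cvgMl_tmp; exact: cvg_id.
Qed.

Lemma continuous_itv_integrable (q : R -> R) (a b : R) : continuous q ->
  mu.-integrable `[a, b] (EFin \o q).
Proof.
move=> cq; apply: continuous_compact_integrable; first exact: segment_compact.
exact: continuous_subspaceT.
Qed.

Lemma integral_grid_error :
  (\int[mu]_(s in `[0%R, t]) ((f s - grid_step s) ^+ 2)%:E <= (mesh_error ^+ 2 * t)%:E)%E.
Proof.
have mfg : measurable_fun [set: R] (fun s => f s - grid_step s).
  apply: measurable_funB; first exact: continuous_measurable_fun.
  exact: measurable_step.
rewrite -integral_itv_bndo_bndc; last first.
  by apply/measurable_EFinP/measurable_funTS; exact: measurable_funX.
apply: (@le_trans _ _ (\int[mu]_(s in `[0%R, t[) (cst (mesh_error ^+ 2)%:E s))%E).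
  apply: ge0_le_integral => //.
  - by move=> s _; rewrite lee_fin sqr_ge0.
  - by apply/measurable_EFinP/measurable_funTS; exact: measurable_funX.
  - move=> s /=; rewrite in_itv/= => /andP[s0 st]; rewrite lee_fin -real_normK ?num_real//.
    by rewrite ler_pXn2r ?nnegrE ?mesh_error_ge0// grid_step_error.
rewrite integral_cst//=.
have := lebesgue_measure_itv `[0, t[; rewrite /= lte_fin => ->.
by case: ifP => _; rewrite ?oppr0 ?adde0 ?mule0 -?EFinM ?lee_fin ?mulr_ge0 ?sqr_ge0.
Qed.

Lemma bounded_itv_integrable (q : R -> R) (a b C : R) : measurable_fun [set: R] q ->
  (forall s, `|q s| <= C) -> mu.-integrable `[a, b] (EFin \o q).
Proof.
move=> mq qC; have ic : mu.-integrable `[a, b] (EFin \o (fun _ : R => C)).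
  by apply: continuous_itv_integrable => x; exact: cvg_cst.
apply: (le_integrable _ _ _ ic) => //.
  by apply/measurable_EFinP/measurable_funTS.
by move=> s _ /=; rewrite lee_fin (le_trans (qC s))// ler_norm.
Qed.

Lemma integral_cos (la a b : R) : la != 0 -> a <= b ->
  \int[mu]_(s in `[a, b]) cos (la * s) = (sin (la * b) - sin (la * a)) / la.
Proof.
move=> la0; rewrite le_eqVlt => /predU1P[->|ab].
  by rewrite set_itv1 Rintegral_set1 subrr mul0r.
pose G := fun s : R => la^-1 *: sin (la * s).
have dG (x : R) : is_derive x 1 G (cos (la * x)).
  have H : is_derive x 1 (fun s : R => la * s) la.
    have -> : (fun s : R => la * s) = (fun s : R => la *: id s) by [].
    by apply: is_derive_eq; rewrite /GRing.scale/= mulr1.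
  rewrite /G; apply: is_derive_eq; rewrite /GRing.scale/=.
  by field.
have cG : continuous G.
  by move=> x; apply/differentiable_continuous/derivable1_diffP; have [] := dG x.
rewrite /Rintegral (@continuous_FTC2 _ _ G)//.
- by rewrite -EFinB /= /G /GRing.scale/= -mulrBr mulrC.
- by apply: continuous_subspaceT.
- split.
  + by move=> x _; have [] := dG x.
  + exact/cvg_at_right_filter/cG.
  + exact/cvg_at_left_filter/cG.
- by move=> x _; rewrite derive1E; have [_ ->] := dG x.
Qed.

(** The bracket is the integral of cos (la s) over [u i, v i]. For la = lambda k
it is also, up to the factor sqrt 2, the k-th Karhunen-Loeve coefficient of the
increment of w over this interval; this coincidence is what turns sines into
the cosines of phicos. *)
Lemma integral_step_cos (I : finType) (c u v : I -> R) (la : R) : la != 0 ->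
  (forall i, 0 <= u i) -> (forall i, u i <= v i) -> (forall i, v i <= t) ->
  mu.-integrable `[0, t] (EFin \o (fun s => step c u v s * cos (la * s))) /\
  \int[mu]_(s in `[0, t]) (step c u v s * cos (la * s)) =
  \sum_i c i * ((sin (la * v i) - sin (la * u i)) / la).
Proof.
move=> la0 u0 uv vt.
have mcos : measurable_fun [set: R] (fun s : R => cos (la * s)).
  by apply: continuous_measurable_fun; exact: cst_cos.
have i1 i : mu.-integrable `[0, t] (EFin \o (fun s => cos (la * s) * \1_(`[u i, v i[%classic) s)).
  apply: (@bounded_itv_integrable _ _ _ 1).
    by apply: measurable_funM => //; exact: measurable_indic.
  move=> s; rewrite normrM indicE; case: (_ \in _); rewrite ?normr1 ?normr0 ?mulr0// mulr1.
  by rewrite ler_norml cos_geN1 cos_le1.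
have e1 i : \int[mu]_(s in `[0, t]) (cos (la * s) * \1_(`[u i, v i[%classic) s) =
    (sin (la * v i) - sin (la * u i)) / la.
  rewrite -integral_cos// -Rintegral_itv_bndo_bndc; last first.
    apply: (integrableS _ _ _ (continuous_itv_integrable (u i) (v i) (@cst_cos la))) => //.
    by apply: subset_itvl; rewrite bnd_simp.
  have uvt : `[0, t]%classic `&` `[u i, v i[%classic = `[u i, v i[%classic :> set R.
    apply/setIidPr => s /=; rewrite !in_itv/= => /andP[us sv].
    by rewrite (le_trans (u0 i))//= (le_trans (ltW sv)).
  rewrite -[in RHS]uvt Rintegral_mkcondr; apply: eq_Rintegral => s _.
  by rewrite patchE indicE; case: (s \in _); rewrite ?mulr1 ?mulr0.
have stepE s : step c u v s * cos (la * s) =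
    \sum_i c i * (cos (la * s) * \1_(`[u i, v i[%classic) s).
  by rewrite /step mulr_suml; apply: eq_bigr => i _; ring.
have ii i : mu.-integrable `[0, t]
    (EFin \o (fun s => c i * (cos (la * s) * \1_(`[u i, v i[%classic) s))).
  exact: (integrableZl _ (c i) (i1 i)).
split.
  rewrite (_ : EFin \o _ = (fun s => \sum_i (c i * (cos (la * s) * \1_(`[u i, v i[%classic) s))%:E)%E).
    exact: (@integrable_sum _ _ _ mu `[0, t]%classic (measurable_itv _) I (index_enum I) xpredT _ (fun i _ => ii i)).
  by apply/funext => s /=; rewrite stepE sumEFin.
rewrite /Rintegral; under eq_integral do rewrite stepE -sumEFin.
rewrite integral_sum//.
rewrite (eq_bigr (fun i => (c i * ((sin (la * v i) - sin (la * u i)) / la))%:E)) => [|i _].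
  by rewrite sumEFin.
rewrite -e1 -RintegralZl//.
rewrite /Rintegral fineK//.
by have := integrable_fin_num _ (ii i); apply.
Qed.

Lemma integral_grid_cos_error (la : R) : la != 0 ->
  `| \int[mu]_(s in `[0, t]) (f s * cos (la * s)) -
     \sum_(i < M.+1) f (grid i) * ((sin (la * grid i.+1) - sin (la * grid i)) / la) | <=
  mesh_error * t.
Proof.
move=> la0.
have [istep <-] := @integral_step_cos 'I_M.+1 (fun i => f (grid i)) (fun i => grid i)
  (fun i => grid i.+1) la la0 (fun i => grid_ge0 i) (fun i => grid_le (leqnSn i))
  (fun i => grid_leT (ltn_ord i)).
have ifc : mu.-integrable `[0, t] (EFin \o (fun s => f s * cos (la * s))).
  apply: continuous_itv_integrable => x; apply: cvgM; first exact: cf.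
  exact: cst_cos.
rewrite -RintegralB//.
have id : mu.-integrable `[0, t] (EFin \o (fun s => f s * cos (la * s) - grid_step s * cos (la * s))).
  by have := integrableB _ ifc istep; apply.
apply: (le_trans (le_normr_Rintegral _ id)) => //.
have ian := integrable_norm id.
rewrite -Rintegral_itv_bndo_bndc; last first.
  by apply: (integrableS _ _ _ ian) => //; apply: subset_itvl; rewrite bnd_simp.
apply: (@le_trans _ _ (\int[mu]_(s in `[0, t[) (cst mesh_error s))).
  apply: le_Rintegral => //.
  - by apply: (integrableS _ _ _ ian) => //; apply: subset_itvl; rewrite bnd_simp.
  - apply: (integrableS _ _ _ (continuous_itv_integrable 0 t (q := cst mesh_error) _)) => //.
      by apply: subset_itvl; rewrite bnd_simp.
    by move=> x; exact: cvg_cst.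
  - move=> s /=; rewrite in_itv/= => /andP[s0 st].
    rewrite -mulrBl normrM -[leRHS]mulr1 ler_pM//; first exact: grid_step_error.
    by rewrite ler_norml cos_geN1 cos_le1.
rewrite Rintegral_cst//=.
have := lebesgue_measure_itv `[0, t[; rewrite /= lte_fin => ->.
by case: ifP => _; rewrite ?oppr0 ?adde0//= mulr0 mulr_ge0// mesh_error_ge0.
Qed.

End uniform_grid.

(** * Karhunen-Loeve coefficients of an Ito integral *)

Section karhunen_loeve_coefficients.
Context d (T : measurableType d) (R : realType) (P : probability T R).
Local Notation mu := (@lebesgue_measure R).
Local Notation ip := (ip P).
Local Notation sqn := (sqn P).
Variables (F : R -> set (set T)) (w : R -> T -> R) (bw : brownian P F w).
(* The indices are shifted: e k stands for Z_{k+1}. *)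
Variables (e : nat -> T -> R) (e_on : orthonormal_rv P e).
Hypothesis w2 : forall b : R, 0 <= b <= 1 -> L2 P (w b).
Hypothesis kl : forall b : R, 0 <= b <= 1 ->
  sqn (fun x => w b x - \sum_(0 <= k < N)
     (Num.sqrt 2 * (sin (lambda k.+1 * b) / lambda k.+1)) * e k x) @[N --> \oo] --> 0.

Let e2 k : L2 P (e k). Proof. by have [] := e_on. Qed.

Lemma spanned_wiener b : 0 <= b <= 1 -> spanned P e (w b).
Proof. by move=> b01; apply: (spanned_of_cvg e_on (w2 b01) (kl b01)). Qed.

Lemma ip_wiener b k : 0 <= b <= 1 ->
  ip (w b) (e k) = Num.sqrt 2 * (sin (lambda k.+1 * b) / lambda k.+1).
Proof.
move=> b01.
have S2 N : L2 P (fun x => \sum_(0 <= k < N)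
     (Num.sqrt 2 * (sin (lambda k.+1 * b) / lambda k.+1)) * e k x).
  exact: L2_lincomb.
have h1 := ip_cvg S2 (w2 b01) (e2 k) (kl b01).
apply: (cvg_unique _ h1); first exact: Rhausdorff.
apply: cvg_near_cst; near=> N.
rewrite (ip_lincomb_basis e_on) ?iota_uniq// mem_index_iota/= ifT//.
by near: N; exists k.+1.
Unshelve. all: by end_near. Qed.

Lemma lambda_gt0 k : 0 < lambda k.+1 :> R.
Proof.
rewrite mulr_gt0 ?pi_gt0// subr_gt0.
by rewrite (@lt_le_trans _ _ 1)// ?invf_lt1// ?ltr1n// ler1n.
Qed.

Variables (t : R) (t0 : 0 <= t) (t1 : t <= 1).
Variables (f : R -> R) (cf : continuous f) (K : R) (K0 : 0 <= K).
Hypothesis lip : forall x y : R, 0 <= x -> x <= y -> y <= t -> `|f y - f x| <= K * (y - x).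
Variable I : {RV P >-> R}.
Hypothesis ito : is_ito_integral F w t (fun s _ => f s) I.

Let S (M : nat) (x : T) : R :=
  \sum_(i < M.+1) f (grid t M i) * inc w (grid t M i) (grid t M i.+1) x.

Let grid01 M i : (i <= M.+1)%N -> 0 <= grid t M i <= 1.
Proof. by move=> iM; rewrite grid_ge0//= (le_trans (grid_leT _ _)). Qed.

Let mf : measurable_fun [set: R] f. Proof. exact: continuous_measurable_fun. Qed.

Let I2 : L2 P I. Proof. exact: (L2_ito_integral bw t1 ito). Qed.

Let inc2 M (i : 'I_M.+1) : L2 P (inc w (grid t M i) (grid t M i.+1)).
Proof.
by apply: L2B; apply: w2; apply: grid01 => //; exact: ltnW.
Qed.

Let S2 M : L2 P (S M).
Proof. by apply: L2_sum => i; apply: L2Z; exact: inc2. Qed.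

Let error_cvg0 : mesh_error t n K @[n --> \oo] --> 0.
Proof.
rewrite -(mulr0 K); apply: cvgMl_tmp; rewrite -(mulr0 t); apply: cvgMl_tmp.
have := @cvg_harmonic R; exact.
Qed.

Let sqn_error M : sqn (fun x => I x - S M x) <= 4 * (mesh_error t M K ^+ 2 * t).
Proof.
rewrite -lee_fin EFinM.
apply: le_trans (@ito_step_bound _ _ _ _ _ _ bw _ t1 _ mf _ ito 'I_M.+1
  (fun i => f (grid t M i)) (fun i => grid t M i) (fun i => grid t M i.+1) _ _ _) _.
- by move=> i; exact: grid_ge0.
- by move=> i; exact: grid_le.
- by move=> i; exact: grid_leT.
- by rewrite lee_pmul2l//; exact: integral_grid_error.
Qed.

Let error2_cvg0 : 4 * (mesh_error t n K ^+ 2 * t) @[n --> \oo] --> 0.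
Proof.
rewrite -(mulr0 4); apply: cvgMl_tmp; rewrite -(mul0r t); apply: cvgMr_tmp.
rewrite [X in _ --> X](_ : 0 = 0 ^+ 2); last by rewrite expr0n.
exact: (continuous_cvg _ (@sqr_continuous R 0)).
Qed.

Let sqn_error_cvg0 : sqn (fun x => I x - S M x) @[M --> \oo] --> 0.
Proof.
apply: (cvg0_le _ error2_cvg0) => M; rewrite sqn_error andbT; exact: sqn_ge0.
Qed.

(** For a Riemann sum of f the coefficient is given by the expansion of w at the
grid points, and equals sqrt 2 times the integral of cos against the
corresponding step function. Both sides are continuous as the mesh tends to 0,
the left one by ito_step_bound. *)
Lemma ip_ito k :
  ip I (e k) = Num.sqrt 2 * \int[mu]_(s in `[0, t]) (f s * cos (lambda k.+1 * s)).
Proof.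
have la0 : lambda k.+1 != 0 :> R by rewrite gt_eqF// lambda_gt0.
have h1 := ip_cvg S2 I2 (e2 k) sqn_error_cvg0.
apply: (cvg_unique _ h1); first exact: Rhausdorff.
have SE M : ip (S M) (e k) = Num.sqrt 2 *
    \sum_(i < M.+1) f (grid t M i) * ((sin (lambda k.+1 * grid t M i.+1) -
      sin (lambda k.+1 * grid t M i)) / lambda k.+1).
  rewrite /S ip_suml//; last by move=> i; apply: L2Z; exact: inc2.
  rewrite mulr_sumr; apply: eq_bigr => i _.
  have g1 : 0 <= grid t M i <= 1 by apply: grid01; exact: ltnW.
  have g2 : 0 <= grid t M i.+1 <= 1 by exact: grid01.
  rewrite ipZl//.
  rewrite ipBl//; [|exact: w2..].
  by rewrite !ip_wiener//; ring.
rewrite (funext SE).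
apply: cvgMl_tmp.
apply: (@cvg_sqr_dist _ _ (fun M => (mesh_error t M K * t) ^+ 2)).
  move=> M; rewrite -real_normK ?num_real// ler_pXn2r ?nnegrE ?mulr_ge0 ?mesh_error_ge0//.
  exact: integral_grid_cos_error.
rewrite [X in _ --> X](_ : 0 = (0 * t) ^+ 2); last by rewrite mul0r expr0n.
apply: (continuous_cvg _ (@sqr_continuous R _)).
exact: cvgMr_tmp.
Qed.

(** Riemann sums are combinations of values of w, which lie in the closed span,
and they converge to I. *)
Lemma spanned_ito : spanned P e I.
Proof.
apply: (spanned_closed e_on) => // eps eps0.
move/cvgrPdist_le : sqn_error_cvg0 => /(_ eps eps0) [M _ /(_ M (leqnn M))].
rewrite /= sub0r normrN ger0_norm; last exact: sqn_ge0.
move=> IS; exists (S M); split => //.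
apply: (spanned_lincomb e_on); first exact: inc2.
move=> i; rewrite (_ : inc w _ _ = fun x => (-1) * w (grid t M i) x + w (grid t M i.+1) x).
  have g1 : 0 <= grid t M i <= 1 by apply: grid01; exact: ltnW.
  have g2 : 0 <= grid t M i.+1 <= 1 by exact: grid01.
  by apply: (spannedDZ e_on); [exact: w2|exact: w2|exact: spanned_wiener|exact: spanned_wiener].
by apply/funext => x; rewrite /inc; ring.
Qed.

End karhunen_loeve_coefficients.

(** * Spectral decomposition of a negative semidefinite matrix *)

Section spectral_decomposition.
Context (R : realType) (n : nat).
Local Notation C := R[i].
Local Notation toC := (real_complex R).
Variable L : 'M[R]_n.
Hypothesis nsd : negative_semidefinite L.

Let A : 'M[C]_n := map_mx toC L.

(** Scaling: the numerical range only tests unit vectors. *)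
Lemma nsd_form_le0 (x : 'cV[C]_n) : ((map_mx Num.conj x)^T *m A *m x) 0 0 <= 0.
Proof.
pose N := \sum_i `|x i 0| ^+ 2.
have N0 : 0 <= N by apply: sumr_ge0 => i _; rewrite exprn_ge0.
have [Nz|Nz] := eqVneq N 0.
  have -> : x = 0.
    apply/matrixP => i j; rewrite mxE (ord1 j); apply/eqP; rewrite -normr_eq0.
    have /eqP := Nz; rewrite psumr_eq0 => [/allP/(_ i)|k _]; last by rewrite exprn_ge0.
    by rewrite mem_index_enum => /(_ isT); rewrite expf_eq0.
  by rewrite mulmx0 mxE.
have Np : 0 < N by rewrite lt_neqAle eq_sym Nz.
pose s := sqrtC N; have s0 : 0 < s by rewrite sqrtC_gt0.
have ss : s ^+ 2 = N by rewrite sqrtCK.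
have H : sqrtC (\sum_i `|(s^-1 *: x) i 0| ^+ 2) = 1.
  rewrite (eq_bigr (fun i => s^-2 * `|x i 0| ^+ 2)) => [|i _].
    by rewrite -mulr_sumr -/N -ss mulVf ?sqrtC1// expf_neq0// gt_eqF.
  rewrite mxE normrM exprMn normfV (gtr0_norm s0).
  by congr (_ * _); rewrite exprVn.
have := nsd (ex_intro2 _ _ (s^-1 *: x) H erefl).
rewrite /=.
have -> : map_mx Num.conj (s^-1 *: x) = s^-1 *: map_mx Num.conj x.
  apply/matrixP => i j; rewrite !mxE rmorphM/=; congr (_ * _).
  by apply/CrealP; rewrite ger0_real// invr_ge0 ltW.
rewrite [(_ *: _)^T]linearZ/= -!scalemxAl -scalemxAr.
rewrite mxE [X in _ * X]mxE.
by rewrite !pmulr_rle0 ?invr_gt0.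
Qed.

(** The form is real at e_i + 'i e_j, where its imaginary part is
L i j - L j i. *)
Lemma nsd_sym i j : L i j = L j i.
Proof.
pose r a : 'rV[C]_n := delta_mx 0 a; pose c a : 'cV[C]_n := delta_mx a 0.
have E a b : (r a *m A *m c b) 0 0 = toC (L a b).
  by rewrite /r /c -rowE -colE !mxE.
have := nsd_form_le0 (c i + 'i *: c j).
have -> : (map_mx Num.conj (c i + 'i *: c j))^T = r i - 'i *: r j.
  apply/matrixP => a b; rewrite !mxE rmorphD rmorphM/= conjCi !conjC_nat mulNr.
  by rewrite (andbC (b == i)) (andbC (b == j)).
have -> : (r i - 'i *: r j) *m A *m (c i + 'i *: c j) =
    r i *m A *m c i + 'i *: (r i *m A *m c j)
    - 'i *: (r j *m A *m c i) + r j *m A *m c j.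
  rewrite mulmxDr !mulmxBl -!scalemxAl -!scalemxAr scalerA -expr2 sqrCi scaleN1r opprK.
  by rewrite !addrA; congr (_ + _); rewrite -!addrA; congr (_ + _); rewrite addrC.
move: (E i i) (E i j) (E j i) (E j j).
move: (r i *m A *m c i) (r i *m A *m c j) (r j *m A *m c i) (r j *m A *m c j).
move=> m1 m2 m3 m4 e1 e2 e3 e4; rewrite !mxE e1 e2 e3 e4 -complexiE lecE.
move=> /andP[/eqP + _]; rewrite /=.
by rewrite !(mul0r, mul1r, mulr0, addr0, add0r, subr0, sub0r); lra.
Qed.

Let U : 'M[C]_n := spectralmx A.
Let D : 'rV[C]_n := spectral_diag A.
Let Ut : 'M[C]_n := map_mx Num.conj (U^T).

Let UUt : U *m Ut = 1%:M.
Proof. by have /unitarymxP := spectral_unitarymx A; exact. Qed.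

Let AE : A = Ut *m diag_mx D *m U.
Proof.
have Aherm : A \is hermsymmx.
  apply: realsym_hermsym; first apply/is_hermitianmxP.
    by rewrite expr0 scale1r; apply/matrixP => i j; rewrite !mxE nsd_sym.
  by apply/mxOverP => i j; rewrite mxE; apply/complex_realP; eexists.
have /orthomx_spectralP := hermitian_normalmx Aherm.
by rewrite invmx_unitary ?spectral_unitarymx// -map_trmx.
Qed.

Let D_le0 r : D 0 r <= 0.
Proof.
have := nsd_form_le0 (col r Ut).
have -> : (map_mx Num.conj (col r Ut))^T = row r U.
  by apply/matrixP => i j; rewrite !mxE conjCK.
have -> : (row r U *m A *m col r Ut) 0 0 = (U *m A *m Ut) r r.
  by rewrite -row_mul [LHS]mxE [RHS]mxE; apply: eq_bigr => k _; rewrite !mxE.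
rewrite AE mulmxA -[_ *m U *m Ut]mulmxA UUt mulmx1 mulmxA UUt mul1mx.
by rewrite mxE eqxx mulr1n.
Qed.

Let dd (r : 'I_n) : R := complex.Re (D 0 r).

Let DE r : D 0 r = toC (dd r).
Proof. by rewrite /dd RRe_real// ler0_real. Qed.

Let AX k : map_mx toC (L ^+ k) = Ut *m diag_mx (\row_r (D 0 r) ^+ k) *m U.
Proof.
have UtU : Ut *m U = 1%:M by exact: mulmx1C.
elim: k => [|k IH].
  rewrite expr0 map_mx1; apply/esym.
  have -> : diag_mx (\row_r D 0 r ^+ 0) = 1%:M :> 'M[C]_n.
    by apply/matrixP => i j; rewrite !mxE expr0.
  by rewrite mulmx1 UtU.
rewrite exprS -mulmxE map_mxM IH -/A AE.
rewrite !mulmxA -[_ *m U *m Ut]mulmxA UUt mulmx1 -[_ *m diag_mx D *m _]mulmxA mulmx_diag.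
congr (_ *m diag_mx _ *m _); apply/matrixP => i j.
by rewrite !mxE exprS.
Qed.

(** The real and imaginary parts of the rows of a unitary diagonalisation of L,
stacked on top of each other, form V: a 2n x n isometry, each eigenvalue
occurring twice. The identity for the powers of L is the real part of the
complex one, and V^T V = 1 is its case k = 0. *)
Lemma nsd_spectral : exists (m : nat) (V : 'M[R]_(m, n)) (e : 'I_m -> R),
  [/\ V^T *m V = 1%:M, forall r, e r <= 0 &
      forall k i j, (L ^+ k) i j = \sum_r e r ^+ k * (V r i * V r j)].
Proof.
pose V := col_mx (map_mx (@complex.Re R) U) (map_mx (@complex.Im R) U).
pose e (r : 'I_(n + n)) := match fintype.split r with inl r => dd r | inr r => dd r end.
have LX k i j : (L ^+ k) i j = \sum_r e r ^+ k * (V r i * V r j).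
  have e1 : complex.Re (toC ((L ^+ k) i j)) = complex.Re ((map_mx toC (L ^+ k)) i j) by rewrite mxE.
  rewrite -[LHS]/(complex.Re (toC ((L ^+ k) i j))) e1 AX.
  rewrite big_split_ord/= -big_split/= mxE.
  have ReD (x y : C) : complex.Re (x + y) = complex.Re x + complex.Re y.
    by case: x; case: y.
  rewrite (big_morph (@complex.Re R) ReD erefl).
  apply: eq_bigr => r _.
  have -> : e (lshift n r) = dd r by rewrite /e (unsplitK (inl r)).
  have -> : e (rshift n r) = dd r by rewrite /e (unsplitK (inr r)).
  rewrite /V !col_mxEu !col_mxEd mul_mx_diag !mxE DE -rmorphXn/=.
  case: (U r i) => a1 b1; case: (U r j) => a2 b2 /=.
  by ring.
exists (n + n)%N, V, e; split => // [|r].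
  apply/matrixP => i j; have := LX 0 i j; rewrite expr0 => ->.
  by rewrite mxE; apply: eq_bigr => r _; rewrite expr0 mul1r mxE.
rewrite /e; case: (fintype.split r) => s; have := D_le0 s; rewrite lecE /dd.
  by case/andP.
by case/andP.
Qed.
End spectral_decomposition.

(** * Functions of a symmetric matrix *)

Section matrix_functions.
Context (R : realType) (n m : nat).
Local Notation mu := (@lebesgue_measure R).

Lemma cvg_sum_seq (I : Type) (s : seq I) (F : I -> nat -> R) (l : I -> R) :
  (forall i, F i N @[N --> \oo] --> l i) ->
  \sum_(i <- s) F i N @[N --> \oo] --> \sum_(i <- s) l i.
Proof.
move=> Fl; elim: s => [|i s IH].
  by rewrite big_nil; under eq_fun do rewrite big_nil; exact: cvg_cst.
by rewrite big_cons; under eq_fun do rewrite big_cons; apply: cvgD.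
Qed.

Variables (L : 'M[R]_n) (V : 'M[R]_(m, n)) (e : 'I_m -> R).
Hypothesis VV : V^T *m V = 1%:M.
Hypothesis LX : forall k i j, (L ^+ k) i j = \sum_r e r ^+ k * (V r i * V r j).

Lemma expmx_spectral (x : R) i j :
  expmx (x *: L) i j = \sum_r expR (x * e r) * (V r i * V r j).
Proof.
rewrite mxE; apply: cvg_lim; first exact: Rhausdorff.
have -> : series (fun k => ((x *: L) ^+ k) i j / k`!%:R) =
   (fun N => \sum_r series (exp_coeff (x * e r)) N * (V r i * V r j)).
  apply/funext => N; rewrite /series/=.
  under [RHS]eq_bigr do rewrite mulr_suml.
  rewrite exchange_big/=; apply: eq_bigr => k _.
  have -> : (x *: L) ^+ k = x ^+ k *: L ^+ k.
    elim: k => [|k IH]; first by rewrite !expr0 scale1r.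
    by rewrite !exprS IH -!mulmxE -scalemxAl -scalemxAr scalerA.
  rewrite mxE LX mulr_sumr mulr_suml; apply: eq_bigr => r _.
  by rewrite /exp_coeff/= exprMn; ring.
apply: cvg_sum_seq => r.
by apply: cvgMr_tmp; exact: is_cvg_series_exp_coeff.
Qed.

Definition phicos_scalar (k : nat) (t z : R) : R :=
  \int[mu]_(s in `[0, t]) (expR ((t - s) * z) * cos (lambda k * s)).

Let cecos k (t z c : R) : continuous (fun s => expR ((t - s) * z) * c * cos (lambda k * s) : R).
Proof.
move=> s; apply: cvgM.
  apply: cvgMr_tmp; apply: continuous_comp; last exact: continuous_expR.
  by apply: cvgMr_tmp; apply: cvgB; [exact: cvg_cst|exact: cvg_id].
apply: continuous_comp; last exact: continuous_cos.
by apply: cvgMl_tmp; exact: cvg_id.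
Qed.

Let iecos k (t z c : R) :
  mu.-integrable `[0, t] (EFin \o (fun s => expR ((t - s) * z) * c * cos (lambda k * s))).
Proof.
apply: continuous_compact_integrable; first exact: segment_compact.
by apply: continuous_subspaceT; exact: cecos.
Qed.

Lemma integral_exp_sum_cos k t (c : 'I_m -> R) :
  \int[mu]_(s in `[0, t]) ((\sum_r expR ((t - s) * e r) * c r) * cos (lambda k * s)) =
  \sum_r phicos_scalar k t (e r) * c r.
Proof.
under eq_Rintegral do rewrite mulr_suml.
rewrite /Rintegral; under eq_integral do rewrite -sumEFin.
rewrite integral_sum//; last by move=> r; exact: iecos.
rewrite (eq_bigr (fun r => (phicos_scalar k t (e r) * c r)%:E)) => [|r _].
  by rewrite sumEFin.
have /= i1 := iecos k t (e r) 1.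
rewrite /phicos_scalar; under [in RHS]eq_Rintegral do rewrite -[expR _]mulr1.
rewrite -RintegralZr//.
rewrite /Rintegral fineK.
  by apply: eq_integral => s _; congr EFin; ring.
have -> : (\int[mu]_(s in `[0%R, t])
      (expR ((t - s) * e r) * 1 * cos (lambda k * s) * c r)%:E =
    \int[mu]_(s in `[0%R, t])
      (expR ((t - s) * e r) * c r * cos (lambda k * s))%:E)%E.
  by apply: eq_integral => s _ /=; congr EFin; ring.
by have := integrable_fin_num _ (iecos k t (e r) (c r)); apply.
Qed.

Lemma phicos_spectral k t i j :
  phicos k t L i j = \sum_r phicos_scalar k t (e r) * (V r i * V r j).
Proof.
rewrite mxE; under eq_Rintegral do rewrite expmx_spectral.
exact: integral_exp_sum_cos.
Qed.

Definition ito_integrand (B : 'M[R]_n) t i j (s : R) : R :=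
  (expmx ((t - s) *: L) *m B) i j.

Lemma ito_integrand_spectral (B : 'M[R]_n) t i j s :
  ito_integrand B t i j s = \sum_r expR ((t - s) * e r) * (V r i * (V *m B) r j).
Proof.
rewrite /ito_integrand mxE (eq_bigr (fun l => \sum_r expR ((t - s) * e r) * (V r i * (V r l * B l j)))).
  rewrite exchange_big/=; apply: eq_bigr => r _.
  by rewrite -mulr_sumr -mulr_sumr mxE.
move=> l _; rewrite expmx_spectral mulr_suml; apply: eq_bigr => r _; ring.
Qed.

Lemma integral_ito_integrand_cos (B : 'M[R]_n) k t i j :
  \int[mu]_(s in `[0, t]) (ito_integrand B t i j s * cos (lambda k * s)) =
  (phicos k t L *m B) i j.
Proof.
under eq_Rintegral do rewrite ito_integrand_spectral.
rewrite integral_exp_sum_cos mxE.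
rewrite [RHS](eq_bigr (fun l => \sum_r phicos_scalar k t (e r) * (V r i * (V r l * B l j)))).
  rewrite exchange_big/=; apply: eq_bigr => r _.
  by rewrite -mulr_sumr -mulr_sumr mxE.
move=> l _; rewrite phicos_spectral mulr_suml; apply: eq_bigr => r _; ring.
Qed.

Lemma continuous_ito_integrand (B : 'M[R]_n) t i j : continuous (ito_integrand B t i j).
Proof.
rewrite (funext (ito_integrand_spectral B t i j)) => s.
apply: cvg_big => // [|r _]; first exact: add_continuous.
apply: cvgMr_tmp; apply: continuous_comp; last exact: continuous_expR.
by apply: cvgMr_tmp; apply: cvgB; [exact: cvg_cst|exact: cvg_id].
Qed.

(** The exponential is 1-Lipschitz on nonpositive numbers. *)
Lemma lipschitz_ito_integrand (B : 'M[R]_n) t i j : (forall r, e r <= 0) ->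
  exists2 K, 0 <= K & forall x y, 0 <= x -> x <= y -> y <= t ->
    `|ito_integrand B t i j y - ito_integrand B t i j x| <= K * (y - x).
Proof.
move=> e0; exists (\sum_r `|e r| * `|V r i * (V *m B) r j|).
  by apply: sumr_ge0 => r _; rewrite mulr_ge0.
move=> x y x0 xy yt; rewrite !ito_integrand_spectral -sumrB mulr_suml.
apply: (le_trans (ler_norm_sum _ _ _)); apply: ler_sum => r _.
rewrite -mulrBl normrM mulrAC ler_wpM2r//.
have ab : (t - x) * e r <= (t - y) * e r by have := e0 r; nra.
have b0 : (t - y) * e r <= 0 by rewrite mulr_ge0_le0// subr_ge0.
rewrite ger0_norm; last by rewrite subr_ge0 ler_expR.
rewrite (ler0_norm (e0 r)) (_ : - e r * (y - x) = (t - y) * e r - (t - x) * e r); last by ring.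
move: ((t - x) * e r) ((t - y) * e r) ab b0 => a b ab b0.
have -> : expR b - expR a = expR b * (1 - expR (a - b)).
  by rewrite mulrBr mulr1 -expRD (_ : b + (a - b) = a)//; ring.
have h1 : expR b <= 1 by rewrite expR_le1.
have h2 : 1 - expR (a - b) <= b - a by have := expR_ge1Dx (a - b); lra.
have h3 : 0 <= 1 - expR (a - b) by rewrite subr_ge0 expR_le1; lra.
by apply: le_trans h2; rewrite ler_piMl.
Qed.

(** The adjoint of an isometry is a contraction:
|y - V V^T y|^2 = |y|^2 - |V^T y|^2. *)
Lemma sum_sqr_isometryT (y : 'I_m -> R) :
  \sum_i (\sum_r y r * V r i) ^+ 2 <= \sum_r y r ^+ 2.
Proof.
pose x i := \sum_r y r * V r i.
have Vx : \sum_r (y r - \sum_i V r i * x i) ^+ 2 = \sum_r y r ^+ 2 - \sum_i x i ^+ 2.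
  have VVE i j : \sum_r V r i * V r j = (i == j)%:R.
    have /matrixP/(_ i j) := VV; rewrite !mxE => <-.
    by apply: eq_bigr => r _; rewrite mxE.
  have e1 : \sum_r y r * (\sum_i V r i * x i) = \sum_i x i ^+ 2.
    under eq_bigr do rewrite mulr_sumr.
    rewrite exchange_big/=; apply: eq_bigr => i _.
    by rewrite expr2 {1}/x mulr_suml; apply: eq_bigr => r _; rewrite mulrA.
  have e2 : \sum_r (\sum_i V r i * x i) ^+ 2 = \sum_i x i ^+ 2.
    under eq_bigr do rewrite expr2 mulr_suml.
    rewrite exchange_big/=; apply: eq_bigr => i _.
    under eq_bigr do rewrite mulr_sumr.
    rewrite exchange_big/= (bigD1 i)//= [X in _ + X]big1 => [|j ji].
      rewrite addr0 (eq_bigr (fun r => x i ^+ 2 * (V r i * V r i))) => [|r _]; last by ring.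
      by rewrite -mulr_sumr VVE eqxx mulr1.
    rewrite (eq_bigr (fun r => x i * x j * (V r i * V r j))) => [|r _]; last by ring.
    by rewrite -mulr_sumr VVE eq_sym (negbTE ji) mulr0.
  rewrite (eq_bigr (fun r => y r ^+ 2 - 2 * (y r * (\sum_i V r i * x i)) +
    (\sum_i V r i * x i) ^+ 2)) => [|r _]; last by ring.
  by rewrite !big_split/= sumrN -mulr_sumr e1 e2; ring.
rewrite -subr_ge0 -Vx; apply: sumr_ge0 => r _; exact: sqr_ge0.
Qed.

(** Both sides are the trace of V^T V. *)
Lemma sum_sqr_rows : \sum_r \sum_i V r i ^+ 2 = n%:R.
Proof.
rewrite exchange_big/= (eq_bigr (fun=> 1)) => [|i _].
  by rewrite sumr_const card_ord.
have /matrixP/(_ i i) := VV; rewrite !mxE eqxx => e1.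
rewrite -[RHS]e1; by apply: eq_bigr => r _; rewrite mxE expr2.
Qed.

Lemma frobenius_sqr (M : 'M[R]_n) : frobenius M ^+ 2 = \sum_i \sum_j M i j ^+ 2.
Proof.
by rewrite sqr_sqrtr//; apply: sumr_ge0 => i _; apply: sumr_ge0 => j _; exact: sqr_ge0.
Qed.

(** M B = V^T diag(g) V B, and the outer factor V^T is a contraction. *)
Lemma frobenius_spectral_le (g : 'I_m -> R) (M B : 'M[R]_n) :
  (forall i j, M i j = \sum_r g r * (V r i * V r j)) ->
  frobenius (M *m B) ^+ 2 <= \sum_r g r ^+ 2 * \sum_j (V *m B) r j ^+ 2.
Proof.
move=> ME; rewrite frobenius_sqr exchange_big/=.
under [leRHS]eq_bigr do rewrite mulr_sumr.
rewrite [leRHS]exchange_big/=; apply: ler_sum => j _.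
have := sum_sqr_isometryT (fun r => g r * (V *m B) r j).
under [leRHS]eq_bigr do rewrite exprMn.
apply: le_trans; rewrite le_eqVlt; apply/orP; left; apply/eqP.
apply: eq_bigr => i _; congr (_ ^+ 2).
rewrite mxE; under eq_bigr do rewrite ME mulr_suml.
rewrite exchange_big/=; apply: eq_bigr => r _.
by rewrite mxE mulr_sumr mulr_suml; apply: eq_bigr => k _; ring.
Qed.

Lemma vnorm2_sqr (x : 'cV[R]_n) : vnorm2 x ^+ 2 = \sum_i x i 0 ^+ 2.
Proof. by rewrite sqr_sqrtr// sumr_ge0// => i _; exact: sqr_ge0. Qed.

Lemma vnorm2_ge0 (x : 'cV[R]_n) : 0 <= vnorm2 x.
Proof. exact: sqrtr_ge0. Qed.

Lemma opnorm2_le (B : 'M[R]_n) (x : 'cV[R]_n) : vnorm2 x <= 1 ->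
  vnorm2 (B *m x) <= opnorm2 B.
Proof.
move=> x1; apply: sup_upper_bound; last by exists x.
split; first by exists (vnorm2 (B *m x)), x.
exists (Num.sqrt (\sum_i (\sum_j `|B i j|) ^+ 2)) => _ [y /= y1 <-].
apply: ler_wsqrtr; apply: ler_sum => i _.
rewrite -real_normK ?num_real// ler_pXn2r ?nnegrE ?sumr_ge0//.
rewrite mxE (le_trans (ler_norm_sum _ _ _))//; apply: ler_sum => j _.
rewrite normrM ler_piMr//.
have : y j 0 ^+ 2 <= 1.
  have : vnorm2 y ^+ 2 <= 1 by rewrite exprn_ile1// vnorm2_ge0.
  rewrite vnorm2_sqr (bigD1 j)//=; apply: le_trans.
  by rewrite lerDl sumr_ge0// => k _; exact: sqr_ge0.
by rewrite -real_normK ?num_real// expr_le1.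
Qed.

Lemma opnorm2_ge0 (B : 'M[R]_n) : 0 <= opnorm2 B.
Proof.
apply: (le_trans (vnorm2_ge0 (B *m 0))); apply: opnorm2_le.
by rewrite /vnorm2 big1 ?sqrtr0 ?ler01// => i _; rewrite mxE expr0n.
Qed.

Lemma opnorm2_mul (B : 'M[R]_n) (x : 'cV[R]_n) :
  vnorm2 (B *m x) <= opnorm2 B * vnorm2 x.
Proof.
have vZ (a : R) (y : 'cV[R]_n) : 0 <= a -> vnorm2 (a *: y) = a * vnorm2 y.
  move=> a0; rewrite /vnorm2 -[in RHS](ger0_norm a0) -sqrtr_sqr -sqrtrM ?sqr_ge0//.
  by rewrite mulr_sumr; congr Num.sqrt; apply: eq_bigr => i _; rewrite mxE exprMn.
have [x0|x0] := eqVneq (vnorm2 x) 0.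
  rewrite x0 mulr0; suff -> : x = 0.
    by rewrite mulmx0 /vnorm2 big1 ?sqrtr0// => i _; rewrite mxE expr0n.
  apply/matrixP => i j; rewrite mxE (ord1 j); apply/eqP; rewrite -sqrf_eq0.
  have /eqP := vnorm2_sqr x; rewrite x0 expr0n/= eq_sym psumr_eq0 => [|k _]; last exact: sqr_ge0.
  by move/allP/(_ i); rewrite mem_index_enum => /(_ isT).
have xp : 0 < vnorm2 x by rewrite lt_neqAle eq_sym x0 vnorm2_ge0.
have := opnorm2_le B (x := (vnorm2 x)^-1 *: x).
rewrite vZ ?invr_ge0 ?vnorm2_ge0// mulVf// => /(_ (lexx _)).
by rewrite -scalemxAr vZ ?invr_ge0 ?vnorm2_ge0// mulrC ler_pdivrMr.
Qed.

(** The spectral norm b of B also bounds its transpose: y = B^T v satisfies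
|y|^2 = <v, B y> and |B y| <= b |y|, and it remains to expand
0 <= |b^2 v - B y|^2. *)
Lemma opnorm2_row (B : 'M[R]_n) (v : 'I_n -> R) :
  \sum_j (\sum_i v i * B i j) ^+ 2 <= opnorm2 B ^+ 2 * \sum_i v i ^+ 2.
Proof.
pose y : 'cV[R]_n := \col_j \sum_i v i * B i j.
pose z := B *m y.
have Sy : \sum_j (\sum_i v i * B i j) ^+ 2 = \sum_j y j 0 ^+ 2.
  by apply: eq_bigr => j _; rewrite mxE.
have Svz : \sum_j y j 0 ^+ 2 = \sum_i v i * z i 0.
  transitivity (\sum_j \sum_i v i * B i j * y j 0).
    by apply: eq_bigr => j _; rewrite expr2 {1}mxE mulr_suml.
  rewrite exchange_big/=; apply: eq_bigr => i _.
  by rewrite [z i 0]mxE mulr_sumr; apply: eq_bigr => j _; rewrite mulrA.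
have Sz : \sum_i z i 0 ^+ 2 <= opnorm2 B ^+ 2 * \sum_j y j 0 ^+ 2.
  rewrite -!vnorm2_sqr -exprMn ler_pXn2r ?nnegrE ?vnorm2_ge0 ?mulr_ge0 ?opnorm2_ge0 ?vnorm2_ge0//.
  exact: opnorm2_mul.
rewrite Sy; have := opnorm2_ge0 B; rewrite le_eqVlt => /predU1P[b0|b0].
  move: Sz; rewrite -b0 expr0n/= !mul0r => Sz.
  have z0 i : z i 0 = 0.
    apply/eqP; rewrite -sqrf_eq0; have /eqP : \sum_i z i 0 ^+ 2 = 0.
      by apply/le_anti; rewrite Sz sumr_ge0// => k _; exact: sqr_ge0.
    rewrite psumr_eq0 => [|k _]; last exact: sqr_ge0.
    by move/allP/(_ i); rewrite mem_index_enum => /(_ isT).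
  by rewrite Svz big1// => i _; rewrite z0 mulr0.
pose b := opnorm2 B.
have : 0 <= \sum_i (b ^+ 2 * v i - z i 0) ^+ 2 by apply: sumr_ge0 => i _; exact: sqr_ge0.
rewrite (eq_bigr (fun i => (b ^+ 4 * v i ^+ 2 - 2 * b ^+ 2 * (v i * z i 0)) + z i 0 ^+ 2)) => [|i _]; last by ring.
rewrite !big_split/= sumrN -!mulr_sumr -Svz.
set S := \sum_j y j 0 ^+ 2 in Sz *; set N := \sum_i v i ^+ 2.
move=> h; have : 0 <= b ^+ 2 * (b ^+ 2 * N - S).
  have -> : b ^+ 2 * (b ^+ 2 * N - S) = b ^+ 4 * N - 2 * b ^+ 2 * S + b ^+ 2 * S by ring.
  by rewrite (le_trans h)// lerD2l.
by rewrite pmulr_rge0 ?exprn_gt0// subr_ge0.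
Qed.

End matrix_functions.

(** * The scalar coefficients *)

Section scalar_coefficients.
Context (R : realType).
Local Notation mu := (@lebesgue_measure R).

(** The antiderivative is the real part of that of a complex exponential. *)
Lemma phicos_scalarE (k : nat) (t z : R) : 0 <= t -> 0 < lambda k :> R ->
  phicos_scalar k t z = (z * expR (t * z) - z * cos (lambda k * t) +
    lambda k * sin (lambda k * t)) / (z ^+ 2 + lambda k ^+ 2).
Proof.
set la := lambda k; move=> t0 la0.
have den0 : z ^+ 2 + la ^+ 2 != 0.
  by rewrite gt_eqF// ltr_wpDl ?sqr_ge0// exprn_gt0.
move: t0; rewrite le_eqVlt => /predU1P[<-|t0].
  rewrite /phicos_scalar set_itv1 Rintegral_set1 mul0r mulr0 expR0 cos0 sin0.
  by field.
pose G := fun s : R => (z ^+ 2 + la ^+ 2)^-1 *: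
   (expR ((t - s) * z) * (la *: sin (la * s) - z *: cos (la * s))).
have dG (x : R) : is_derive x 1 G (expR ((t - x) * z) * cos (la * x)).
  have H1 : is_derive x 1 (fun s : R => la * s) la.
    have -> : (fun s : R => la * s) = (fun s : R => la *: id s) by [].
    by apply: is_derive_eq; rewrite /GRing.scale/= mulr1.
  have H2 : is_derive x 1 (fun s : R => (t - s) * z) (- z).
    have -> : (fun s : R => (t - s) * z) = (fun s : R => z *: (cst t s - id s)).
      by apply/funext => s; rewrite /GRing.scale/= mulrC.
    by apply: is_derive_eq; rewrite /GRing.scale/= sub0r mulrN1.
  rewrite /G; apply: is_derive_eq; rewrite /GRing.scale/=.
  by field.
have cG : continuous G.
  by move=> x; apply/differentiable_continuous/derivable1_diffP; have [] := dG x.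
rewrite /phicos_scalar /Rintegral (@continuous_FTC2 _ _ G)//.
- rewrite -EFinB /= /G /GRing.scale/= subrr mul0r expR0 !mulr0 sin0 cos0 subr0.
  by field.
- apply: continuous_subspaceT => s; apply: cvgM.
    apply: continuous_comp; last exact: continuous_expR.
    by apply: cvgMr_tmp; apply: cvgB; [exact: cvg_cst|exact: cvg_id].
  apply: continuous_comp; last exact: continuous_cos.
  by apply: cvgMl_tmp; exact: cvg_id.
- split.
  + by move=> x _; have [] := dG x.
  + exact/cvg_at_right_filter/cG.
  + exact/cvg_at_left_filter/cG.
- by move=> x _; rewrite derive1E; have [_ ->] := dG x.
Qed.
End scalar_coefficients.

(** * Numerical estimates *)

Section elementary_estimates.
Context {R : realType}.

Lemma le_of_derive_ge0 (f g : R -> R) (x : R) :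
  (forall y : R, is_derive y 1 f (g y)) -> (forall y, 0 <= y -> 0 <= g y) ->
  0 <= x -> f 0 <= f x.
Proof.
move=> d g0 x0; apply: (@ger0_derive1_ndecry _ f 0) => //.
- by move=> y; rewrite in_itv/= andbT derive1E => /ltW y0; have [_ ->] := d y; exact: g0.
- by apply: continuous_subspaceT => y; apply/differentiable_continuous/derivable1_diffP; have [] := d y.
Qed.

Lemma sin_le_id (x : R) : 0 <= x -> sin x <= x.
Proof.
move=> x0.
have d (y : R) : is_derive y 1 (fun s : R => s - sin s) (1 - cos y).
  by apply: is_derive_eq.
have := le_of_derive_ge0 d _ x0; rewrite sin0 subrr subr_ge0; apply.
by move=> y _; rewrite subr_ge0 cos_le1.
Qed.

Lemma cos_ge_quadratic (x : R) : 0 <= x -> 1 - x ^+ 2 / 2 <= cos x.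
Proof.
move=> x0.
have d (y : R) : is_derive y 1 (fun s : R => cos s + 2^-1 *: (s ^+ 2)) (y - sin y).
  by apply: is_derive_eq; rewrite /GRing.scale/=; field.
have := le_of_derive_ge0 d _ x0; rewrite cos0 /GRing.scale/=.
move=> H; have {H} : 1 + 2^-1 * 0 ^+ 2 <= cos x + 2^-1 * x ^+ 2.
  by apply: H => y y0; rewrite subr_ge0 sin_le_id.
by lra.
Qed.

Lemma sin_ge_cubic (x : R) : 0 <= x -> x - x ^+ 3 / 6 <= sin x.
Proof.
move=> x0.
have d (y : R) : is_derive y 1 (fun s : R => sin s - s + 6^-1 *: (s ^+ 3))
    (cos y - 1 + y ^+ 2 / 2).
  by apply: is_derive_eq; rewrite /GRing.scale/=; field.
have := le_of_derive_ge0 d _ x0; rewrite sin0 /GRing.scale/=.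
move=> H; have {H} : 0 - 0 + 6^-1 * 0 ^+ 3 <= sin x - x + 6^-1 * x ^+ 3.
  by apply: H => y y0; have := cos_ge_quadratic y0; lra.
by lra.
Qed.

Lemma cos_double (x : R) : cos (2 * x) = 1 - 2 * sin x ^+ 2.
Proof. by rewrite mulrC mulr_natr cos_mulr2n cos2sin2 -mulr_natr; ring. Qed.

Lemma sqr_quarter_pi : sin (pi / 4 : R) ^+ 2 = 2^-1.
Proof.
have := cos_double (pi / 4 : R).
have -> : 2 * (pi / 4) = pi / 2 :> R by field.
by rewrite cos_pihalf; lra.
Qed.

(** If pi < 3, then cos (pi / 4) >= 1 - (3/4)^2 / 2 > 0.71, and its square would
exceed 1/2. *)
Lemma pi_ge3 : 3 <= pi :> R.
Proof.
have := @pi_ge2 R; rewrite leNgt => h2; apply/negP => h.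
have := @cos_ge_quadratic (pi / 4).
have : cos (pi / 4 : R) ^+ 2 = 2^-1 by rewrite cos2sin2 sqr_quarter_pi; lra.
have y1 : pi / 4 <= 3 / 4 :> R by lra.
have y0 : 0 <= pi / 4 :> R by lra.
move: (pi / 4) y1 y0 => y y1 y0; move: (cos y) => c E /(_ y0) H.
have : 7 / 10 + 1 / 100 <= c by nra.
by nra.
Qed.

(** If pi > 7/2, then pi / 4 lies in [7/8, 1], so that
sin (pi / 4) >= (5/6) (7/8), and its square would exceed 1/2. *)
Lemma pi_le72 : pi <= 7 / 2 :> R.
Proof.
have h4 : pi / 2 < 2 :> R := pihalf_lt2 R; rewrite leNgt; apply/negP => h.
have y1 : 7 / 8 <= pi / 4 :> R by lra.
have y2 : pi / 4 <= 1 :> R by lra.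
have := @sin_ge_cubic (pi / 4) ltac:(lra); have := sqr_quarter_pi.
move: (pi / 4) y1 y2 => y y1 y2; move: (sin y) => s E H.
have : y * (5 / 6) <= s by nra.
by nra.
Qed.

(** The maximum is 1 / e, at u = 1, and e >= (1 + 1/8)^8 >= 5/2. *)
Lemma mul_expR_opp_le (u : R) : u * expR (- u) <= 2 / 5.
Proof.
have e : 5 / 2 <= expR 1 :> R.
  have e0 : 9 / 8 <= expR (1 / 8) :> R by have := expR_ge1Dx (1 / 8 : R); lra.
  have -> : expR 1 = expR (1 / 8) ^+ 8 :> R.
    by rewrite -expRM_natl; congr expR; field.
  move: (expR _) e0 => a a1.
  have sq (x c : R) : 0 <= c -> c <= x -> c * c <= x ^+ 2.
    by move=> c0 cx; rewrite expr2 ler_pM.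
  have a2 : 81 / 64 <= a ^+ 2 by have := sq _ _ _ a1; lra.
  have a4 : 8 / 5 <= a ^+ 4 by rewrite (exprM a 2 2); have := sq _ _ _ a2; lra.
  by rewrite (exprM a 4 2); have := sq _ _ _ a4; lra.
have : u * expR (- u) * expR 1 <= 1.
  rewrite -mulrA -expRD; apply: (@le_trans _ _ (expR (u - 1) * expR (- u + 1))).
    by rewrite ler_wpM2r ?expR_ge0//; have := expR_ge1Dx (u - 1); lra.
  by rewrite -expRD -[leRHS]expR0 le_eqVlt; apply/orP; left; apply/eqP; congr expR; ring.
move: (u * _) (expR 1) e => v E; nra.
Qed.

End elementary_estimates.

(** * Bounds on one scalar coefficient *)

Lemma quadratic_form_ge0 (R : realFieldType) (u v c x y : R) :
  0 <= u -> 0 <= v -> c ^+ 2 = u * v ->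
  0 <= u * x ^+ 2 + 2 * x * y * c + v * y ^+ 2.
Proof.
rewrite le_eqVlt => /predU1P[<-|u0] v0 cuv.
  have -> : c = 0 by apply/eqP; rewrite -sqrf_eq0 cuv mul0r.
  by rewrite !(mul0r, mulr0) !add0r mulr_ge0 ?sqr_ge0.
have -> : u * x ^+ 2 + 2 * x * y * c + v * y ^+ 2 = (u * x + c * y) ^+ 2 / u.
  have -> : v = c ^+ 2 / u by rewrite cuv mulrC mulKf// gt_eqF.
  by field; rewrite gt_eqF.
by rewrite divr_ge0 ?sqr_ge0 ?ltW.
Qed.

Section coefficient_bounds.
Context {R : realType}.
Variables (k : nat) (t z : R).
Hypotheses (z0 : z <= 0) (t0 : 0 < t) (la0 : 0 < lambda k :> R).
Local Notation s := (sin (lambda k * t)).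

(** Let x = - z, la = lambda k, s and c the sine and cosine of la t, and
E = exp (t z). As a quadratic form in (x, la), la (x c + la s) has the
eigenvalues (s + 1) / 2 and (s - 1) / 2. Multiplying the numerator of the
coefficient by la leaves the further term - la x E, whose absolute value is at
most (x t E) / (la t) times x^2 + la^2, and x t E <= 1 / e <= 2 / 5. *)
Lemma lambda_phicos_scalar_le :
  lambda k * `|phicos_scalar k t z| <= (1 + `|s|) / 2 + 2 / 5 / (lambda k * t).
Proof.
rewrite (phicos_scalarE z (ltW t0) la0).
have := cos2Dsin2 (lambda k * t); have := expR_ge0 (t * z).
have : - z * t * expR (t * z) <= 2 / 5.
  by have := mul_expR_opp_le (- z * t); rewrite mulNr opprK (mulrC z t).
move: (expR _) s (cos (lambda k * t)) => E S C; move: (lambda k) la0 => l l0 HE E0 SC.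
have D0 : 0 < z ^+ 2 + l ^+ 2 by rewrite ltr_wpDl ?sqr_ge0// exprn_gt0.
have e2 : l * (- z) * E <= 2 / 5 / (l * t) * (z ^+ 2 + l ^+ 2).
  have -> : l * (- z) * E = (- z * t * E) / (l * t) * l ^+ 2.
    by field; rewrite !gt_eqF.
  apply: ler_pM; rewrite ?sqr_ge0//; last by rewrite lerDr sqr_ge0.
    by rewrite !mulr_ge0 ?invr_ge0 ?mulr_ge0 ?oppr_ge0 ?(ltW t0) ?(ltW l0).
  by rewrite ler_pM2r// invr_gt0 mulr_gt0.
have e0 : 0 <= 2 / 5 / (l * t) by rewrite !mulr_ge0 ?invr_ge0 ?mulr_ge0 ?(ltW t0) ?(ltW l0).
have zE : 0 <= l * (- z) * E by rewrite !mulr_ge0 ?oppr_ge0 ?(ltW l0).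
have S1 : -1 <= S <= 1 by nra.
have up : l * (z * E - z * C + l * S) <= (1 + S) / 2 * (z ^+ 2 + l ^+ 2).
  suff : 0 <= (1 + S) * z ^+ 2 + 2 * z * l * C + (1 - S) * l ^+ 2 by nra.
  by apply: quadratic_form_ge0; [lra|lra|rewrite -[C ^+ 2](addrK (S ^+ 2)) SC; ring].
have dn : - (l * (z * E - z * C + l * S)) <= (1 - S) / 2 * (z ^+ 2 + l ^+ 2) + l * (- z) * E.
  suff : 0 <= (1 - S) * z ^+ 2 + 2 * z * l * (- C) + (1 + S) * l ^+ 2 by nra.
  by apply: quadratic_form_ge0; [lra|lra|rewrite sqrrN -[C ^+ 2](addrK (S ^+ 2)) SC; ring].
rewrite -[X in X * `|_|](gtr0_norm l0) -normrM mulrA normrM normfV (gtr0_norm D0).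
rewrite ler_pdivrMr// ler_norml; apply/andP; split.
  rewrite lerNl; apply: (le_trans dn); rewrite [leRHS]mulrDl; apply: lerD => //.
  rewrite ler_pM2r//; have := ler_norm (- S); rewrite normrN; lra.
apply: (le_trans up); rewrite ler_pM2r//; have := ler_norm S; lra.
Qed.

(** The exponential only spoils the lower bound. When s >= 0, la times the
numerator is at least - la x (E - c) >= - 2 la x >= - (x^2 + la^2). *)
Lemma lambda_phicos_scalar_le1 : 0 <= s -> lambda k * `|phicos_scalar k t z| <= 1.
Proof.
rewrite (phicos_scalarE z (ltW t0) la0).
have := cos2Dsin2 (lambda k * t); have := expR_ge0 (t * z).
have : expR (t * z) <= 1 by rewrite expR_le1 pmulr_rle0.
move: (expR _) s (cos (lambda k * t)) => E S C; move: (lambda k) la0 => l l0 E1 E0 SC S0.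
have D0 : 0 < z ^+ 2 + l ^+ 2 by rewrite ltr_wpDl ?sqr_ge0// exprn_gt0.
pose D := z ^+ 2 + l ^+ 2.
have S1 : -1 <= S <= 1 by nra.
have C1 : -1 <= C <= 1 by nra.
have zl : - z * l >= 0 by rewrite mulr_ge0 ?oppr_ge0// ltW.
have zl2 : 2 * (- z * l) <= z ^+ 2 + l ^+ 2 by have := sqr_ge0 (z + l); nra.
rewrite -[X in X * `|_|](gtr0_norm l0) -normrM mulrA normrM normfV (gtr0_norm D0).
rewrite ler_pdivrMr// mul1r ler_norml; apply/andP; split.
  rewrite lerNl.
  have -> : - (l * (z * E - z * C + l * S)) = (- z * l) * (E - C) - l ^+ 2 * S by ring.
  have : 0 <= l ^+ 2 * S by rewrite mulr_ge0 ?sqr_ge0.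
  have : (- z * l) * (E - C) <= (- z * l) * 2 by rewrite ler_wpM2l//; lra.
  lra.
have -> : l * (z * E - z * C + l * S) = (- z * l) * C + l ^+ 2 * S - (- z * l) * E by ring.
have : 0 <= (- z * l) * E by rewrite mulr_ge0.
have : 0 <= (1 + S) * z ^+ 2 + 2 * z * l * C + (1 - S) * l ^+ 2.
  by apply: quadratic_form_ge0; [lra|lra|rewrite -[C ^+ 2](addrK (S ^+ 2)) SC; ring].
have : S * D <= D by rewrite ger_pMl //; lra.
rewrite /D; nra.
Qed.
End coefficient_bounds.

(** * Telescoping majorants *)

(** Every tail estimate on the coefficients goes through a majorant b of this
kind. *)
Lemma sum_le_telescope (R : numDomainType) (u b : nat -> R) (m N : nat) :
  (forall k, (m <= k)%N -> u k.+1 <= b k - b k.+1) ->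
  (forall k, (m <= k)%N -> 0 <= b k) ->
  \sum_(m.+1 <= k < N) u k <= b m.
Proof.
move=> ub b0; have [Nm|mN] := leqP N m; first by rewrite big_geq ?b0// ltnW.
have -> : N = (N - m.+1 + m.+1)%N by rewrite subnK.
move: (N - _)%N => {mN}N.
suff : \sum_(m.+1 <= k < N + m.+1) u k <= b m - b (N + m)%N.
  by move=> /le_trans; apply; rewrite gerBl b0// leq_addl.
elim: N => [|N IH]; first by rewrite big_geq// subrr.
rewrite addSn big_nat_recr/= ?leq_addl//.
rewrite addnS in IH *.
by rewrite (le_trans (lerD IH (ub _ (leq_addl _ _))))// addrA subrK addSn.
Qed.

Section reciprocal_telescoping.
Context {R : realFieldType}.
Implicit Type x : R.

Lemma inv_sqr_le_telescope x : 1 < x -> (x ^+ 2)^-1 <= (x - 1)^-1 - x^-1.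
Proof.
move=> x1; have -> : (x - 1)^-1 - x^-1 = ((x - 1) * x)^-1.
  by field; apply/andP; split; apply/eqP; lra.
by rewrite lef_pV2 ?posrE; nra.
Qed.

Lemma inv_half_sqr_le_telescope x :
  0 < x -> ((x + 2^-1) ^+ 2)^-1 <= x^-1 - (x + 1)^-1.
Proof.
move=> x1; have -> : x^-1 - (x + 1)^-1 = (x * (x + 1))^-1.
  by field; apply/andP; split; apply/eqP; lra.
by rewrite lef_pV2 ?posrE; nra.
Qed.

Lemma inv_half_cube_le_telescope x :
  0 < x -> ((x + 2^-1) ^+ 3)^-1 <= ((x ^+ 2)^-1 - ((x + 1) ^+ 2)^-1) / 2.
Proof.
move=> x1.
have -> : ((x ^+ 2)^-1 - ((x + 1) ^+ 2)^-1) / 2 = (x + 2^-1) / (x * (x + 1)) ^+ 2.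
  by field; apply/andP; split; apply/eqP; lra.
have -> : ((x + 2^-1) ^+ 3)^-1 = (x + 2^-1) / ((x + 2^-1) ^+ 2) ^+ 2.
  by field; apply/eqP; lra.
rewrite ler_pM2l; last by lra.
rewrite lef_pV2 ?posrE ?exprn_gt0 ?mulr_gt0//; [|lra..].
by rewrite lerXn2r ?nnegrE; nra.
Qed.
End reciprocal_telescoping.

(** * The tail of the squared scalar coefficients *)

Section coefficient_tail.
Context {R : realType}.
Variables (t z : R).
Hypotheses (z0 : z <= 0) (tge0 : 0 <= t).
Local Notation u k := (phicos_scalar k t z ^+ 2).

Let pi3 : 3 <= pi :> R := pi_ge3.
Let pi0 : 0 < pi :> R := pi_gt0 R.

Lemma lambdaS (k : nat) : lambda k.+1 = (k%:R + 2^-1) * pi :> R.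
Proof. by rewrite /lambda -natr1; congr (_ * _); field. Qed.

(** Here lambda k.+1 * t <= pi, so the sine is nonnegative. *)
Lemma phicos_scalar_sqr_le_small_phase (k : nat) : (0 < k)%N -> (k%:R + 2^-1) * t <= 1 ->
  u k.+1 <= (k%:R^-1 - k.+1%:R^-1) / pi ^+ 2.
Proof.
move=> k0 kt; have k1 : 1 <= k%:R :> R by rewrite ler1n.
have l0 := lambda_gt0 R k.
have H : lambda k.+1 * `|phicos_scalar k.+1 t z| <= 1.
  have := tge0; rewrite le_eqVlt => /predU1P[t00|tp].
    rewrite phicos_scalarE// -t00 !(mul0r, mulr0) expR0 cos0 sin0.
    by rewrite subrr mulr0 addr0 mul0r normr0 mulr0.
  apply: lambda_phicos_scalar_le1 => //; apply: sin_ge0_pi.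
  rewrite lambdaS mulrAC; apply/andP; split.
    by rewrite !mulr_ge0 ?(ltW pi0)//; lra.
  by rewrite ger_pMl.
have : u k.+1 <= (lambda k.+1 ^+ 2)^-1.
  rewrite -real_normK ?num_real// -exprVn lerXn2r ?nnegrE ?invr_ge0 ?(ltW l0)//.
  by rewrite -[leRHS]mul1r ler_pdivlMr// mulrC.
move=> /le_trans; apply; rewrite lambdaS exprMn invfM ler_pM2r ?invr_gt0 ?exprn_gt0//.
by rewrite -[k.+1%:R]natr1; apply: inv_half_sqr_le_telescope; lra.
Qed.

(** For t >= 4/15 the correction (2/5) / (lambda t) is at most
1 / (2 k), which amounts to replacing lambda = (k + 1/2) pi by k pi. *)
Lemma phicos_scalar_sqr_le_large_time (k : nat) : (1 < k)%N -> 4 / 15 <= t ->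
  u k.+1 <= ((k%:R - 1)^-1 - k%:R^-1) / pi ^+ 2.
Proof.
move=> k0 kt; have k1 : 2 <= k%:R :> R by rewrite (ler_nat _ 2).
have l0 := lambda_gt0 R k.
have tp : 0 < t by lra.
have H := lambda_phicos_scalar_le z0 tp l0.
have : u k.+1 <= ((k%:R * pi) ^+ 2)^-1.
  rewrite -real_normK ?num_real// -exprVn lerXn2r ?nnegrE ?invr_ge0 ?mulr_ge0 ?(ltW pi0)//.
  rewrite -(ler_pM2l l0) (le_trans H)//.
  have := sin_max (lambda k.+1 * t); move: `|sin _| => S S1.
  rewrite lambdaS.
  have -> : (k%:R + 2^-1) * pi / (k%:R * pi) = 1 + 1 / (2 * k%:R) :> R.
    by move: (pi : R) pi0 => q q0; field; rewrite !gt_eqF//; apply: lt_le_trans k1.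
  apply: lerD; first lra.
  rewrite ler_pdivrMr; last by rewrite !mulr_gt0//; lra.
  rewrite mulrAC ler_pdivlMr; last by lra.
  have : 3 * (4 / 15) <= pi * t by rewrite ler_pM//; lra.
  by rewrite mul1r -[X in _ -> _ <= X]mulrA; move: (pi * t) => q q0; nra.
move=> /le_trans; apply; rewrite exprMn invfM ler_pM2r ?invr_gt0 ?exprn_gt0//.
by apply: inv_sqr_le_telescope; lra.
Qed.

Let theta := pi * t.

(** The majorant for the sum of - cos (2 lambda t) / (4 (k + 1/2)^2), by Abel
summation: the cosines are differences of sines divided by 2 sin theta, and
adding 1 to the sines makes the boundary terms nonnegative. *)
Let osc (k : nat) : R :=
  (8 * sin theta)^-1 * ((1 + sin (2 * k%:R * theta)) / (k%:R + 2^-1) ^+ 2).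

Lemma osc_telescope (k : nat) : 0 < sin theta ->
  - cos (2 * (lambda k.+1 * t)) / 4 / (k%:R + 2^-1) ^+ 2 <= osc k - osc k.+1.
Proof.
move=> st; have k0 : 0 <= k%:R :> R by rewrite ler0n.
have -> : 2 * (lambda k.+1 * t) = (2 * k%:R + 1) * theta.
  by rewrite lambdaS /theta; move: (pi : R) => q; field.
have E : - cos ((2 * k%:R + 1) * theta) / 4 =
    (8 * sin theta)^-1 * (sin (2 * k%:R * theta) - sin (2 * k.+1%:R * theta)).
  have -> : 2 * k%:R * theta = (2 * k%:R + 1) * theta - theta by ring.
  have -> : 2 * k.+1%:R * theta = (2 * k%:R + 1) * theta + theta.
    by rewrite -[k.+1%:R]natr1; ring.
  rewrite sinB sinD; move: (sin theta) (sin _) (cos theta) (cos _) st => a b c e a0.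
  by field; rewrite gt_eqF.
rewrite E -[leLHS]mulrA /osc -mulrBr ler_pM2l ?invr_gt0 ?mulr_gt0//.
have := sin_geN1 (2 * k.+1%:R * theta).
have : (((k.+1%:R + 2^-1) ^+ 2)^-1 <= ((k%:R + 2^-1) ^+ 2)^-1 :> R).
  by rewrite -[k.+1%:R]natr1 lef_pV2 ?posrE; nra.
move: (sin _) (sin _) (_^-1) (_^-1) => a b p q pq a1.
have : 0 <= (1 + b) * (p - q) by rewrite mulr_ge0; lra.
lra.
Qed.

(** Each of the four terms majorises the tail of one term of
(3/4 + 2 eps + eps^2 - cos (2 lambda t) / 4) / lambda^2, with
eps = (2/5) / (lambda t); in the third one, eps^2 is replaced by its value at
the start m of the tail. *)
Let majorant (m k : nat) : R := (3 / 4 / k%:R + 2 / 5 / theta / k%:R ^+ 2 +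
  (2 / 5 / ((m%:R + 2^-1) * theta)) ^+ 2 / k%:R + osc k) / pi ^+ 2.

(** Squaring the bound of lambda_phicos_scalar_le and using
((1 + |s|) / 2)^2 <= (1 + s^2) / 2 = 3/4 - cos (2 lambda t) / 4. Averaging the
cosine over k leaves the factor 3/4, and this gain pays for the terms in eps. *)
Lemma phicos_scalar_sqr_le_oscillating (m k : nat) : (0 < m)%N -> (m <= k)%N ->
  0 < t -> 0 < sin theta -> u k.+1 <= majorant m k - majorant m k.+1.
Proof.
move=> m0 mk t0 st.
have m1 : 1 <= m%:R :> R by rewrite ler1n.
have k1 : m%:R <= k%:R :> R by rewrite ler_nat.
have l0 := lambda_gt0 R k.
have H := lambda_phicos_scalar_le z0 t0 l0.
have theta0 : 0 < theta by rewrite mulr_gt0.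
have T4 := osc_telescope k st.
have H2 : lambda k.+1 ^+ 2 * u k.+1 <= 3 / 4 - cos (2 * (lambda k.+1 * t)) / 4 +
    2 * (2 / 5 / (lambda k.+1 * t)) + (2 / 5 / (lambda k.+1 * t)) ^+ 2.
  rewrite -exprMn -real_normK ?num_real// normrM (gtr0_norm l0).
  have e0 : 0 <= 2 / 5 / (lambda k.+1 * t) by apply: divr_ge0; [lra|exact/ltW/mulr_gt0].
  have := sin_max (lambda k.+1 * t); have := normr_ge0 (sin (lambda k.+1 * t)).
  have : cos (2 * (lambda k.+1 * t)) = 1 - 2 * `|sin (lambda k.+1 * t)| ^+ 2.
    by rewrite cos_double real_normK ?num_real.
  have : 0 <= lambda k.+1 * `|phicos_scalar k.+1 t z| by rewrite mulr_ge0// ltW.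
  move: (cos _) `|sin _| (lambda _ * `|_|) (2 / 5 / _) H e0 => C S v e H e0 v0 -> S0 S1.
  have : v ^+ 2 <= ((1 + S) / 2 + e) ^+ 2 by rewrite lerXn2r ?nnegrE//; lra.
  have : (1 - S) ^+ 2 >= 0 by rewrite sqr_ge0.
  have : 0 <= (1 - S) * e by rewrite mulr_ge0//; lra.
  nra.
have -> : u k.+1 = (lambda k.+1 ^+ 2 * u k.+1) / (k%:R + 2^-1) ^+ 2 / pi ^+ 2.
  have E : (k%:R + 2^-1) ^+ 2 * pi ^+ 2 = lambda k.+1 ^+ 2 :> R.
    by rewrite lambdaS exprMn.
  rewrite -mulrA -invfM E mulrAC divff ?mul1r//.
  by rewrite sqrf_eq0 gt_eqF.
rewrite /majorant -mulrBl ler_pM2r ?invr_gt0 ?exprn_gt0//.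
have h0 : 0 < k%:R + 2^-1 :> R by lra.
apply: (@le_trans _ _ ((3 / 4 - cos (2 * (lambda k.+1 * t)) / 4 +
    2 * (2 / 5 / (lambda k.+1 * t)) + (2 / 5 / (lambda k.+1 * t)) ^+ 2) / (k%:R + 2^-1) ^+ 2)).
  by rewrite ler_pM2r ?invr_gt0 ?exprn_gt0.
have T1 := @inv_half_sqr_le_telescope R k%:R ltac:(lra).
have T2 := @inv_half_cube_le_telescope R k%:R ltac:(lra).
have -> : lambda k.+1 * t = (k%:R + 2^-1) * theta by rewrite lambdaS mulrA.
have T3 : (2 / 5 / ((k%:R + 2^-1) * theta)) ^+ 2 <= (2 / 5 / ((m%:R + 2^-1) * theta)) ^+ 2.
  have mt0 : 0 < (m%:R + 2^-1) * theta by rewrite mulr_gt0//; lra.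
  have kt0 : 0 < (k%:R + 2^-1) * theta by rewrite mulr_gt0.
  have c0 : 0 < 2 / 5 :> R by lra.
  rewrite lerXn2r ?nnegrE ?divr_ge0 ?(ltW c0) ?(ltW mt0) ?(ltW kt0)//.
  by rewrite ler_pM2l ?lef_pV2 ?posrE ?ler_pM2r//; lra.
have -> : 2 * (2 / 5 / ((k%:R + 2^-1) * theta)) = 2 / 5 / theta * 2 / (k%:R + 2^-1).
  by field; rewrite !gt_eqF.
move: T4; rewrite (_ : lambda k.+1 * t = (k%:R + 2^-1) * theta); last by rewrite lambdaS mulrA.
move: (osc k) (osc k.+1) (cos _) => o o' C T4.
have T3' := ler_pM (sqr_ge0 _) _ T3 T1.
rewrite [X in X <= _]mulrDl [X in X + _ <= _]mulrDl.
rewrite -[k.+1%:R]natr1 in T3' *.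
have p0 : 0 <= ((k%:R + 2^-1) ^+ 2)^-1 :> R by rewrite invr_ge0 sqr_ge0.
have w0 : 0 <= 2 / 5 / theta by rewrite divr_ge0 ?(ltW theta0)//; lra.
have T2' := ler_wpM2l w0 T2.
rewrite -[X in _ + X + _ <= _]mulrA -invfM -exprS.
move: (2 / 5 / theta) ((2 / 5 / _) ^+ 2) ((2 / 5 / _) ^+ 2) T3' T2' => w e e' /(_ p0) T3' T2'.
move: T1 T2' T3' T4 => T1 T2' T3' T4; lra.
Qed.

Lemma sin_theta_ge : t <= 4 / 15 -> 64 / 25 * t <= sin theta.
Proof.
move=> t1; have p72 := @pi_le72 R.
have x1 : theta <= 14 / 15 by apply: le_trans (ler_pM (ltW pi0) tge0 p72 t1) _; lra.
have x0 : 3 * t <= theta by rewrite ler_wpM2r.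
have th0 : 0 <= theta by rewrite mulr_ge0// ltW.
have := sin_ge_cubic th0.
apply: le_trans; move: theta x1 x0 th0 => x x1 x0 xp.
have : x ^+ 2 <= (14 / 15) ^+ 2 by rewrite lerXn2r ?nnegrE//; lra.
have -> : x - x ^+ 3 / 6 = x * (1 - x ^+ 2 / 6) by ring.
nra.
Qed.

(** With y = 1 / m, and by pi >= 3, (m + 1/2) t >= 1 and sin (pi t) >= (64/25) t,
the four terms of the majorant at m add up to at most
(3/4 + 2/15 + 4/225 + 25/256) y + y^2 / 15 <= y + y^2 <= 1 / (m - 1), the first
coefficient being about 0.9988. *)
Lemma phicos_scalar_tail_oscillating (m N : nat) : (1 < m)%N ->
  t <= 4 / 15 -> 1 <= (m%:R + 2^-1) * t ->
  \sum_(m.+1 <= k < N) u k <= (m%:R - 1)^-1 / pi ^+ 2.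
Proof.
move=> m1 t1 mt.
have m2 : 2 <= m%:R :> R by rewrite (ler_nat _ 2).
have t0 : 0 < t by rewrite lt_neqAle tge0 andbT; apply/eqP => t00; move: mt; rewrite -t00 mulr0; lra.
have st := sin_theta_ge t1.
have st0 : 0 < sin theta by apply: lt_le_trans st; lra.
have theta0 : 0 < theta by rewrite mulr_gt0.
apply: (le_trans (sum_le_telescope N (b := majorant m) _ _)).
- by move=> k mk; apply: phicos_scalar_sqr_le_oscillating => //; exact: ltnW.
- move=> k mk; have k0 : 0 <= k%:R :> R by [].
  rewrite /majorant divr_ge0 ?sqr_ge0// !addr_ge0 ?divr_ge0 ?sqr_ge0 ?(ltW theta0)//.
  rewrite mulr_ge0 ?invr_ge0 ?mulr_ge0 ?(ltW st0)// divr_ge0 ?sqr_ge0//.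
rewrite /majorant ler_pM2r ?invr_gt0 ?exprn_gt0// /osc.
have T : 3 <= (m%:R + 2^-1) * theta.
  rewrite mulrCA -[leLHS]mulr1 ler_pM//; lra.
have b1 : 2 / 5 / theta <= 2 / 15 * (m%:R + 2^-1).
  by rewrite ler_pdivrMr//; move: ((m%:R + _) * theta) T (mulrA (2 / 15) (m%:R + 2^-1) theta) => A TA <-; lra.
have b2 : (2 / 5 / ((m%:R + 2^-1) * theta)) ^+ 2 <= (2 / 15) ^+ 2.
  have A0 : 0 < (m%:R + 2^-1) * theta by apply: lt_le_trans T; lra.
  rewrite lerXn2r ?nnegrE ?divr_ge0 ?(ltW A0)//.
  by rewrite ler_pdivrMr//; lra.
have b3 : (8 * sin theta)^-1 * ((1 + sin (2 * m%:R * theta)) / (m%:R + 2^-1) ^+ 2)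
   <= 25 / 256 / m%:R.
  have h0 : 0 < m%:R + 2^-1 :> R by lra.
  have S1 := sin_le1 (2 * m%:R * theta).
  apply: (@le_trans _ _ ((4 * (sin theta * (m%:R + 2^-1) ^+ 2))^-1)).
    have -> : (4 * (sin theta * (m%:R + 2^-1) ^+ 2))^-1 =
        (8 * sin theta)^-1 * (2 / (m%:R + 2^-1) ^+ 2).
      by move: (sin theta) (m%:R + 2^-1) st0 h0 => s h s0 h0; field; rewrite !gt_eqF.
    rewrite ler_pM2l ?invr_gt0 ?mulr_gt0// ler_pM2r ?invr_gt0 ?exprn_gt0//; lra.
  have -> : 25 / 256 / m%:R = (4 * (64 / 25 * m%:R))^-1 :> R.
    by field; rewrite gt_eqF//; lra.
  rewrite lef_pV2 ?posrE ?mulr_gt0 ?exprn_gt0//; [|lra..].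
  rewrite ler_pM2l//; apply: (@le_trans _ _ (64 / 25 * t * (m%:R + 2^-1) ^+ 2)).
    rewrite -[leRHS]mulrA ler_pM2l; last lra.
    by move: (m%:R : R) m2 mt => x x2 xt; nra.
  by rewrite ler_pM2r// exprn_gt0.
move: ((8 * sin theta)^-1 * _) (2 / 5 / theta) ((2 / 5 / _) ^+ 2) b1 b2 b3 => o w e b1 b2 b3.
have y0 : 0 < m%:R^-1 :> R by rewrite invr_gt0; lra.
have my : m%:R * m%:R^-1 = 1 :> R by rewrite divff// gt_eqF//; lra.
have b4 : m%:R^-1 + m%:R^-1 ^+ 2 <= (m%:R - 1)^-1 :> R.
  rewrite -[leRHS]mul1r ler_pdivlMr; last lra.
  move: (m%:R : R) (m%:R^-1 : R) my y0 m2 => x y xy y0 x2.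
  have -> : (y + y ^+ 2) * (x - 1) = x * y + y * (x * y) - y - y ^+ 2 by ring.
  rewrite xy; have := sqr_ge0 y; lra.
rewrite -exprVn; apply: le_trans b4.
have b5 : w * m%:R^-1 ^+ 2 <= 2 / 15 * (m%:R^-1 + m%:R^-1 ^+ 2).
  apply: (le_trans (ler_wpM2r (sqr_ge0 _) b1)).
  move: (m%:R : R) (m%:R^-1 : R) my y0 => x y xy y0.
  have -> : 2 / 15 * (x + 2^-1) * y ^+ 2 = 2 / 15 * (x * y * y + 2^-1 * y ^+ 2) by ring.
  by rewrite xy; have := sqr_ge0 y; lra.
have b6 : e * m%:R^-1 <= (2 / 15) ^+ 2 * m%:R^-1 by rewrite ler_wpM2r// ltW.
move: (m%:R^-1 : R) y0 b3 b5 b6 => y y0 b3 b5 b6; have := sqr_ge0 y; lra.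
Qed.

(** For t >= 4/15 every single term is small enough. For smaller t the terms with
lambda t <= pi are, and are peeled off one by one until the remaining tail
starts in the oscillating regime; at t = 0 this never happens, and all terms
are of the first kind. *)
Lemma phicos_scalar_tail (m N : nat) : (1 < m)%N ->
  \sum_(m.+1 <= k < N) u k <= (m%:R - 1)^-1 / pi ^+ 2.
Proof.
pose b (k : nat) : R := (k%:R - 1)^-1 / pi ^+ 2.
have b0 k : (1 < k)%N -> 0 <= b k.
  by move=> k1; rewrite divr_ge0 ?sqr_ge0 ?invr_ge0 ?subr_ge0 ?ler1n// ltnW.
have bS k : b k.+1 = k%:R^-1 / pi ^+ 2 by rewrite /b -natr1 addrK.
have small_phase k : (1 < k)%N -> (k%:R + 2^-1) * t <= 1 -> u k.+1 <= b k - b k.+1.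
  move=> k1 kt; apply: (le_trans (phicos_scalar_sqr_le_small_phase (ltnW k1) kt)).
  rewrite bS -mulrBl ler_pM2r ?invr_gt0 ?exprn_gt0//.
  have k2 : 2 <= k%:R :> R by rewrite (ler_nat _ 2).
  rewrite -[k.+1%:R]natr1; have -> : k%:R^-1 - (k%:R + 1)^-1 = (k%:R * (k%:R + 1))^-1 :> R.
    by field; apply/andP; split; apply/eqP; lra.
  have -> : (k%:R - 1)^-1 - k%:R^-1 = ((k%:R - 1) * k%:R)^-1 :> R.
    by field; apply/andP; split; apply/eqP; lra.
  by rewrite lef_pV2 ?posrE; nra.
have [t1 m1|t1 m1] := leP (4 / 15) t.
  apply: (sum_le_telescope N (b := b)) => k mk; last by apply: b0; exact: leq_trans mk.
  by rewrite bS -mulrBl; apply: phicos_scalar_sqr_le_large_time => //; exact: leq_trans mk.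
have := tge0; rewrite le_eqVlt => /predU1P[t00|t0].
  apply: (sum_le_telescope N (b := b)) => k mk; last by apply: b0; exact: leq_trans mk.
  by apply: small_phase; [exact: leq_trans mk|rewrite -t00 mulr0].
have [M Mt] : exists M : nat, 1 <= M%:R * t.
  exists (Num.bound t^-1); rewrite -ler_pdivrMr// mul1r.
  by apply/ltW/archi_boundP; rewrite invr_ge0 ltW.
have [j jm] : exists j, (M <= m + j)%N by exists M; rewrite leq_addl.
elim: j m m1 jm => [|j IH] m m1 jm.
  apply: phicos_scalar_tail_oscillating => //; first exact: ltW.
  apply: le_trans Mt _; rewrite ler_pM2r//; rewrite addn0 in jm.
  have : M%:R <= m%:R :> R by rewrite ler_nat.
  lra.
have [mt|mt] := leP 1 ((m%:R + 2^-1) * t).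
  by apply: phicos_scalar_tail_oscillating => //; exact: ltW.
have [Nm|mN] := leqP N m.+1; first by rewrite big_geq// b0.
rewrite big_ltn//; have := IH m.+1 (ltnW m1); rewrite addSnnS => /(_ jm) H.
have := small_phase m m1 (ltW mt); rewrite -/(b m); rewrite -/(b m.+1) in H; lra.
Qed.

End coefficient_tail.

(** * The Wiener process and its Karhunen-Loeve basis *)

Section generated_sigma_algebra.
Context d (T : measurableType d) (R : realType).
Context (I : Type) (X : I -> T -> R).
Implicit Type D : set I.

Lemma sigma_of_sigma_algebra D : sigma_algebra setT (sigma_of D X).
Proof. exact: smallest_sigma_algebra. Qed.

Lemma sigma_of_adapted D i : D i -> adapted (sigma_of D X) (X i).
Proof.
move=> Di A mA; apply: sub_gen_smallest; exists i => //.
by exists A => //; rewrite setTI.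
Qed.

Lemma sigma_of_le D (G : set (set T)) : sigma_algebra setT G ->
  (forall i, D i -> adapted G (X i)) -> sigma_of D X `<=` G.
Proof.
move=> sG aX; apply: smallest_sub => // _ [i Di [A mA <-]].
by rewrite setTI; exact: aX.
Qed.

End generated_sigma_algebra.

Section gaussian_data.
Context (R : realType) d (T : measurableType d) (P : probability T R) (n : nat).

Lemma standard_wiener_brownian (W : R -> 'I_n -> {RV P >-> R}) (j : 'I_n) :
  standard_wiener `[0, 1]%classic W ->
  brownian P (natural_filtration `[0, 1]%classic W) (fun s => W s j).
Proof.
move=> sw; split.
- by move=> s; exact: sigma_of_sigma_algebra.
- move=> s; apply: sigma_of_le; first exact: sigma_algebra_measurable.
  by move=> [u i] _ A mA; rewrite -[_ @^-1` _]setTI; exact: measurable_funPT.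
- move=> s t st; apply: sigma_of_le; first exact: sigma_of_sigma_algebra.
  move=> [u i] [Du us]; apply: (@sigma_of_adapted _ _ _ _ (fun uj => W uj.1 uj.2) _ (u, i)).
  by split => //=; exact: le_trans st.
- move=> s t s0 st t1.
  have a (u : R) : 0 <= u -> u <= t -> adapted (natural_filtration `[0, 1]%classic W t) (W u j).
    move=> u0 ut; apply: (@sigma_of_adapted _ _ _ _ (fun uj => W uj.1 uj.2) _ (u, j)).
    by split => //=; rewrite in_itv/= u0 (le_trans ut).
  have sF := @sigma_of_sigma_algebra _ T R _ (fun uj : R * 'I_n => W uj.1 uj.2)
    [set uj | `[0, 1]%classic uj.1 /\ uj.1 <= t].
  apply/(adaptedP _ sF); apply: measurable_funB; apply/(adaptedP _ sF); apply: a => //.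
  exact: le_trans st.
- move=> s t s0 st t1.
  by apply: (wiener_increment_law sw); rewrite //= in_itv/= ?s0 ?t1 ?(le_trans (ltW st)) ?(le_trans s0 (ltW st)).
- move=> s t s0 st t1 A B FA mB.
  apply: (wiener_increment_independent sw (s := s) (t := t)) => //=.
  + by rewrite in_itv/= s0 (le_trans (ltW st)).
  + by rewrite in_itv/= t1 (le_trans s0 (ltW st)).
  + exact: (@sigma_of_adapted _ _ _ _ (fun i : 'I_n => W t i \- W s i) setT j).
Qed.

(** Independent variables of mean 0 and variance 1 are orthonormal. *)
Lemma iid_standard_normal_orthonormal (Z : nat -> 'I_n -> {RV P >-> R}) :
  iid_standard_normal Z ->
  orthonormal_rv P (fun kj : nat * 'I_n => Z kj.1.+1 kj.2 : T -> R).
Proof.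
move=> [law indep].
have m (kj : nat * 'I_n) : measurable_fun setT (Z kj.1.+1 kj.2) by exact: measurable_funPT.
have l (kj : nat * 'I_n) : has_law P (Z kj.1.+1 kj.2) (normal_prob 0 1) by exact: law.
have Z2 kj : L2 P (Z kj.1.+1 kj.2).
  by split => //; exact: (normal_sqr_integrable ltr01 (m kj) (l kj)).
split => // a b; have [<-|ab] := eqVneq a b.
  apply/EFin_inj.
  have := normal_sqr_integral ltr01 (m a) (l a); rewrite expr1n => <-.
  exact: sqnE.
have Z1 kj := L2_L1 (Z2 kj).
have [|_ E] := @integral_mul_indep _ _ _ P (Z a.1.+1 a.2) (Z b.1.+1 b.2) _ (Z1 a) (Z1 b).
  move=> A B mA mB.
  have := indep [:: a; b] (fun i => if i == a then A else B).
  rewrite /= inE ab => /(_ isT); rewrite !big_cons big_nil mule1 eqxx.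
  rewrite eq_sym (negbTE ab) => <-; last by move=> i; case: ifP.
  congr (P _); apply/seteqP; split => w /=.
    by move=> [wa wb] i /=; rewrite !inE => /orP[]/eqP ->; rewrite ?eqxx// eq_sym (negbTE ab).
  move=> H; split; first by have := H a; rewrite /= eqxx; apply; rewrite inE eqxx.
  by have := H b; rewrite /= eq_sym (negbTE ab); apply; rewrite !inE eqxx orbT.
by rewrite ipE /Rintegral E (normal_integral0 ltr01 (m a) (l a)) mul0e.
Qed.

(** One coordinate of the error is dominated by its Euclidean norm. That the
error is finite for some N also gives the square integrability of W b j. *)
Lemma karhunen_loeve_component (W : R -> 'I_n -> {RV P >-> R})
    (Z : nat -> 'I_n -> {RV P >-> R}) (j : 'I_n) (b : R) :
  iid_standard_normal Z -> karhunen_loeve W Z -> 0 <= b <= 1 ->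
  L2 P (W b j) /\
  sqn P (fun w => W b j w - \sum_(0 <= k < N)
    (Num.sqrt 2 * (sin (lambda k.+1 * b) / lambda k.+1)) * Z k.+1 j w) @[N --> \oo] --> (0 : R).
Proof.
move=> iid kl b01; have [Z2 _] := iid_standard_normal_orthonormal iid.
pose S i N w := \sum_(0 <= k < N)
    (Num.sqrt 2 * (sin (lambda k.+1 * b) / lambda k.+1)) * Z k.+1 i w.
have S2 i N : L2 P (S i N) by apply: L2_sum => k; apply: L2Z; exact: (Z2 (k, i)).
have mD i N : measurable_fun setT (fun w => W b i w - S i N w).
  by apply: measurable_funB; [exact: measurable_funPT|case: (S2 i N)].
have vE N w : vnorm2 (rvec (W b) w - Num.sqrt 2 *:
       \sum_(1 <= k < N.+1) (sin (lambda k * b) / lambda k) *: rvec (Z k) w) ^+ 2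
    = \sum_i (W b i w - S i N w) ^+ 2.
  rewrite vnorm2_sqr; apply: eq_bigr => i _; rewrite !mxE summxE big_add1 /= mulr_sumr.
  by congr ((_ - _) ^+ 2); apply: eq_bigr => k _; rewrite !mxE mulrA.
have := kl b b01; rewrite unlock => /(ecvg0_near _) H.
have {}H e : 0 < e -> \forall N \near \oo, (\int[P]_w ((W b j w - S j N w) ^+ 2)%:E < e%:E)%E.
  move=> /H; apply: filterS => N; apply: le_lt_trans.
  apply: ge0_le_integral => //.
  - by move=> w _; rewrite lee_fin sqr_ge0.
  - by apply/measurable_EFinP; apply: measurable_funX.
  - under eq_fun do rewrite vE.
    by apply/measurable_EFinP; apply: measurable_sum => i; exact: measurable_funX.
  - move=> w _; rewrite lee_fin vE (bigD1 j)//= lerDl sumr_ge0// => i _.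
    exact: sqr_ge0.
have D2 : exists N, L2 P (fun w => W b j w - S j N w).
  have [N _ /(_ N (leqnn N)) HN] := H _ ltr01; exists N; split => //.
  apply/integrableP; split; first by apply/measurable_EFinP; apply: measurable_funX.
  under eq_integral do rewrite gee0_abs ?lee_fin ?sqr_ge0//.
  by rewrite (lt_trans HN) ?ltry.
have W2 : L2 P (W b j).
  have [N DN] := D2.
  rewrite (_ : W b j = (fun w => (W b j w - S j N w) + S j N w) :> (T -> R)).
    exact: L2D.
  by apply/funext => w; rewrite subrK.
split=> //; apply/cvgr0Pnorm_lt => e e0.
have := H e e0; apply: filterS => N.
rewrite ger0_norm; last exact: sqn_ge0.
by rewrite -sqnE ?lte_fin//; exact: L2B.
Qed.

(** * The mean-square error *)

Section error_expansion.
Variables (L B : 'M[R]_n) (t : R) (m : nat).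
Variables (Z : nat -> 'I_n -> {RV P >-> R}) (I : 'I_n -> 'I_n -> {RV P >-> R}).
Local Notation a k i j := (Num.sqrt 2 * (phicos k.+1 t L *m B) i j).
Hypothesis Z_on : orthonormal_rv P (fun kj : nat * 'I_n => Z kj.1.+1 kj.2 : T -> R).
Hypothesis I2 : forall i j, L2 P (I i j).
Hypothesis I_series : forall i j,
  sqn P (fun w => I i j w - \sum_(0 <= k < N) a k i j * Z k.+1 j w) @[N --> \oo] --> (0 : R).

Definition error_component i w : R :=
  \sum_j (I i j w - \sum_(0 <= k < m) a k i j * Z k.+1 j w).

Let Z2 k j : L2 P (Z k.+1 j). Proof. by have [h _] := Z_on; exact: (h (k, j)). Qed.

Lemma cvg_sqn_sum (J : Type) (s : seq J) (X : J -> nat -> T -> R) :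
  (forall j N, L2 P (X j N)) ->
  (forall j, sqn P (X j N) @[N --> \oo] --> (0 : R)) ->
  sqn P (fun w => \sum_(j <- s) X j N w) @[N --> \oo] --> (0 : R).
Proof.
move=> X2 X0; elim: s => [|j s IH].
  rewrite (_ : (fun N => _) = fun=> 0); first exact: cvg_cst.
  by apply/funext => N; under eq_fun do rewrite big_nil; rewrite sqn0.
apply: cvg0_le (cvg0_comb 2 2 (X0 j) IH) => N.
under eq_fun do rewrite big_cons.
rewrite sqn_ge0/= sqnD_le//; exact: L2_sum.
Qed.

Let tail i N w : R := \sum_j \sum_(m <= k < N) a k i j * Z k.+1 j w.

Let L2_tail i N : L2 P (tail i N).
Proof. by apply: L2_sum => j; apply: L2_sum => k; exact: L2Z. Qed.

Lemma L2_error_component i : L2 P (error_component i).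
Proof. by apply: L2_sum => j; apply: L2B => //; apply: L2_sum => k; exact: L2Z. Qed.

Let sqn_tail i N : sqn P (tail i N) = \sum_(m <= k < N) \sum_j a k i j ^+ 2.
Proof.
pose s := [seq (k, j) | k <- index_iota m N, j <- index_enum 'I_n].
have us : uniq s.
  by apply: allpairs_uniq; rewrite ?iota_uniq ?index_enum_uniq// => -[? ?] [? ?] _ _ [-> ->].
transitivity (\sum_(kj <- s) (a kj.1 i kj.2) ^+ 2).
  rewrite -(sqn_lincomb Z_on (fun kj => a kj.1 i kj.2) us).
  congr (sqn P _); apply/funext => w.
  by rewrite big_allpairs /tail exchange_big.
by rewrite big_allpairs.
Qed.

Let cvg_tail i : sqn P (fun w => error_component i w - tail i N w) @[N --> \oo] --> (0 : R).
Proof.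
apply: cvg_trans (@cvg_sqn_sum _ (index_enum 'I_n)
  (fun j N w => I i j w - \sum_(0 <= k < N) a k i j * Z k.+1 j w) _ (I_series i)).
  apply: near_eq_cvg; near=> N; congr (sqn P _); apply/funext => w.
  rewrite /error_component /tail -sumrB; apply: eq_bigr => j _.
  rewrite (@big_cat_nat _ _ _ m 0 N)//=; last by near: N; exact: nbhs_infty_ge.
  by rewrite opprD addrA.
by move=> j N; apply: L2B => //; apply: L2_sum => k; exact: L2Z.
Unshelve. all: by end_near. Qed.

(** Parseval: by I_series, the i-th component of the error is the L^2 limit of
the sums over j and over m <= k < N of its terms, which are orthogonal. *)
Lemma sum_sqn_error_component :
  2 * \sum_(m.+1 <= k < N) frobenius (phicos k t L *m B) ^+ 2 @[N --> \oo] -->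
  \sum_i sqn P (error_component i).
Proof.
have E N : 2 * \sum_(m.+1 <= k < N.+1) frobenius (phicos k t L *m B) ^+ 2 =
    \sum_i sqn P (tail i N).
  under [RHS]eq_bigr do rewrite sqn_tail.
  rewrite exchange_big/= big_add1/= mulr_sumr; apply: eq_bigr => k _.
  rewrite frobenius_sqr mulr_sumr; apply: eq_bigr => i _.
  by rewrite mulr_sumr; apply: eq_bigr => j _; rewrite exprMn sqr_sqrtr.
rewrite -cvg_shiftS (funext E).
apply: cvg_big => // [|i _]; first exact: add_continuous.
by apply: sqn_cvg => //; exact: L2_error_component.
Qed.

End error_expansion.

End gaussian_data.

(** In the eigenbasis, the squared Frobenius norm is at most the sum over r of
phicos_scalar (e r)^2 times the squared length of the r-th row of V B. The sum
over k is bounded for each eigenvalue separately, and the rows of V B have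
total squared length at most opnorm2 B ^ 2 * n. *)
Lemma frobenius_phicos_tail (R : realType) (n m N : nat) (L B : 'M[R]_n) (t : R) :
  negative_semidefinite L -> 0 <= t -> (1 < m)%N ->
  \sum_(m.+1 <= k < N) frobenius (phicos k t L *m B) ^+ 2 <=
  (m%:R - 1)^-1 / pi ^+ 2 * (opnorm2 B ^+ 2 * n%:R).
Proof.
move=> Lnsd t0 m1; have [q [V [e [VV e0 LX]]]] := nsd_spectral Lnsd.
pose c (r : 'I_q) := \sum_j (V *m B) r j ^+ 2.
have c0 r : 0 <= c r by apply: sumr_ge0 => j _; exact: sqr_ge0.
apply: (@le_trans _ _ (\sum_(m.+1 <= k < N) \sum_r phicos_scalar k t (e r) ^+ 2 * c r)).
  apply: ler_sum => k _; apply: (frobenius_spectral_le VV) => i j.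
  exact: phicos_spectral.
rewrite exchange_big/=; under eq_bigr do rewrite -mulr_suml.
apply: (@le_trans _ _ (\sum_r (m%:R - 1)^-1 / pi ^+ 2 * c r)).
  by apply: ler_sum => r _; rewrite ler_wpM2r//; exact: phicos_scalar_tail.
rewrite -mulr_sumr ler_wpM2l//.
  by rewrite divr_ge0 ?sqr_ge0// invr_ge0 subr_ge0 ler1n ltnW.
rewrite -(sum_sqr_rows VV) mulr_sumr; apply: ler_sum => r _.
by apply: le_trans (opnorm2_row B (V r)); apply: ler_sum => j _; rewrite mxE.
Qed.

Section expectation.
Context (R : realType) d (T : measurableType d) (P : probability T R) (n : nat).
Variables (L B : 'M[R]_n) (X0 : 'cV[R]_n) (t : R) (m : nat).
Variables (Z : nat -> 'I_n -> {RV P >-> R}) (X : R -> 'I_n -> {RV P >-> R}).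
Variables (I : 'I_n -> 'I_n -> {RV P >-> R}).
Hypothesis XE : {ae P, forall w, forall i,
  X t i w = (expmx (t *: L) *m X0) i 0 + \sum_j I i j w}.
Hypothesis Y2 : forall i, L2 P (error_component L B t m Z I i).

Lemma expectation_sqr_error :
  ('E_P[fun w => (vnorm2 (rvec (X t) w - Xapprox L B X0 Z m t w) ^+ 2)%R] =
  (\sum_i sqn P (error_component L B t m Z I i))%:E)%E.
Proof.
rewrite unlock -sumEFin.
under [RHS]eq_bigr do rewrite sqnE//.
rewrite -integral_sum//; last by move=> i; have [] := Y2 i.
have XaE w i : Xapprox L B X0 Z m t w i 0 = (expmx (t *: L) *m X0) i 0 +
    \sum_j \sum_(0 <= k < m) Num.sqrt 2 * (phicos k.+1 t L *m B) i j * Z k.+1 j w.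
  rewrite /Xapprox mxE; congr (_ + _).
  rewrite mxE summxE big_add1/= mulr_sumr exchange_big/=; apply: eq_bigr => k _.
  by rewrite mxE mulr_sumr; apply: eq_bigr => j _; rewrite [rvec _ _ _ _]mxE mulrA.
have mXa i : measurable_fun setT (fun w => Xapprox L B X0 Z m t w i 0).
  under eq_fun do rewrite XaE.
  apply: measurable_funD; first exact: measurable_cst.
  apply: measurable_sum => j; apply: measurable_sum => k.
  by apply: measurable_funM; [exact: measurable_cst|exact: measurable_funPT].
have dE w i : (rvec (X t) w - Xapprox L B X0 Z m t w) i 0 =
    X t i w - Xapprox L B X0 Z m t w i 0.
  by move: (Xapprox _ _ _ _ _ _ _) => x; rewrite !mxE.
apply: ae_eq_integral => //.
- under eq_fun do rewrite vnorm2_sqr.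
  apply/measurable_EFinP; apply: measurable_sum => i; apply: measurable_funX.
  by under eq_fun do rewrite dE; apply: measurable_funB => //; exact: measurable_funPT.
- apply: emeasurable_sum => i; apply/measurable_EFinP; apply: measurable_funX.
  by have [] := Y2 i.
- apply: filterS XE => w Xw _; rewrite sumEFin; congr EFin.
  rewrite vnorm2_sqr; apply: eq_bigr => i _; congr (_ ^+ 2).
  rewrite dE XaE Xw /error_component sumrB; ring.
Qed.
End expectation.

Theorem theorem6 (R : realType) (d : measure_display) (T : measurableType d)
    (P : probability T R) (n : nat) (L B : 'M[R]_n) (X0 : 'cV[R]_n)
    (W : R -> 'I_n -> {RV P >-> R}) (Z : nat -> 'I_n -> {RV P >-> R})
    (X : R -> 'I_n -> {RV P >-> R}) (t : R) (m : nat) :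
  negative_semidefinite L ->
  standard_wiener `[0, 1]%classic W ->
  iid_standard_normal Z ->
  karhunen_loeve W Z ->
  sde_solution `[0, 1]%classic L B X0 W X ->
  0 <= t <= 1 ->
  (2 <= m)%N ->
  ('E_P[fun w => (vnorm2 (rvec (X t) w - Xapprox L B X0 Z m t w) ^+ 2)%R] =
     2%:E * \sum_(m.+1 <= k <oo) (frobenius (phicos k t L *m B) ^+ 2)%R%:E)%E /\
  (2%:E * \sum_(m.+1 <= k <oo) (frobenius (phicos k t L *m B) ^+ 2)%R%:E <=
     (2 * opnorm2 B ^+ 2 / pi ^+ 2 * (n%:R / (m%:R - 1)))%R%:E)%E.
Proof.
move=> Lnsd sw iid kl sde /andP[t0 t1] m2.
have Z_on := iid_standard_normal_orthonormal iid.
have Zj_on j : orthonormal_rv P (fun k => Z k.+1 j : T -> R).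
  have [Z2 ZZ] := Z_on; split=> [k|k l]; first exact: (Z2 (k, j)).
  by rewrite (ZZ (k, j) (l, j)) xpair_eqE eqxx andbT.
have [|I [I_ito XE]] := sde t; first by rewrite /= in_itv/= t0 t1.
have [q [V [e [VV e0 LX]]]] := nsd_spectral Lnsd.
have bw j := standard_wiener_brownian j sw.
have I2 i j : L2 P (I i j) by exact: (L2_ito_integral (bw j) t1 (I_ito i j)).
have I_series i j : sqn P (fun w => I i j w - \sum_(0 <= k < N)
    Num.sqrt 2 * (phicos k.+1 t L *m B) i j * Z k.+1 j w) @[N --> \oo] --> (0 : R).
  have W2 b (b01 : 0 <= b <= 1) := (karhunen_loeve_component j iid kl b01).1.
  have KL b (b01 : 0 <= b <= 1) := (karhunen_loeve_component j iid kl b01).2.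
  have [K K0 lip] := lipschitz_ito_integrand LX B t i j e0.
  have cf : continuous (ito_integrand L B t i j) by exact: (continuous_ito_integrand LX).
  have cE k : ip P (I i j) (Z k.+1 j) = Num.sqrt 2 * (phicos k.+1 t L *m B) i j.
    rewrite (ip_ito (bw j) (Zj_on j) W2 KL t0 t1 cf K0 lip (I_ito i j)).
    by rewrite (integral_ito_integrand_cos LX).
  have := spanned_ito (bw j) (Zj_on j) W2 KL t0 t1 cf K0 lip (I_ito i j).
  apply: cvg_trans; apply: near_eq_cvg; apply: nearW => N.
  congr (sqn P _); apply/funext => w; congr (_ - _).
  by apply: eq_bigr => k _; rewrite cE.
have Y2 i := L2_error_component L B t m Z_on I2 i.
have EE := expectation_sqr_error XE Y2.
have C := sum_sqn_error_component Z_on I2 I_series.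
set g := fun k => frobenius (phicos k t L *m B) ^+ 2.
pose S := \sum_i sqn P (error_component L B t m Z I i); rewrite -/S in EE C.
have C2 : \sum_(m.+1 <= k < N) g k @[N --> \oo] --> 2^-1 * S.
  rewrite (_ : (fun N => _) = (fun N => 2^-1 * (2 * \sum_(m.+1 <= k < N) g k))).
    exact: cvgMl_tmp.
  by apply/funext => N; rewrite mulKf.
have sumE : (\sum_(m.+1 <= k <oo) (g k)%:E = (2^-1 * S)%:E)%E.
  apply/cvg_lim => //; under eq_fun do rewrite sumEFin.
  by apply: cvg_EFin => //; apply: nearW => N.
rewrite EE sumE -EFinM mulVKf//; split => //.
rewrite lee_fin; have : 2^-1 * S <= (m%:R - 1)^-1 / pi ^+ 2 * (opnorm2 B ^+ 2 * n%:R).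
  rewrite -(cvg_lim _ C2)//; apply: limr_le; first by apply/cvg_ex; exists (2^-1 * S).
  by apply: nearW => N; exact: frobenius_phicos_tail.
move=> H; have -> : S = 2 * (2^-1 * S) by rewrite mulVKf.
apply: le_trans (ler_wpM2l (ler0n _ 2) H) _; rewrite le_eqVlt; apply/orP; left; apply/eqP.
by move: (opnorm2 B) (m%:R - 1)^-1 (pi ^+ 2)^-1 => a b c; ring.
Qed.
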